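(* For every $p\in(1,\infty)$ and every (arbitrarily small) $\delta>0$ there exist weights $w,v$ on $\mathbb{R}$ satisfying $$\sup_{I}\Big(\frac1{|I|}\int_I w(x)\,dx\Big)\Big(\frac1{|I|}\int_I v(x)^{-1/(p-1)}\,dx\Big)^{p-1}<\infty$$ (supremum over all intervals $I\subset\mathbb{R}$), such that the doubling constants of the weights $w$ and $\sigma=v^{-1/(p-1)}$ are bounded by $2+\delta$ and the Hilbert transform $H$ is not a bounded operator acting from $L^p(v)$ to $L^p(w)$. In particular, there exists $f\in L^p(v)$ such that $\|Hf\|_{L^p(w)}=\infty$.
   Context: A weight on $\mathbb{R}$ is a locally integrable function that is positive a.e. The norm in $L^p(w)$ is $\|f\|_{L^p(w)}^p=\int_{\mathbb{R}}|f(x)|^pw(x)\,dx$. The doubling constant of a weight $w$ is $D_w=\sup_I w(2I)/w(I)$, where the supremum is over all (bounded) intervals $I$ in $\mathbb{R}$, $2I$ is the interval with the same center as $I$ and length $2|I|$, and $w(I)=\int_I w\,dx$. $H$ is the Hilbert transform, $Hf(x)=\mathrm{p.v.}\int_{\mathbb{R}}\frac{f(y)}{x-y}\,dy$. *)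

(* Defs.v *)
From HB Require Import structures.
From mathcomp Require Import all_boot all_order all_algebra.
From mathcomp Require Import all_classical all_reals all_analysis.

Set Implicit Arguments.
Unset Strict Implicit.
Unset Printing Implicit Defensive.

Import Order.TTheory GRing.Theory Num.Theory.
Import numFieldNormedType.Exports.

Local Open Scope classical_set_scope.
Local Open Scope ring_scope.

Section weights.
Context {R : realType}.
Implicit Types (w v f : R -> R) (a b p x eps : R).

Let mu := @lebesgue_measure R.

Definition is_weight w : Prop :=
  locally_integrable setT w /\ {ae mu, forall x, 0 < w x}.

Definition wmeas w (A : set R) : \bar R := (\int[mu]_(x in A) (w x)%:E)%E.

(* Intervals I are represented by closed nondegenerate intervals [a, b]:
   endpoints are Lebesgue-null, so open and half-open intervals give the same
   suprema. *)
Definition dbl_itv a b : set R :=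
  `[(a + b) / 2 - (b - a), (a + b) / 2 + (b - a)].

Definition doubling_constant w : \bar R :=
  ereal_sup [set q | exists a b, a < b /\
    q = (wmeas w (dbl_itv a b) / wmeas w `[a, b])%E].

Definition average w a b : \bar R := ((b - a)^-1%:E * wmeas w `[a, b])%E.

Definition dual_weight p v : R -> R := fun x => v x `^ (- (p - 1)^-1).

Definition joint_Ap p w v : \bar R :=
  ereal_sup [set q | exists a b, a < b /\
    q = (average w a b * average (dual_weight p v) a b `^ (p - 1))%E].

Definition weighted_norm p w f : \bar R :=
  ((\int[mu]_x (`|f x| `^ p * w x)%:E) `^ p^-1)%E.

Definition weighted_Lp p w f : Prop :=
  measurable_fun setT f /\ (weighted_norm p w f < +oo)%E.

Definition hilbert_trunc f x eps : R :=
  Rintegral mu [set y | eps < `|x - y|] (fun y => f y / (x - y)).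

(* A meaningful value at x only where [hilbert_defined f x] holds; both [lim]
   and [Rintegral] are total and default to 0. *)
Definition hilbert f x : R := lim (hilbert_trunc f x eps @[eps --> 0^'+]).

Definition hilbert_defined f x : Prop :=
  (forall eps, 0 < eps ->
    mu.-integrable [set y | eps < `|x - y|] (fun y => (f y / (x - y))%:E)) /\
  cvg (hilbert_trunc f x eps @[eps --> 0^'+]).

Definition bounded_weighted_Lp p v w (T : (R -> R) -> R -> R) : Prop :=
  exists C : R, forall f, weighted_Lp p v f ->
    (weighted_norm p w (T f) <= C%:E * weighted_norm p v f)%E.

End weights.

(* Main.v *)
(* The weights are [w = W_oo] and [sigma = X_oo], where stage [k] multiplies
   [X_k] by [1 + eps a_k cos (N_k x)] and [W_k] by [1 - eps (p - 1) Z_k a_k cos (N_k x)]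
   with [Z_k = W_k X_k^(p-1)] and [N_k] growing very fast.  This choice keeps
   [Z_k <= 1], hence the joint A_p condition, and since every stage changes
   averages by at most a factor [1 +- eps] at one scale and by a negligible
   amount at all others, both weights have doubling constant close to [2].
   The cutoffs [a_k] activate the stages one after the other as [x] grows, so
   that the products are locally finite and [sigma], [w] are continuous; on
   [J_n = [4n, 4n+3]] exactly the first [n] stages are active.

   The Hilbert transform of [X_k cos (N_k x)] is nearly [h X_k sin (N_k x)], so
   [H sigma] is nearly [Y_n = sum_(k < n) eps h_k X_k sin (N_k x)] on [J_n].  By
   strict convexity of [|.|^p] the energy [int |Y_k|^p W_k] grows at each stage
   by a multiple of [int X_k^p W_k = int X_k Z_k], up to an arbitrarily small
   multiple of the energy itself.  The entropy [int X_k ln Z_k <= 0] grows by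
   [c int X_k - C int X_k Z_k], which forces [int X_k Z_k] to be bounded below
   on average.  Hence the energies on [J_n] tend to infinity, and
   [f = sum_n alpha_n chi_n sigma], with [chi_n] a cutoff to [J_n] and summable
   [alpha_n], is the function sought. *)
Require Import Defs.
From mathcomp Require Import all_boot all_order all_algebra.
From mathcomp Require Import all_classical all_reals all_analysis.
From mathcomp Require Import measurable_realfun.
From mathcomp Require Import ring lra.
Set Implicit Arguments.
Unset Strict Implicit.
Unset Printing Implicit Defensive.
Import Order.TTheory GRing.Theory Num.Theory.
Import numFieldNormedType.Exports.
Local Open Scope classical_set_scope.
Local Open Scope ring_scope.

(** * Integrals of continuous functions over intervals *)
Section itg.
Context {R : realType}.
Implicit Types (f g : R -> R) (a b c x y : R).
Let mu := @lebesgue_measure R.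

(** A product of infinitely many factors [1 + eps cos (N_k x)] with fixed [eps] behaves like a Riesz
    product and need not converge to a function; this is why each [J_n] carries only finitely many
    stages, in growing number.

    The obstacle is a possible decay of [Z]: the energy is fed only by [X^p W = X Z], and in
    Lebesgue average [ln Z] tends to fall at every stage, logarithms being concave. Measured against
    [X] the drift changes sign: for a mean-zero oscillation [u] the average of [(1 + u) ln (1 + u)]
    is positive, [t ln t] being convex, whereas the loss coming from [W] carries a factor [Z]. So
    the entropy rises where [Z] is small, and it cannot pass 0.

    To first order a stage multiplies [Z] by [1 + (p - 1) (1 - Z) u] with [u = eps a_k cos (N_k x)].
    This first-order change vanishes at [Z = 1], which is the reason for the factor [Z] in the
    increment of [W].

    The stages are fixed before any target energy is named, while the convexity constants depend on
    the target; hence the energy estimate of a stage is stated for all such constants at once. *)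

Definition itg g a b : R := Rintegral mu `[a, b] g.

Lemma cont_integrable g a b : continuous g -> mu.-integrable `[a, b] (EFin \o g).
Proof.
move=> cg; apply: continuous_compact_integrable; first exact: segment_compact.
exact: continuous_subspaceT.
Qed.

Lemma itgD f g a b : continuous f -> continuous g ->
  itg (fun x => f x + g x) a b = itg f a b + itg g a b.
Proof. by move=> cf cg; rewrite /itg RintegralD//; exact: cont_integrable. Qed.

Lemma itgB f g a b : continuous f -> continuous g ->
  itg (fun x => f x - g x) a b = itg f a b - itg g a b.
Proof. by move=> cf cg; rewrite /itg RintegralB//; exact: cont_integrable. Qed.

Lemma itgZ k f a b : continuous f -> itg (fun x => k * f x) a b = k * itg f a b.
Proof. by move=> cf; rewrite /itg RintegralZl//; exact: cont_integrable. Qed.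

Lemma eq_itg f g a b : (forall x, a <= x <= b -> f x = g x) -> itg f a b = itg g a b.
Proof.
by move=> fg; apply: eq_Rintegral => x; rewrite inE/= in_itv/= => /fg.
Qed.

Lemma le_itg f g a b : continuous f -> continuous g ->
  (forall x, a <= x <= b -> f x <= g x) -> itg f a b <= itg g a b.
Proof.
by move=> cf cg fg; apply: le_Rintegral => //; exact: cont_integrable.
Qed.

Lemma itg_cst k a b : a <= b -> itg (fun=> k) a b = k * (b - a).
Proof.
move=> ab; rewrite /itg Rintegral_cst//= lebesgue_measure_itv/= lte_fin.
move: ab; rewrite le_eqVlt => /predU1P[->|ab]; first by rewrite ltxx/= subrr.
by rewrite ab.
Qed.

Lemma itg_split f a b c : continuous f -> a <= b -> b <= c ->
  itg f a c = itg f a b + itg f b c.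
Proof.
move=> cf ab bc.
have := @Rintegral_itvB R f (BLeft a) (BRight c) b (@cont_integrable f a c cf).
rewrite !bnd_simp => /(_ ab bc).
rewrite Rintegral_itv_obnd_cbnd; last first.
  apply: (integrableS _ _ _ (@cont_integrable f b c cf)) => //.
  by apply: subset_itvr; rewrite bnd_simp.
by rewrite /itg => <-; rewrite addrC subrK.
Qed.

Lemma itg_abs f a b M : continuous f -> a <= b ->
  (forall x, a <= x <= b -> `|f x| <= M) -> `|itg f a b| <= M * (b - a).
Proof.
move=> cf ab fM.
have cM (k : R) : continuous (fun _ : R => k) by exact: cst_continuous.
rewrite ler_norml; apply/andP; split.
  rewrite -mulNr -itg_cst//.
  by apply: le_itg => // x /fM; rewrite ler_norml => /andP[].
rewrite -itg_cst//.
by apply: le_itg => // x /fM; rewrite ler_norml => /andP[].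
Qed.

Lemma itg_ge0 f a b : (forall x, a <= x <= b -> 0 <= f x) -> 0 <= itg f a b.
Proof. by move=> f0; apply: Rintegral_ge0 => x /=; rewrite in_itv/= => /f0. Qed.

Lemma itg_FTC (F f : R -> R) a b : continuous f -> a <= b ->
  (forall x, a <= x <= b -> is_derive x 1 F (f x)) -> itg f a b = F b - F a.
Proof.
move=> cf; rewrite le_eqVlt => /predU1P[->|ab] dF.
  by rewrite subrr /itg set_itv1 Rintegral_set1.
have cF x : a <= x <= b -> {for x, continuous F}.
  move=> /dF H; apply: differentiable_continuous; apply/derivable1_diffP.
  by have [] := H.
rewrite /itg /Rintegral (@continuous_FTC2 _ f F)//.
- exact: continuous_subspaceT.
- split.
  + move=> x; rewrite in_itv/= => /andP[/ltW ax /ltW xb].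
    by have [] := dF x; rewrite ?ax ?xb.
  + by apply: cvg_at_right_filter; apply: cF; rewrite lexx ltW.
  + by apply: cvg_at_left_filter; apply: cF; rewrite lexx ltW.
- move=> x; rewrite in_itv/= => /andP[/ltW ax /ltW xb].
  have H := dF x; rewrite ax xb in H; have {}H := H isT.
  by rewrite derive1E; exact: derive_val.
Qed.

Lemma itg_shift f c a b : continuous f -> a <= b ->
  itg (fun t => f (c + t)) a b = itg f (c + a) (c + b).
Proof.
move=> cf ab; pose F (t : R) := c + t.
have cF : continuous F by move=> x; apply: cvgD; [exact: cvg_cst|exact: cvg_id].
have dF x : is_derive x 1 F 1.
  have -> : F = cst c + id by [].
  by apply: is_derive_eq; rewrite add0r.
have dF1 : (F^`())%classic = cst 1 by apply/funext => x; rewrite derive1E; exact: derive_val.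
rewrite /itg /Rintegral -/(F a) -/(F b).
rewrite (@integration_by_substitution_increasing R F f)//.
- by under [in RHS]eq_integral do rewrite dF1 mulr1.
- by move=> x y _ _; rewrite /F ltrD2l.
- by rewrite dF1 => x _; exact: cvg_cst.
- by rewrite dF1; exact: is_cvg_cst.
- by rewrite dF1; exact: is_cvg_cst.
- split.
  + by move=> x _; have [] := dF x.
  + by apply: cvg_at_right_filter; exact: cF.
  + by apply: cvg_at_left_filter; exact: cF.
- exact: continuous_subspaceT.
Qed.

Lemma itg_reflect f c a b : continuous f -> a <= b ->
  itg (fun t => f (c - t)) a b = itg f (c - b) (c - a).
Proof.
move=> cf ab.
have cg : continuous (fun t => f (c + t)).
  by move=> x; apply: continuous_comp (cf _); apply: cvgD; [exact: cvg_cst|exact: cvg_id].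
rewrite -(@itg_shift f c (- b) (- a))// ?lerN2//.
rewrite /itg /Rintegral integration_by_substitution_oppr//.
exact: continuous_subspaceT.
Qed.

Lemma itgE g a b : continuous g ->
  (\int[mu]_(x in `[a, b]) (g x)%:E)%E = (itg g a b)%:E.
Proof.
move=> cg; rewrite /itg /Rintegral fineK//.
by apply: integrable_fin_num => //; exact: cont_integrable.
Qed.

End itg.

(** * Riemann--Lebesgue estimates *)
Section oscillation.
Context {R : realType}.
Implicit Types (f g : R -> R) (a b c x y N ph : R).

Lemma cont_affine (N ph : R) : continuous (fun x : R => N * x + ph).
Proof.
by move=> x; apply: cvgD; [apply: cvgM; [exact: cvg_cst|exact: cvg_id]|exact: cvg_cst].
Qed.

Lemma cont_cos_affine N ph : continuous (fun x => cos (N * x + ph)).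
Proof.
move=> x; apply: (@continuous_comp _ _ _ (fun x => N * x + ph) cos).
  exact: cont_affine.
exact: continuous_cos.
Qed.

Lemma cont_mul f g : continuous f -> continuous g -> continuous (fun x => f x * g x).
Proof. by move=> cf cg x; apply: cvgM; [exact: cf|exact: cg]. Qed.

Lemma cont_add f g : continuous f -> continuous g -> continuous (fun x => f x + g x).
Proof. by move=> cf cg x; apply: cvgD; [exact: cf|exact: cg]. Qed.

Lemma cont_sub f g : continuous f -> continuous g -> continuous (fun x => f x - g x).
Proof. by move=> cf cg x; apply: cvgB; [exact: cf|exact: cg]. Qed.

Lemma is_derive_sin_affine N ph x :
  is_derive x 1 (fun x => sin (N * x + ph)) (N * cos (N * x + ph)).
Proof.
rewrite mulrC.
apply: (@is_derive1_comp _ sin (fun x => N * x + ph)).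
have -> : (fun x : R => N * x + ph) = (N \*: id) + cst ph by [].
by apply: is_derive_eq; rewrite addr0 -[LHS]/(N * 1) mulr1.
Qed.

Lemma itg_cos_period N ph a : 0 < N ->
  itg (fun x => cos (N * x + ph)) a (a + 2 * pi / N) = 0.
Proof.
move=> N0; have T0 : 0 <= 2 * pi / N by rewrite divr_ge0 ?mulr_ge0 ?pi_ge0// ltW.
pose F x : R := N^-1 * sin (N * x + ph).
have dF x : is_derive x 1 F (cos (N * x + ph)).
  have -> : F = N^-1 \*: (fun x => sin (N * x + ph)) by [].
  have H := is_derive_sin_affine N ph x.
  apply: is_derive_eq.
  by rewrite -[LHS]/(N^-1 * (N * _)) mulrA mulVf ?mul1r// gt_eqF.
rewrite (@itg_FTC _ F _ _ _ (@cont_cos_affine N ph) _ (fun x _ => dF x)) ?lerDl//.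
rewrite /F; have -> : N * (a + 2 * pi / N) + ph = N * a + ph + pi *+ 2.
  by field; rewrite gt_eqF.
by rewrite sinD2pi subrr.
Qed.

(* Riemann--Lebesgue, quantitatively: over a full period the oscillation of [g]
   is all that contributes. *)
Lemma itg_osc g a b N ph (e M : R) : 0 < N -> continuous g -> a <= b ->
  (forall x, a <= x <= b -> `|g x| <= M) ->
  (forall x y, a <= x <= b -> a <= y <= b -> `|x - y| <= 2 * pi / N ->
     `|g x - g y| <= e) ->
  `|itg (fun x => g x * cos (N * x + ph)) a b| <= e * (b - a) + M * (2 * pi / N).
Proof.
move=> N0 cg; set T := 2 * pi / N.
have T0 : 0 < T by rewrite divr_gt0 ?mulr_gt0 ?pi_gt0.
have cc := @cont_cos_affine N ph.
(* Induction on the number of periods that cover [[a, b]]: a full period costs [e * T], and only the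
   last, incomplete one costs [M * T]. *)
have [m] : exists m : nat, b <= a + m%:R * T.
  exists (Num.truncn `|(b - a) / T|).+1.
  have := truncnS_gt `|(b - a) / T|; set m := _%:R => mP.
  rewrite -lerBlDl -ler_pdivrMr//; apply: le_trans (ltW mP); exact: ler_norm.
elim: m a => [|m IH] a bm ab gM ge.
  have ba : b = a by apply/eqP; rewrite eq_le ab andbT; move: bm; rewrite mul0r addr0.
  have g0 : 0 <= M by apply: le_trans (gM a _) => //; rewrite lexx.
  rewrite ba subrr mulr0 add0r.
  apply: (le_trans (@itg_abs _ _ a a M _ _ _)) => //; first exact: cont_mul.
    move=> x /andP[h1 h2]; rewrite normrM -[leRHS]mulr1 ler_pM//.
      by apply: gM; rewrite h1 ba h2.
    by rewrite ler_norml cos_geN1 cos_le1.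
  by rewrite subrr mulr0 mulr_ge0// ltW.
have M0 : 0 <= M by apply: le_trans (gM a _) => //; rewrite lexx.
have e0 : 0 <= e by apply: le_trans (ge a a _ _ _); rewrite ?lexx// subrr normr0 ltW.
have [bT|Tb] := leP b (a + T).
  apply: (le_trans (@itg_abs _ _ a b M _ _ _)) => //; first exact: cont_mul.
    move=> x xab; rewrite normrM -[leRHS]mulr1 ler_pM//; first exact: gM.
    by rewrite ler_norml cos_geN1 cos_le1.
  rewrite -[leLHS]add0r lerD//; first by rewrite mulr_ge0// subr_ge0.
  by rewrite ler_wpM2l// lerBlDl.
have aT : a <= a + T by rewrite lerDl ltW.
rewrite (@itg_split _ _ a (a + T) b)//; [|exact: cont_mul|exact: ltW].
apply: le_trans (ler_normD _ _) _.
have -> : e * (b - a) + M * T = e * T + (e * (b - (a + T)) + M * T) by ring.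
apply: lerD; last first.
  apply: IH => //; [|exact: ltW| |].
  - by move: bm; rewrite -natr1; lra.
  - by move=> x /andP[h1 h2]; apply: gM; rewrite (le_trans aT h1) h2.
  - move=> x y /andP[h1 h2] /andP[h3 h4]; apply: ge.
      by rewrite (le_trans aT h1) h2.
    by rewrite (le_trans aT h3) h4.
(* The cosine integrates to 0 over a full period, so [g] may be replaced by [g - g a], which is at
   most [e] there. *)
have -> : itg (fun x => g x * cos (N * x + ph)) a (a + T) =
          itg (fun x => (g x - g a) * cos (N * x + ph)) a (a + T).
  have cga : continuous (fun x => g a * cos (N * x + ph)).
    by apply: cont_mul => //; exact: cst_continuous.
  rewrite [RHS](_ : _ = itg (fun x => g x * cos (N * x + ph) -
     g a * cos (N * x + ph)) a (a + T)); last first.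
    by apply: eq_itg => x _; ring.
  rewrite itgB//; last exact: cont_mul.
  by rewrite itgZ// itg_cos_period// mulr0 subr0.
have -> : e * T = e * (a + T - a) by congr (_ * _); ring.
apply: itg_abs => //.
  by apply: cont_mul => //; apply: cont_sub => //; exact: cst_continuous.
move=> x /andP[h1 h2]; rewrite normrM -[leRHS]mulr1 ler_pM//.
  apply: ge; rewrite ?lexx ?ab ?h1//= ?(le_trans h2 (ltW Tb))//.
  by rewrite ger0_norm ?subr_ge0// lerBlDl.
by rewrite ler_norml cos_geN1 cos_le1.
Qed.

End oscillation.

(** * Bounded uniformly continuous functions *)

Section buc.
Context {R : realType}.
Implicit Types (f g h : R -> R) (a b c x y N ph : R).

(** Uniformity over the whole line makes the frequency thresholds below independent of the position
    of the interval, so that one frequency serves all intervals. *)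
Definition buc g : Prop :=
  (exists M : R, forall x, `|g x| <= M) /\
  (forall e : R, 0 < e -> exists2 d : R, 0 < d &
    forall x y, `|x - y| <= d -> `|g x - g y| <= e).

(** One number controls both the size and the Lipschitz constant, so that an estimate can be uniform
    over the class of all [phi] with [lipb L phi]. *)
Definition lipb (L : R) g : Prop :=
  (forall x, `|g x| <= L) /\ (forall x y, `|g x - g y| <= L * `|x - y|).

Lemma buc_bound g : buc g -> exists2 M : R, 0 < M & forall x, `|g x| <= M.
Proof.
case=> -[M gM] _; exists (M + 1) => [|x]; last by rewrite (le_trans (gM x)) ?lerDl.
by rewrite ltr_wpDl// (le_trans _ (gM 0)).
Qed.

Lemma buc_cont g : buc g -> continuous g.
Proof.
move=> [_ ug] x; apply/cvgrPdist_le => e e0.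
have [d d0 gd] := ug e e0; near=> y; apply: gd.
by near: y; exists d => //= y /ltW.
Unshelve. all: by end_near. Qed.

Lemma lipb_buc L g : lipb L g -> buc g.
Proof.
move=> [gL gl]; split; first by exists L.
move=> e e0; have L0 : 0 <= L by apply: le_trans (gL 0).
exists (e / (L + 1)); first by rewrite divr_gt0// ltr_wpDl.
move=> x y xy; apply: le_trans (gl x y) _.
apply: (@le_trans _ _ ((L + 1) * (e / (L + 1)))).
  by rewrite ler_pM// lerDl.
by rewrite mulrCA divff ?mulr1// gt_eqF// ltr_wpDl.
Qed.

Lemma buc_cst k : buc (fun=> k).
Proof.
split; first by exists `|k|.
by move=> e e0; exists 1 => // x y _; rewrite subrr normr0 ltW.
Qed.

Lemma buc_add f g : buc f -> buc g -> buc (fun x => f x + g x).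
Proof.
move=> [[M fM] uf] [[K gK] ug]; split.
  by exists (M + K) => x; rewrite (le_trans (ler_normD _ _))// lerD.
move=> e e0; have e2 : 0 < e / 2 by rewrite divr_gt0.
have [d1 d10 h1] := uf _ e2; have [d2 d20 h2] := ug _ e2.
exists (Num.min d1 d2); first by rewrite lt_min d10 d20.
move=> x y; rewrite le_min => /andP[/h1 H1 /h2 H2].
have -> : f x + g x - (f y + g y) = (f x - f y) + (g x - g y) by ring.
by rewrite (le_trans (ler_normD _ _))// [leRHS](splitr e) lerD.
Qed.

Lemma buc_mul f g : buc f -> buc g -> buc (fun x => f x * g x).
Proof.
move=> bf bg; have [M M0 fM] := buc_bound bf; have [K K0 gK] := buc_bound bg.
split.
  by exists (M * K) => x; rewrite normrM ler_pM.
move=> e e0.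
have [d1 d10 h1] := bf.2 (e / (2 * K)) (divr_gt0 e0 (mulr_gt0 (ltr0Sn _ 1) K0)).
have [d2 d20 h2] := bg.2 (e / (2 * M)) (divr_gt0 e0 (mulr_gt0 (ltr0Sn _ 1) M0)).
exists (Num.min d1 d2); first by rewrite lt_min d10 d20.
move=> x y; rewrite le_min => /andP[/h1 H1 /h2 H2].
have -> : f x * g x - f y * g y = (f x - f y) * g x + f y * (g x - g y) by ring.
rewrite (le_trans (ler_normD _ _))// !normrM.
apply: (@le_trans _ _ (e / (2 * K) * K + M * (e / (2 * M)))).
  by rewrite lerD// ler_pM.
by rewrite le_eqVlt; apply/orP; left; apply/eqP; field; rewrite !gt_eqF.
Qed.

Lemma buc_scale k g : buc g -> buc (fun x => k * g x).
Proof. by move=> bg; apply: buc_mul => //; exact: buc_cst. Qed.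

Lemma buc_sub f g : buc f -> buc g -> buc (fun x => f x - g x).
Proof.
move=> bf bg; have -> : (fun x => f x - g x) = (fun x => f x + (-1) * g x).
  by apply/funext => x; rewrite mulN1r.
by apply: buc_add => //; exact: buc_scale.
Qed.

Lemma heine_cantor h (M e : R) : continuous h -> 0 < e ->
  exists2 d : R, 0 < d & forall x y, `|x| <= M -> `|x - y| <= d -> `|h x - h y| <= e.
Proof.
move=> ch e0.
have /compact_near_coveringP/(_ R 0^'+
  (fun d x => forall y, `|x - y| <= d -> `|h x - h y| <= e)) := @segment_compact R (- M) M.
case.
  move=> x _; have e2 : 0 < e / 2 by rewrite divr_gt0.
  have /cvgrPdist_le/(_ _ e2)/nbhs_ballP[r /= r0 hr] := ch x.
  have r2 : 0 < r / 2 by rewrite divr_gt0.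
  exists (ball x (r / 2), [set d | 0 < d < r / 2]) => /=.
    split; first exact: nbhsx_ballx.
    by near=> d; apply/andP; split; near: d; [exact: nbhs_right_gt|exact: nbhs_right_lt].
  move=> [u d] /= [xu /andP[d0 dr]] y uy.
  have hu : `|h x - h u| <= e / 2.
    by apply: hr; apply: (lt_le_trans xu); rewrite ler_pdivrMr// ler_peMr// ?ltW// ltr1n.
  have hy : `|h x - h y| <= e / 2.
    apply: hr; rewrite /ball/= (splitr r).
    have -> : x - y = (x - u) + (u - y) by ring.
    rewrite (le_lt_trans (ler_normD _ _))// ltrD//.
    exact: le_lt_trans uy dr.
  have -> : h u - h y = (h u - h x) + (h x - h y) by ring.
  rewrite (le_trans (ler_normD _ _))// (splitr e) lerD//.
  by rewrite distrC.
move=> d /= d0 H.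
exists (d / 2) => [|x y xM xy]; first by rewrite divr_gt0.
apply: (H (d / 2)) => //=.
- rewrite sub0r normrN gtr0_norm ?divr_gt0//.
  by rewrite ltr_pdivrMr// ltr_pMr// ltr1n.
- by rewrite divr_gt0.
- by rewrite in_itv/= -ler_norml.
Unshelve. all: by end_near. Qed.

Lemma buc_comp h g : continuous h -> buc g -> buc (fun x => h (g x)).
Proof.
move=> ch [[M gM] ug]; split.
  have M0 : 0 <= M by apply: le_trans (gM 0).
  have mM : - M <= M by lra.
  have [c1 _ H1] := EVT_max mM (continuous_subspaceT ch).
  have [c2 _ H2] := EVT_min mM (continuous_subspaceT ch).
  exists (`|h c1| + `|h c2|) => x.
  have gx : g x \in `[- M, M] by rewrite in_itv/= -ler_norml.
  have := H1 _ gx; have := H2 _ gx => h1 h2.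
  rewrite ler_norml; apply/andP; split.
    have := ler_norm (- h c2); rewrite normrN => ?.
    have := normr_ge0 (h c1) => ?; lra.
  have := ler_norm (h c1) => ?.
  have := normr_ge0 (h c2) => ?; lra.
move=> e e0; have [d d0 hd] := heine_cantor M ch e0.
have [d' d'0 gd] := ug d d0; exists d' => // x y /gd; exact: (hd _ _ (gM x)).
Qed.

Lemma cos_lip x y : `|cos x - cos y| <= `|x - y| :> R.
Proof.
wlog yx : x y / y <= x => [H|].
  by have [/H//|/ltW/H] := leP y x; rewrite distrC (distrC y).
have [c _ ->] := @MVT_segment _ (@cos R) (fun x => - sin x) y x yx
  (fun z _ => is_derive_cos z) (continuous_subspaceT (@continuous_cos R)).
by rewrite normrM normrN ler_piMl// ler_norml sin_geN1 sin_le1.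
Qed.

Lemma lipb_cos N ph : 0 <= N -> lipb (N + 1) (fun x => cos (N * x + ph)).
Proof.
move=> N0; split=> x.
  apply: (@le_trans _ _ 1); last by rewrite lerDr.
  by rewrite ler_norml cos_geN1 cos_le1.
move=> y; apply: le_trans (cos_lip _ _) _.
have -> : N * x + ph - (N * y + ph) = N * (x - y) by ring.
by rewrite normrM (ger0_norm N0) ler_wpM2r// lerDl.
Qed.

Lemma lipb_add L K f g : lipb L f -> lipb K g -> lipb (L + K) (fun x => f x + g x).
Proof.
move=> [fL fl] [gK gl]; split=> x.
  by rewrite (le_trans (ler_normD _ _))// lerD.
move=> y; have -> : f x + g x - (f y + g y) = (f x - f y) + (g x - g y) by ring.
by rewrite (le_trans (ler_normD _ _))// mulrDl lerD.
Qed.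

Lemma lipb_mul L K f g : lipb L f -> lipb K g -> lipb (2 * (L * K) + L * K) (fun x => f x * g x).
Proof.
move=> [fL fl] [gK gl].
have L0 : 0 <= L by apply: le_trans (fL 0).
have K0 : 0 <= K by apply: le_trans (gK 0).
have LK := mulr_ge0 L0 K0.
split=> x.
  by rewrite normrM (@le_trans _ _ (L * K)) ?ler_pM// lerDr mulr_ge0.
move=> y; have -> : f x * g x - f y * g y = (f x - f y) * g x + f y * (g x - g y) by ring.
rewrite (le_trans (ler_normD _ _))// !normrM.
apply: (@le_trans _ _ ((L * `|x - y|) * K + L * (K * `|x - y|))).
  by rewrite lerD// ler_pM.
have := mulr_ge0 LK (normr_ge0 (x - y)); nra.
Qed.

Lemma lipb_cst k : lipb `|k| (fun=> k).
Proof. by split=> // x y; rewrite subrr normr0 mulr_ge0. Qed.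

Lemma buc_cos N ph : 0 <= N -> buc (fun x => cos (N * x + ph)).
Proof. by move=> N0; apply: lipb_buc (lipb_cos _ N0). Qed.

(** The lower bound [lam] on the length lets the boundary term [M * (2 * pi / N)] be absorbed into
    [e / 2 * (b - a)]. *)
Lemma buc_riemann_lebesgue g (e lam : R) : buc g -> 0 < e -> 0 < lam ->
  exists N0, forall N, N0 <= N -> forall ph a b, lam <= b - a ->
  `|itg (fun x => g x * cos (N * x + ph)) a b| <= e * (b - a).
Proof.
move=> bg e0 lam0; have [M M0 gM] := buc_bound bg.
have e2 : 0 < e / 2 by rewrite divr_gt0.
have [d d0 gd] := bg.2 _ e2.
have pi2 : 0 < 2 * pi :> R by rewrite mulr_gt0// pi_gt0.
pose N1 : R := 2 * pi / d; pose N2 : R := M * (2 * pi) / (e / 2 * lam).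
have N10 : 0 < N1 by rewrite divr_gt0.
have N20 : 0 < N2 by apply: divr_gt0; apply: mulr_gt0.
exists (N1 + N2) => N NN ph a b ab.
have N0 : 0 < N by apply: lt_le_trans NN; rewrite addr_gt0.
apply: le_trans (@itg_osc _ g a b N ph (e / 2) M N0 (buc_cont bg) _ _ _) _ => //.
- by rewrite -subr_ge0 (le_trans (ltW lam0)).
- move=> x y _ _ xy; apply: gd; apply: (le_trans xy).
  rewrite ler_pdivrMr// [d * N]mulrC -ler_pdivrMr//.
  by apply: le_trans NN; rewrite lerDl ltW.
- have H : M * (2 * pi / N) <= e / 2 * lam.
    rewrite mulrA ler_pdivrMr// [_ * N]mulrC -ler_pdivrMr ?mulr_gt0//.
    by apply: le_trans NN; rewrite lerDr ltW.
  have : e / 2 * lam <= e / 2 * (b - a) by rewrite ler_pM2l.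
  by move=> ?; lra.
Qed.

End buc.

(** * Convexity inequalities *)
Section powers.
Context {R : realType}.
Implicit Types (a b c x y p q r s t u : R).

(** The signed power: [p * spow (p - 1)] is the derivative of [|t|^p], hence the slope in the
    tangent-line inequalities below. *)
Definition spow q t : R := Num.sg t * `|t| `^ q.

Lemma powR_split p x : 1 < p -> 0 <= x -> x `^ p = x * x `^ (p - 1).
Proof.
move=> p1 x0; rewrite -{2}(powRr1 x0) -powRD.
  by congr (_ `^ _); ring.
by apply/implyP => /eqP H; exfalso; lra.
Qed.

Lemma normpow_spow p t : 1 < p -> `|t| `^ p = t * spow (p - 1) t.
Proof. by move=> p1; rewrite powR_split// /spow mulrA [t * _]mulrC -normrEsg. Qed.

(** This is the strict weighted inequality of arithmetic and geometric means for [x^p] and 1 with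
    weights [1/p] and [1 - 1/p]: the geometric mean is [x], the arithmetic mean is [m]. It follows
    from [1 + t <= expR t] at the logarithms of [x^p / m] and [1 / m], one of which is nonzero. *)
Lemma bernoulli_strict p x : 1 < p -> 0 < x -> x != 1 -> 1 + p * (x - 1) < x `^ p.
Proof.
move=> p1 x0 x1; have p0 : 0 < p by lra.
set A := x `^ p; set u := ln x.
have eu : expR u = x by rewrite lnK.
have u0 : u != 0 by rewrite ln_eq0.
have A0 : 0 < A by exact: powR_gt0.
have eA : A = expR (p * u) by rewrite mulrC expRM eu.
rewrite ltNge; apply/negP => Ax.
pose m := p^-1 * A + (1 - p^-1).
have ip : 0 < p^-1 < 1 by rewrite invr_gt0 p0 invf_lt1.
have m0 : 0 < m.
  have : 0 < p^-1 * A by rewrite mulr_gt0 ?invr_gt0.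
  by rewrite /m => *; lra.
have mx : m <= x.
  have : p^-1 * A <= p^-1 * (1 + p * (x - 1)) by rewrite ler_pM2l// invr_gt0.
  rewrite /m mulrDr mulrA mulVf ?gt_eqF// => H; lra.
pose c := ln m.
have ec : expR (- c) = m^-1 by rewrite expRN lnK.
have cu : c <= u by rewrite ler_ln.
have h1 := expR_ge1Dx (p * u - c); have h2 := expR_ge1Dx (- c).
have e1 : expR (p * u - c) = A / m by rewrite expRD ec -eA.
have key : p^-1 * (A / m) + (1 - p^-1) * m^-1 = 1.
  by rewrite mulrA -mulrDl -/m divff// gt_eqF.
have pp : p^-1 * (p * u) = u by rewrite mulrA mulVf ?mul1r// gt_eqF.
rewrite e1 in h1; rewrite ec in h2.
case: (eqVneq c 0) => [c0|c0].
  have pu : p * u - c != 0 by rewrite c0 subr0 mulf_neq0// gt_eqF.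
  have := expR_gt1Dx pu; rewrite e1 => h3.
  have : p^-1 * (1 + (p * u - c)) < p^-1 * (A / m) by rewrite ltr_pM2l// invr_gt0.
  have : (1 - p^-1) * (1 + - c) <= (1 - p^-1) * m^-1 by rewrite ler_pM2l ?subr_gt0//; case/andP: ip.
  by move=> *; lra.
have cN : - c != 0 by rewrite oppr_eq0.
have := expR_gt1Dx cN; rewrite ec => h3.
have : p^-1 * (1 + (p * u - c)) <= p^-1 * (A / m) by rewrite ler_pM2l// invr_gt0.
have : (1 - p^-1) * (1 + - c) < (1 - p^-1) * m^-1 by rewrite ltr_pM2l ?subr_gt0//; case/andP: ip.
by move=> *; lra.
Qed.

Lemma bernoulli p x : 1 < p -> 0 <= x -> 1 + p * (x - 1) <= x `^ p.
Proof.
move=> p1; rewrite le_eqVlt => /predU1P[<-|x0].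
  by rewrite powR0 ?gt_eqF//; lra.
have [->|x1] := eqVneq x 1; first by rewrite powR1 subrr mulr0 addr0.
exact/ltW/bernoulli_strict.
Qed.

(** Division by [|u|^p] turns this into Bernoulli's inequality at [1 + 1/u], except for
    [-1 <= u <= 0], where the left side is at most 0 and strictness is read off directly. *)
Lemma normpow_tangent_lt p u : 1 < p ->
  `|u| `^ p + p * spow (p - 1) u < `|u + 1| `^ p.
Proof.
move=> p1; have p0 : 0 < p by lra.
have [u0|u0|<-] := ltrgtP 0 u.
- rewrite /spow gtr0_sg// mul1r !gtr0_norm ?addr_gt0//.
  have -> : u + 1 = u * (1 + u^-1) by field; rewrite gt_eqF.
  rewrite powRM ?ltW//; last by rewrite addr_gt0 ?invr_gt0.
  have := @bernoulli_strict p (1 + u^-1) p1.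
  have iu : 0 < u^-1 by rewrite invr_gt0.
  rewrite addr_gt0// gt_eqF ?ltrDl// => /(_ isT isT).
  move=> B; rewrite -(ltr_pM2l (powR_gt0 p u0)) in B.
  apply: le_lt_trans B; rewrite (powR_split p1 (ltW u0)).
  rewrite le_eqVlt; apply/orP; left; apply/eqP; field; by rewrite gt_eqF.
- rewrite /spow ltr0_sg// (ltr0_norm u0).
  set r := - u; have r0 : 0 < r by rewrite oppr_gt0.
  have -> : u + 1 = 1 - r by rewrite /r; ring.
  have r1 : 0 < r `^ (p - 1) by exact: powR_gt0.
  rewrite (powR_split p1 (ltW r0)).
  have [rl|rl] := leP r 1.
    have := powR_ge0 `|1 - r| p => h.
    have : r * r `^ (p - 1) <= r `^ (p - 1) by rewrite ler_piMl// ltW.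
    have : 0 < (p - 1) * r `^ (p - 1) by rewrite mulr_gt0//; lra.
    move=> *; lra.
  rewrite ltr0_norm ?subr_lt0//.
  have ir : r^-1 < 1 by rewrite invf_lt1.
  have ir0 : 0 < r^-1 by rewrite invr_gt0.
  have -> : - (1 - r) = r * (1 - r^-1) by field; rewrite gt_eqF.
  rewrite powRM ?ltW//; last by rewrite subr_gt0.
  have := @bernoulli_strict p (1 - r^-1) p1.
  rewrite subr_gt0 ir lt_eqF ?ltrBlDr ?ltrDl// => /(_ isT isT).
  move=> B; rewrite -(ltr_pM2l (powR_gt0 p r0)) in B.
  apply: le_lt_trans B; rewrite (powR_split p1 (ltW r0)).
  rewrite le_eqVlt; apply/orP; left; apply/eqP; field; by rewrite gt_eqF.
- by rewrite /spow sgr0 mul0r mulr0 addr0 add0r normr0 normr1 powR1 powR0 ?gt_eqF.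
Qed.

Lemma continuous_spow q : 0 < q -> continuous (spow q).
Proof.
move=> q0 t.
have [t0|t0|t0] := ltrgtP 0 t.
- have cE : {for t, continuous (fun x => expR (q * ln x))}.
    apply: (@continuous_comp _ _ _ (fun x => q * ln x) expR); last exact: continuous_expR.
    by apply: cvgM; [exact: cvg_cst|exact: continuous_ln].
  apply: cvg_trans; last first.
    have -> : spow q t = expR (q * ln t).
      by rewrite /spow gtr0_sg// mul1r gtr0_norm// /powR gt_eqF.
    exact: cE.
  apply: near_eq_cvg; near=> x.
  have x0 : 0 < x by near: x; exact: lt_nbhsr.
  by rewrite /spow gtr0_sg// mul1r gtr0_norm// /powR gt_eqF.
- have cE : {for t, continuous (fun x => - expR (q * ln (- x)))}.
    apply: cvgN; apply: (@continuous_comp _ _ _ (fun x => q * ln (- x)) expR); last exact: continuous_expR.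
    apply: cvgM; first exact: cvg_cst.
    apply: (@continuous_comp _ _ _ -%R (@ln R)); first exact: opp_continuous.
    by apply: continuous_ln; rewrite oppr_gt0.
  apply: cvg_trans; last first.
    have -> : spow q t = - expR (q * ln (- t)).
      by rewrite /spow ltr0_sg// mulN1r ltr0_norm// /powR gt_eqF// oppr_gt0.
    exact: cE.
  apply: near_eq_cvg; near=> x.
  have x0 : x < 0 by near: x; exact: lt_nbhsl.
  by rewrite /spow ltr0_sg// mulN1r ltr0_norm// /powR gt_eqF// oppr_gt0.
- rewrite -t0; apply/cvgrPdist_le => e e0.
  have s0 : spow q 0 = 0 by rewrite /spow sgr0 mul0r.
  near=> x; rewrite s0 sub0r normrN.
  have xe : `|x| <= e `^ q^-1.
    near: x; exists (e `^ q^-1) => /=; first exact: powR_gt0.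
    by move=> x; rewrite /= sub0r normrN => /ltW.
  rewrite /spow normrM (ger0_norm (powR_ge0 _ _)).
  apply: (@le_trans _ _ (`|x| `^ q)).
    by rewrite ler_piMl ?powR_ge0// normr_sg lern1 leq_b1.
  apply: (@le_trans _ _ ((e `^ q^-1) `^ q)).
    by rewrite ge0_ler_powR ?nnegrE ?powR_ge0// ltW.
  by rewrite -powRrM mulVf ?gt_eqF// powRr1// ltW.
Unshelve. all: by end_near. Qed.

Lemma continuous_normpow p : 1 < p -> continuous (fun t => `|t| `^ p).
Proof.
move=> p1; have -> : (fun t => `|t| `^ p) = (fun t => t * spow (p - 1) t).
  by apply/funext => t; exact: normpow_spow.
by apply: cont_mul; [move=> x; exact: cvg_id|apply: continuous_spow; rewrite subr_gt0].
Qed.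

(* Strict convexity of [|.|^p] is uniform while [|y| <= r |t|]; beyond that the
   right-hand side only asks for plain convexity. *)
Lemma normpow_gain p r : 1 < p -> 0 < r -> exists c, 0 < c <= 1 /\
  forall y t, `|y| `^ p + p * spow (p - 1) y * t +
     Num.max 0 (c * (`|t| `^ p - r `^ (- p) * `|y| `^ p)) <= `|y + t| `^ p.
Proof.
move=> p1 r0; have p0 : 0 < p by lra.
pose q u := `|u + 1| `^ p - (`|u| `^ p + p * spow (p - 1) u).
have cq : continuous q.
  apply: cont_sub.
    move=> x; apply: (@continuous_comp _ _ _ (fun u => u + 1) (fun t => `|t| `^ p)).
      by apply: cvgD; [exact: cvg_id|exact: cvg_cst].
    exact: continuous_normpow.
  apply: cont_add; first exact: continuous_normpow.
  apply: cont_mul; first exact: cst_continuous.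
  by apply: continuous_spow; rewrite subr_gt0.
have q0 u : 0 < q u by rewrite subr_gt0 normpow_tangent_lt.
have rr : - r <= r by lra.
(* [q] is the gap above the tangent line; being continuous and positive, it has a positive minimum
   on the compact [[-r, r]]. *)
have [u0 _ qmin] := EVT_min rr (continuous_subspaceT cq).
exists (Num.min 1 (q u0)); set c := Num.min _ _.
have c0 : 0 < c by rewrite lt_min ltr01 q0.
split; first by rewrite c0 ge_min lexx.
move=> y t.
have [->|t0] := eqVneq t 0.
  rewrite mulr0 !addr0 normr0 powR0 ?gt_eqF// sub0r max_l ?addr0//.
  by rewrite mulrN oppr_le0 !mulr_ge0 ?powR_ge0// ltW.
(* All terms are homogeneous of degree [p] in [(y, t)], so only the ratio [u] matters. *)
pose u := y / t.
have yut : y = u * t by rewrite /u mulfVK.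
have tp : 0 < `|t| `^ p by rewrite powR_gt0// normr_gt0.
have e1 : `|y| `^ p = `|t| `^ p * `|u| `^ p by rewrite yut normrM powRM// mulrC.
have e2 : `|y + t| `^ p = `|t| `^ p * `|u + 1| `^ p.
  have -> : y + t = (u + 1) * t by rewrite yut; ring.
  by rewrite normrM powRM// mulrC.
have e3 : spow (p - 1) y * t = `|t| `^ p * spow (p - 1) u.
  rewrite {1}/spow yut sgrM normrM powRM// normpow_spow// /spow; ring.
rewrite -mulrA e3 e1 e2.
have main : `|u| `^ p + p * spow (p - 1) u + Num.max 0 (c * (1 - r `^ (- p) * `|u| `^ p)) <= `|u + 1| `^ p.
  have [ur|ur] := leP `|u| r.
    have H := qmin u; rewrite in_itv/= -ler_norml in H; have {}H := H ur.
    have : Num.max 0 (c * (1 - r `^ (- p) * `|u| `^ p)) <= q u.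
      rewrite ge_max ltW//=; apply: le_trans H.
      apply: (@le_trans _ _ c); last by rewrite ge_min lexx orbT.
      have h : 1 - r `^ (- p) * `|u| `^ p <= 1.
        by rewrite lerBlDr lerDl mulr_ge0 ?powR_ge0.
      by rewrite (ler_piMr (ltW c0) h).
    rewrite /q; lra.
  rewrite max_l.
    by rewrite addr0 ltW// normpow_tangent_lt.
  rewrite pmulr_rle0// subr_le0.
  have : r `^ p <= `|u| `^ p.
    by apply: ge0_ler_powR; rewrite ?nnegrE ?(ltW p0) ?(ltW r0) ?(ltW ur).
  by rewrite powRN mulrC ler_pdivlMr ?mul1r ?powR_gt0.
have := ler_wpM2l (ltW tp) main; apply: le_trans.
have -> : Num.max 0 (c * (`|t| `^ p - r `^ (- p) * (`|t| `^ p * `|u| `^ p))) =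
    `|t| `^ p * Num.max 0 (c * (1 - r `^ (- p) * `|u| `^ p)).
  by rewrite maxr_pMr ?(ltW tp)// mulr0; congr Num.max; ring.
by rewrite le_eqVlt; apply/orP; left; apply/eqP; ring.
Qed.

End powers.

(** * Pointwise inequalities for one stage *)

Section scalar.
Context {R : realType}.
Implicit Types (u v s c b z p beta : R).

(** Any coefficient between 1/2 and 1 has the right shape for small [v]; it must stay below 1 for a
    positive quadratic term to survive in [xlnx_ge]. The proof bounds [expR w] by
    [(1 - w / 2)^(-2)]. *)
Lemma ln_ge_quadratic v : `|v| <= 8^-1 -> v - 7 / 8 * v ^+ 2 <= ln (1 + v).
Proof.
rewrite ler_norml => /andP[v1 v2].
set w := v - _.
have w1 : w / 2 < 1 by rewrite /w; nra.
have v0 : 0 < 1 + v by lra.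
rewrite -ler_expR lnK//.
have e1 : expR w = ((expR (- (w / 2))) ^+ 2)^-1.
  by rewrite -expRM_natl -expRN; congr expR; field.
rewrite e1 invf_ple ?posrE ?exprn_gt0 ?expR_gt0//.
apply: (@le_trans _ _ ((1 - w / 2) ^+ 2)); last first.
  rewrite lerXn2r ?nnegrE ?expR_ge0//; first by rewrite subr_ge0 ltW.
  exact: expR_ge1Dx.
rewrite -[leLHS]mul1r ler_pdivrMr//.
have h0 : 0 <= v ^+ 2 by exact: sqr_ge0.
have h1 : 0 <= v ^+ 2 * (v + 8^-1) by rewrite mulr_ge0//; lra.
have h2 : v ^+ 2 * v <= v ^+ 2 * 8^-1 by rewrite ler_wpM2l.
have h3 : 0 <= v ^+ 2 * v ^+ 2 by rewrite mulr_ge0.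
have h4 : v ^+ 2 * v ^+ 2 <= v ^+ 2 * 64^-1 by rewrite ler_wpM2l//; nra.
have h5 : - (8^-1 * (v ^+ 2 * v ^+ 2)) <= v * (v ^+ 2 * v ^+ 2).
  by rewrite -mulNr ler_wpM2r.
rewrite /w; nra.
Qed.

(** The source of entropy growth: multiplying out leaves [u^2 / 8 - 7 u^3 / 8], and
    [1/8 - 7/64 = 1/64]. *)
Lemma xlnx_ge u : `|u| <= 8^-1 -> u + u ^+ 2 / 64 <= (1 + u) * ln (1 + u).
Proof.
move=> u8; have := ln_ge_quadratic u8; move: u8.
rewrite ler_norml => /andP[v1 v2] h.
have u0 : 0 <= 1 + u by lra.
apply: le_trans (ler_wpM2l u0 h).
have h0 : 0 <= u ^+ 2 by exact: sqr_ge0.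
have h2 : u ^+ 2 * u <= u ^+ 2 * 8^-1 by rewrite ler_wpM2l.
nra.
Qed.

(** Here [c] stands for the cosine: the part linear in [c] averages out and the [c^2] part averages
    to half its coefficient. The gain from [xlnx_ge] is free of [z], while every loss carries a
    factor [z], using [z^2 <= z]. *)
Lemma entropy_step eps beta z c : 0 < eps -> 0 < beta -> eps <= 8^-1 ->
  eps * beta <= 8^-1 -> 0 <= z <= 1 -> `|c| <= 1 ->
  (beta * eps - eps * beta * z) * c +
  (beta * eps ^+ 2 / 64 - (beta + 2 * beta ^+ 2) * eps ^+ 2 * z) * c ^+ 2 <=
  (1 + eps * c) * (beta * ln (1 + eps * c) + ln (1 - eps * beta * z * c)).
Proof.
move=> e0 b0 e8 eb8 /andP[z0 z1] c1.
have eb0 : 0 < eps * beta by rewrite mulr_gt0.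
have u8 : `|eps * c| <= 8^-1.
  by rewrite normrM gtr0_norm// (le_trans _ e8)// ler_piMr// ltW.
have ebz : 0 <= eps * beta * z <= 8^-1.
  by rewrite mulr_ge0 ?(ltW eb0)//= (le_trans _ eb8)// ler_piMr// ltW.
have v8 : `|- (eps * beta * z * c)| <= 8^-1.
  case/andP: ebz => bz0 bz1.
  by rewrite normrN normrM ger0_norm// (le_trans _ bz1)// ler_piMr.
have h1 := xlnx_ge u8.
have h2 := ln_ge_quadratic v8.
have : beta * (eps * c + (eps * c) ^+ 2 / 64) <= beta * ((1 + eps * c) * ln (1 + eps * c)).
  by rewrite ler_wpM2l// ltW.
have u0 : 0 <= 1 + eps * c by move: u8; rewrite ler_norml => /andP[]; lra.
have := ler_wpM2l u0 h2.
set l1 := ln (1 + eps * c); set l2 := ln (1 - _).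
move=> H2 H1.
have c2 : 0 <= c ^+ 2 by exact: sqr_ge0.
have b2z : (eps * beta) ^+ 2 * z ^+ 2 <= (eps * beta) ^+ 2 * z.
  by rewrite ler_wpM2l ?sqr_ge0// expr2 ler_piMr.
have u9 : eps * c <= 8^-1 by apply: le_trans (ler_norm _) u8.
suff : (beta * eps - eps * beta * z) * c +
  (beta * eps ^+ 2 / 64 - (beta + 2 * beta ^+ 2) * eps ^+ 2 * z) * c ^+ 2 <=
  beta * (eps * c + (eps * c) ^+ 2 / 64) +
  (1 + eps * c) * (- (eps * beta * z * c) - 7 / 8 * (- (eps * beta * z * c)) ^+ 2).
  by move=> H; lra.
have h3 : (1 + eps * c) * (7 / 8 * ((eps * beta) ^+ 2 * z ^+ 2)) * c ^+ 2 <=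
   (2 * ((eps * beta) ^+ 2 * z)) * c ^+ 2.
  rewrite ler_wpM2r//.
  have h : 0 <= (eps * beta) ^+ 2 * z ^+ 2 by rewrite mulr_ge0 ?sqr_ge0.
  nra.
have -> : (1 + eps * c) * (- (eps * beta * z * c) - 7 / 8 * (- (eps * beta * z * c)) ^+ 2)
  = - (eps * beta * z * c) - eps ^+ 2 * beta * z * c ^+ 2 -
   (1 + eps * c) * (7 / 8 * ((eps * beta) ^+ 2 * z ^+ 2)) * c ^+ 2 by ring.
nra.
Qed.

(** With [v = beta * u] one has [z (1 - z v) <= 1 - v <= expR (- v)], which cancels
    [(1 + u)^beta <= expR v]. The first inequality is [(1 - z) (1 - v (1 + z)) >= 0]. *)
Lemma product_step beta z u : 0 < beta -> 0 <= z <= 1 -> `|u| <= 8^-1 ->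
  beta * `|u| <= 8^-1 -> z * (1 - beta * z * u) * (1 + u) `^ beta <= 1.
Proof.
move=> b0 /andP[z0 z1] u8 bu8.
have u0 : 0 < 1 + u by move: u8; rewrite ler_norml => /andP[]; lra.
have : (1 + u) `^ beta <= expR (beta * u).
  rewrite /powR gt_eqF// ler_expR ler_wpM2l ?(ltW b0)//.
  by rewrite -ler_expR lnK// expR_ge1Dx.
have bu : `|beta * u| <= 8^-1 by rewrite normrM gtr0_norm.
set v := beta * u in bu *.
move: bu; rewrite ler_norml => /andP[v1 v2].
have -> : beta * z * u = z * v by rewrite /v; ring.
have zz : z * (1 - z * v) <= 1 - v.
  have : 0 <= (1 - z) * (1 - v * (1 + z)) by rewrite mulr_ge0//; nra.
  nra.
have zv : 0 <= z * (1 - z * v) by rewrite mulr_ge0//; nra.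
move=> hp.
apply: (@le_trans _ _ (expR (- v) * expR v)); last by rewrite -expRD addNr expR0.
rewrite ler_pM ?powR_ge0//.
by apply: le_trans zz _; exact: expR_ge1Dx.
Qed.

(** A minorant quadratic in [s], because only averages of [sin^2] are available. Bernoulli is
    applied at [2 |s|], so that replacing [s^2] by its mean 1/2 leaves exactly [2^(-p) > 0]. *)
Lemma normpow_lower p s : 1 < p -> `|s| <= 1 ->
  2 `^ (- p) * (1 - p) + 2 * p * 2 `^ (- p) * s ^+ 2 <= `|s| `^ p.
Proof.
move=> p1 s1.
have h0 : 0 <= 2 * `|s| by rewrite mulr_ge0.
have := bernoulli p1 h0.
rewrite powRM// => H.
have P2 : 0 < 2 `^ (- p) :> R by rewrite powR_gt0.
have := ler_wpM2l (ltW P2) H.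
rewrite mulrA -powRD; last by apply/implyP => _; rewrite pnatr_eq0.
rewrite addNr powRr0 mul1r; apply: le_trans.
have ss : s ^+ 2 <= `|s| by rewrite -real_normK ?num_real// expr2 ler_piMr.
have : 0 <= 2 * p * 2 `^ (- p) by rewrite mulr_ge0 ?(ltW P2)// mulr_ge0//; lra.
move=> h3; have := ler_wpM2l h3 ss; lra.
Qed.

End scalar.

(** * Positive functions and trigonometric averages *)

Section positive_buc.
Context {R : realType}.
Implicit Types (f g : R -> R) (a b m q N : R).

Definition posb g : Prop := exists2 m : R, 0 < m & forall x, m <= g x.

Lemma posb_gt0 g x : posb g -> 0 < g x.
Proof. by case=> m m0 gm; exact: lt_le_trans (gm x). Qed.

Lemma buc_ln g : buc g -> posb g -> buc (fun x => ln (g x)).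
Proof.
move=> bg [m m0 gm].
have -> : (fun x => ln (g x)) = (fun x => ln (Num.max m (g x))).
  by apply/funext => x; rewrite max_r.
apply: (@buc_comp _ (fun t => ln (Num.max m t))) => // t.
apply: (@continuous_comp _ _ _ (fun t => Num.max m t) (@ln R)).
  by apply: continuous_max; [exact: cvg_cst|exact: cvg_id].
by apply: continuous_ln; rewrite lt_max m0.
Qed.

Lemma buc_powR g q : buc g -> posb g -> buc (fun x => g x `^ q).
Proof.
move=> bg pg.
have -> : (fun x => g x `^ q) = (fun x => expR (q * ln (g x))).
  by apply/funext => x; rewrite /powR gt_eqF// posb_gt0.
apply: (@buc_comp _ (@expR R)); first exact: continuous_expR.
by apply: buc_scale; exact: buc_ln.
Qed.

Lemma itgDZ f k g a b : continuous f -> continuous g ->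
  itg (fun x => f x + k * g x) a b = itg f a b + k * itg g a b.
Proof.
by move=> cf cg; rewrite itgD ?itgZ//; apply: cont_mul => //; exact: cst_continuous.
Qed.

Lemma cont_cos N : continuous (fun x : R => cos (N * x)).
Proof.
have -> : (fun x => cos (N * x)) = (fun x => cos (N * x + 0)).
  by apply/funext => x; rewrite addr0.
exact: cont_cos_affine.
Qed.

Lemma sin_cosE (x : R) : sin x = - cos (x + pi / 2).
Proof. by rewrite cosDpihalf opprK. Qed.

Lemma cont_sin N : continuous (fun x : R => sin (N * x)).
Proof.
have -> : (fun x => sin (N * x)) = (fun x => (-1) * cos (N * x + pi / 2)).
  by apply/funext => x; rewrite sin_cosE mulN1r.
by apply: cont_mul; [exact: cst_continuous|exact: cont_cos_affine].
Qed.

(** The products reduce by the double-angle formulas to frequency [2 N]; requiring [N >= 1] makes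
    one threshold valid for both [N] and [2 N]. *)
Lemma trig_averages g (e lam : R) : buc g -> 0 < e -> 0 < lam ->
  exists N0, forall N, N0 <= N -> forall a b, lam <= b - a ->
  [/\ `|itg (fun x => g x * cos (N * x)) a b| <= e * (b - a),
      `|itg (fun x => g x * sin (N * x)) a b| <= e * (b - a),
      `|itg (fun x => g x * (cos (N * x) * sin (N * x))) a b| <= e * (b - a),
      `|itg (fun x => g x * cos (N * x) ^+ 2) a b - 2^-1 * itg g a b| <= e * (b - a) &
      `|itg (fun x => g x * sin (N * x) ^+ 2) a b - 2^-1 * itg g a b| <= e * (b - a)].
Proof.
move=> bg e0 lam0; have [N0 H] := buc_riemann_lebesgue bg e0 lam0.
have cg := buc_cont bg.
exists (Num.max N0 1) => N; rewrite ge_max => /andP[NN N1] a b ab.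
have N2 : N0 <= 2 * N by lra.
have cc := @cont_cos; have cs := @cont_sin.
have sinP M : N0 <= M -> `|itg (fun x => g x * sin (M * x)) a b| <= e * (b - a).
  move=> MM; have := H M MM (pi / 2) a b ab.
  have -> : itg (fun x => g x * sin (M * x)) a b =
     itg (fun x => (-1) * (g x * cos (M * x + pi / 2))) a b.
    by apply: eq_itg => x _; rewrite sin_cosE; ring.
  rewrite itgZ; last by apply: cont_mul => //; exact: cont_cos_affine.
  by rewrite mulN1r normrN.
have cosP M : N0 <= M -> `|itg (fun x => g x * cos (M * x)) a b| <= e * (b - a).
  move=> MM; have := H M MM 0 a b ab.
  by have -> : itg (fun x => g x * cos (M * x + 0)) a b = itg (fun x => g x * cos (M * x)) a b
    by apply: eq_itg => x _; rewrite addr0.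
have eab : 0 <= e * (b - a) by rewrite mulr_ge0 ?ltW// (lt_le_trans lam0).
have half t : `|t| <= e * (b - a) -> `|2^-1 * t| <= e * (b - a).
  by move=> h; rewrite normrM gtr0_norm ?invr_gt0//; lra.
have cg2 : continuous (fun x => 2^-1 * g x).
  by apply: cont_mul => //; exact: cst_continuous.
have cgc : continuous (fun x => g x * cos (2 * N * x)) by exact: cont_mul.
split; [exact: cosP|exact: sinP| | |].
- have -> : itg (fun x => g x * (cos (N * x) * sin (N * x))) a b =
     itg (fun x => 2^-1 * (g x * sin (2 * N * x))) a b.
    apply: eq_itg => x _.
    have -> : 2 * N * x = N * x *+ 2 by ring.
    by rewrite sin_mulr2n; field.
  by rewrite itgZ ?half ?sinP//; exact: cont_mul.
- have -> : itg (fun x => g x * cos (N * x) ^+ 2) a b =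
     itg (fun x => 2^-1 * g x + 2^-1 * (g x * cos (2 * N * x))) a b.
    apply: eq_itg => x _.
    have -> : 2 * N * x = N * x *+ 2 by ring.
    by rewrite cos_mulr2n; field.
  rewrite itgDZ ?itgZ//.
  by rewrite addrC addKr half// cosP.
- have -> : itg (fun x => g x * sin (N * x) ^+ 2) a b =
     itg (fun x => 2^-1 * g x + (- 2^-1) * (g x * cos (2 * N * x))) a b.
    apply: eq_itg => x _.
    have -> : 2 * N * x = N * x *+ 2 by ring.
    by rewrite cos_mulr2n cos2sin2; field.
  rewrite itgDZ ?itgZ//.
  by rewrite addrC addKr mulNr normrN half// cosP.
Qed.

End positive_buc.

(** * Entropy and energy along one stage *)
Section entropy.
Context {R : realType}.
Implicit Types (X W Y : R -> R) (p eps h N a b : R).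

(** The joint A_p product of two weights that are constant near [x], with [X] in the role of the
    dual weight. *)
Definition apZ p X W (x : R) : R := W x * X x `^ (p - 1).

(* The relative increment of [W] is [- (p - 1) Z] times that of [X], where
   [Z = W X^(p-1)]: this keeps [Z <= 1]. *)
Definition stepX eps (N : R) (a : R -> R) X (x : R) : R :=
  X x * (1 + eps * (a x * cos (N * x))).

Definition stepW p eps N (a : R -> R) X W (x : R) : R :=
  W x * (1 - eps * (p - 1) * apZ p X W x * (a x * cos (N * x))).

(** No cutoff enters, in contrast to the weights: [Y] is compared with a Hilbert transform only on
    cells where the ramps of the stages used equal 1. *)
Definition stepY eps h N X Y (x : R) : R :=
  Y x + eps * h * (X x * sin (N * x)).

Definition lnZ p X W (x : R) : R := ln (W x) + (p - 1) * ln (X x).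

Lemma lnZ_ln p X W x : 0 < X x -> 0 < W x -> lnZ p X W x = ln (apZ p X W x).
Proof.
by move=> X0 W0; rewrite /lnZ /apZ lnM ?posrE ?powR_gt0// ln_powR.
Qed.

Lemma buc_apZ p X W : buc X -> posb X -> buc W -> buc (apZ p X W).
Proof. by move=> bX pX bW; apply: buc_mul => //; exact: buc_powR. Qed.

Lemma buc_lnZ p X W : buc X -> posb X -> buc W -> posb W -> buc (lnZ p X W).
Proof.
by move=> bX pX bW pW; apply: buc_add; [exact: buc_ln|apply: buc_scale; exact: buc_ln].
Qed.

Lemma apZ_gt0 p X W x : posb X -> posb W -> 0 < apZ p X W x.
Proof. by move=> pX pW; rewrite mulr_gt0 ?powR_gt0// posb_gt0. Qed.

Definition entropy p X W a b := itg (fun x => X x * lnZ p X W x) a b.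
Definition energy p W Y a b := itg (fun x => `|Y x| `^ p * W x) a b.
Definition zmass p X W a b := itg (fun x => X x * apZ p X W x) a b.

Lemma entropy_growth p eps X W e :
  1 < p -> 0 < eps -> eps <= 8^-1 -> eps * (p - 1) <= 8^-1 ->
  buc X -> posb X -> buc W -> posb W -> (forall x, apZ p X W x <= 1) -> 0 < e ->
  exists N0, forall N, N0 <= N -> forall a b, b - a = 1 ->
  entropy p X W a b + (p - 1) * eps ^+ 2 / 128 * itg X a b
     - ((p - 1) + 2 * (p - 1) ^+ 2) * eps ^+ 2 * zmass p X W a b - e
  <= entropy p (stepX eps N (cst 1) X) (stepW p eps N (cst 1) X W) a b.
Proof.
move=> p1 e0 e8 eb8 bX pX bW pW Z1 ee0.
set beta := p - 1; have b0 : 0 < beta by rewrite subr_gt0.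
pose Z := apZ p X W.
have bZ : buc Z by exact: buc_apZ.
have bL : buc (lnZ p X W) by exact: buc_lnZ.
pose g0 x := X x * lnZ p X W x.
(* The new entropy density is at least [g0 + g1 cos + g2 cos^2]: [g1] integrates to almost 0 and
   [g2] to almost half its integral, whence 128 from 64. *)
pose g1 x := eps * g0 x + (beta * eps * X x - eps * beta * (X x * Z x)).
pose g2 x := beta * eps ^+ 2 / 64 * X x - (beta + 2 * beta ^+ 2) * eps ^+ 2 * (X x * Z x).
have bXZ : buc (fun x => X x * Z x) by exact: buc_mul.
have bg0 : buc g0 by exact: buc_mul.
have bg1 : buc g1.
  apply: buc_add; first exact: buc_scale.
  by apply: buc_sub; apply: buc_scale.
have bg2 : buc g2 by apply: buc_sub; apply: buc_scale.
have e2 : 0 < e / 2 by rewrite divr_gt0.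
have [N1 H1] := trig_averages bg1 e2 ltr01.
have [N2 H2] := trig_averages bg2 e2 ltr01.
exists (Num.max 0 (Num.max N1 N2)) => N; rewrite !ge_max => /and3P[Npos NN1 NN2] a b ab.
have ab1 : 1 <= b - a by rewrite ab.
have [h1 _ _ _ _] := H1 N NN1 a b ab1.
have [_ _ _ h2 _] := H2 N NN2 a b ab1.
rewrite ab mulr1 in h1 h2.
have cc := @cont_cos R N.
have cc2 : continuous (fun x : R => cos (N * x) ^+ 2).
  by under eq_fun do rewrite expr2; exact: cont_mul.
have [[[[cX cg0] cg1] cg2] cXZ] := (buc_cont bX, buc_cont bg0, buc_cont bg1, buc_cont bg2, buc_cont bXZ).
have cst_c (k : R) : continuous (fun _ : R => k) by exact: cst_continuous.
have lower : itg (fun x => (g0 x + 1 * (g1 x * cos (N * x))) + 1 * (g2 x * cos (N * x) ^+ 2)) a b <=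
  entropy p (stepX eps N (cst 1) X) (stepW p eps N (cst 1) X W) a b.
  have bc : buc (fun x : R => cos (N * x)).
    have -> : (fun x => cos (N * x)) = (fun x => cos (N * x + 0)).
      by apply/funext => x; rewrite addr0.
    exact: buc_cos.
  have c1 x : `|cos (N * x)| <= 1 by rewrite ler_norml cos_geN1 cos_le1.
  have cP (k : R) x : 0 <= k -> k <= 8^-1 -> `|k * cos (N * x)| <= 8^-1.
    move=> k0 k8; rewrite normrM ger0_norm// (le_trans _ k8)//.
    by rewrite ler_piMr.
  have Zx x : 0 <= Z x <= 1 by rewrite Z1 andbT ltW// apZ_gt0.
  have kZ x : 0 <= eps * beta * Z x <= 8^-1.
    have /andP[z0 z1] := Zx x.
    have eb : 0 <= eps * beta by rewrite mulr_ge0 ?ltW.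
    by rewrite mulr_ge0//= (le_trans _ eb8)// ler_piMr.
  have u0 x : 8^-1 <= 1 + eps * cos (N * x).
    by have := cP eps x (ltW e0) e8; rewrite ler_norml => /andP[? ?]; lra.
  have v0 x : 8^-1 <= 1 - eps * beta * Z x * cos (N * x).
    have /andP[k0 k8] := kZ x.
    by have := cP _ x k0 k8; rewrite ler_norml => /andP[? ?]; lra.
  have be k : buc (fun x => 1 + k * cos (N * x)).
    by apply: buc_add; [exact: buc_cst|exact: buc_scale].
  have bv : buc (fun x => 1 - eps * beta * Z x * cos (N * x)).
    apply: buc_sub; first exact: buc_cst.
    by apply: buc_mul => //; apply: buc_scale.
  have p8 : 0 < 8^-1 :> R by rewrite invr_gt0.
  have bl1 : buc (fun x => ln (1 + eps * cos (N * x))).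
    by apply: buc_ln => //; exists 8^-1.
  have bl2 : buc (fun x => ln (1 - eps * beta * Z x * cos (N * x))).
    by apply: buc_ln => //; exists 8^-1.
  have E x : stepX eps N (cst 1) X x *
      lnZ p (stepX eps N (cst 1) X) (stepW p eps N (cst 1) X W) x =
    X x * (1 + eps * cos (N * x)) * (lnZ p X W x +
     (beta * ln (1 + eps * cos (N * x)) + ln (1 - eps * beta * Z x * cos (N * x)))).
    rewrite /stepX /stepW /lnZ -/beta -/(Z x) /= mul1r.
    have X0 := posb_gt0 x pX; have W0 := posb_gt0 x pW.
    rewrite !lnM ?posrE//; first ring.
    - by apply: lt_le_trans (u0 x).
    - by apply: lt_le_trans (v0 x).
  rewrite /entropy; under [leRHS]eq_itg do rewrite E.
  apply: le_itg.
  - by do ?[apply: cont_add => // | apply: cont_mul => //].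
  - apply: buc_cont; apply: buc_mul; first exact: buc_mul.
    by apply: buc_add => //; apply: buc_add => //; apply: buc_scale.
  move=> x _.
  have := entropy_step e0 b0 e8 eb8 (Zx x) (c1 x) => /(ler_wpM2l (ltW (posb_gt0 x pX))).
  rewrite /g1 /g2 /g0; set l1 := ln _; set l2 := ln _; lra.
apply: le_trans lower.
rewrite !itgDZ//; [|exact: cont_mul|by do ?[apply: cont_add => // | apply: cont_mul => //]|exact: cont_mul].
have : itg g2 a b = beta * eps ^+ 2 / 64 * itg X a b - (beta + 2 * beta ^+ 2) * eps ^+ 2 * zmass p X W a b.
  rewrite itgB ?itgZ//; by apply: cont_mul.
have : 0 <= (beta + 2 * beta ^+ 2) * eps ^+ 2 * zmass p X W a b.
  apply: mulr_ge0.
    by rewrite mulr_ge0 ?sqr_ge0// addr_ge0 ?(ltW b0)// mulr_ge0 ?sqr_ge0.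
  by apply: itg_ge0 => x _; apply: mulr_ge0; apply: ltW; [exact: posb_gt0|exact: apZ_gt0].
move=> zp E2; rewrite E2 in h2.
have -> : entropy p X W a b = itg g0 a b by [].
by move: h1 h2; rewrite !ler_norml => /andP[? ?] /andP[? ?]; lra.
Qed.

End entropy.

Section energy.
Context {R : realType}.
Implicit Types (X W Y : R -> R) (p eps h N a b : R).

Lemma mass_growth eps X e : 0 < eps <= 1 -> buc X -> 0 < e ->
  exists N0, forall N, N0 <= N -> forall a b, b - a = 1 ->
  itg X a b - e <= itg (stepX eps N (cst 1) X) a b.
Proof.
move=> /andP[e0 e1] bX ee0; have [N0 H] := trig_averages bX ee0 ltr01.
exists N0 => N NN a b ab.
have ab1 : 1 <= b - a by rewrite ab.
have [h1 _ _ _ _] := H N NN a b ab1; rewrite ab mulr1 in h1.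
have -> : itg (stepX eps N (cst 1) X) a b = itg (fun x => X x + eps * (X x * cos (N * x))) a b.
  by apply: eq_itg => x _; rewrite /stepX /= mul1r; ring.
have cX := buc_cont bX.
rewrite itgDZ//; last by apply: cont_mul => //; exact: cont_cos.
rewrite lerD2l; move: h1; set t := itg _ _ _.
rewrite ler_norml => /andP[h1 h2]; nra.
Qed.

(** The convexity inequality is used with [y = Y x] and [t = eps h X sin (N x)]: the term linear in
    [t] and the change of the weight average out. The threshold [N0] comes before [h], which will
    depend on [N], and before [r] and [c], which will depend on the energy to be reached. *)
Lemma energy_growth p eps h1 h2 X W Y e :
  1 < p -> 0 < eps -> eps * (p - 1) <= 8^-1 -> 0 < h1 -> h1 <= h2 ->
  buc X -> posb X -> buc W -> posb W -> buc Y ->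
  (forall x, apZ p X W x <= 1) -> 0 < e ->
  exists N0, forall N, N0 <= N -> forall h, h1 <= h <= h2 ->
  forall a b, b - a = 1 -> forall r c, 0 <= c <= 1 ->
  (forall y t, `|y| `^ p + p * spow (p - 1) y * t +
     Num.max 0 (c * (`|t| `^ p - r * `|y| `^ p)) <= `|y + t| `^ p) ->
  energy p W Y a b + c / 2 * ((eps * h1) `^ p * 2 `^ (- p) * zmass p X W a b
     - r * energy p W Y a b) - e
  <= energy p (stepW p eps N (cst 1) X W) (stepY eps h N X Y) a b.
Proof.
move=> p1 e0 eb8 h10 h12 bX pX bW pW bY Z1 ee0.
set beta := p - 1; have b0 : 0 < beta by rewrite subr_gt0.
pose Z := apZ p X W.
have bZ : buc Z by exact: buc_apZ.
have bP : buc (fun x => `|Y x| `^ p).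
  by apply: (@buc_comp _ (fun t => `|t| `^ p)) => //; exact: continuous_normpow.
have bS : buc (fun x => spow beta (Y x)).
  by apply: (@buc_comp _ (spow beta)) => //; exact: continuous_spow.
pose g0 x := `|Y x| `^ p * W x.
pose k x := eps * beta * Z x.
have bk : buc k by exact: buc_scale.
pose g1 x := k x * g0 x.
pose g2 x := W x * spow beta (Y x) * X x.
pose g3 x := k x * g2 x.
pose g4 x := X x * Z x.
have bg0 : buc g0 by exact: buc_mul.
have bg1 : buc g1 by exact: buc_mul.
have bg2 : buc g2 by apply: buc_mul => //; exact: buc_mul.
have bg3 : buc g3 by exact: buc_mul.
have bg4 : buc g4 by exact: buc_mul.
set kap := (eps * h1) `^ p * 2 `^ (- p).
have kap0 : 0 < kap by rewrite mulr_gt0 ?powR_gt0// mulr_gt0.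
have h20 : 0 < h2 by apply: lt_le_trans h12.
(* The total weight of the four averaging errors: 1 for [g1], [p eps h2] for each of [g2] and [g3],
   and [p kap] for [g4]. *)
pose D := 1 + 2 * (p * eps * h2) + p * kap.
have p0 : 0 < p by lra.
have peh : 0 < p * eps * h2 by rewrite !mulr_gt0.
have pk : 0 < p * kap by rewrite mulr_gt0.
have D0 : 0 < D by rewrite /D; lra.
pose d := e / D; have d0 : 0 < d by rewrite divr_gt0.
have Dd : D * d = e by rewrite /d mulrC divfK// gt_eqF.
have [N1 H1] := trig_averages bg1 d0 ltr01.
have [N2 H2] := trig_averages bg2 d0 ltr01.
have [N3 H3] := trig_averages bg3 d0 ltr01.
have [N4 H4] := trig_averages bg4 d0 ltr01.
exists (Num.max 0 (Num.max (Num.max N1 N2) (Num.max N3 N4))) => N.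
rewrite !ge_max => /and3P[Npos /andP[NN1 NN2] /andP[NN3 NN4]] h /andP[hh1 hh2] a b ab r c /andP[c0 c1] gain.
have ab1 : 1 <= b - a by rewrite ab.
have [q1 _ _ _ _] := H1 N NN1 a b ab1.
have [_ q2 _ _ _] := H2 N NN2 a b ab1.
have [_ _ q3 _ _] := H3 N NN3 a b ab1.
have [_ _ _ _ q4] := H4 N NN4 a b ab1.
rewrite ab mulr1 in q1 q2 q3 q4.
have cc := @cont_cos R N.
have cs := @cont_sin R N.
have ccs : continuous (fun x : R => cos (N * x) * sin (N * x)) by exact: cont_mul.
have cs2 : continuous (fun x : R => sin (N * x) ^+ 2).
  by under eq_fun do rewrite expr2; exact: cont_mul.
have [[[[cg0 cg1] cg2] cg3] cg4] := (buc_cont bg0, buc_cont bg1, buc_cont bg2, buc_cont bg3, buc_cont bg4).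
have cst_c (q : R) : continuous (fun _ : R => q) by exact: cst_continuous.
have C1 : continuous (fun x => g1 x * cos (N * x)) by exact: cont_mul.
have C2 : continuous (fun x => g2 x * sin (N * x)) by exact: cont_mul.
have C3 : continuous (fun x => g3 x * (cos (N * x) * sin (N * x))) by exact: cont_mul.
have C4 : continuous (fun x => g4 x * sin (N * x) ^+ 2) by exact: cont_mul.
have addc (f g : R -> R) q : continuous f -> continuous g -> continuous (fun x => f x + q * g x).
  by move=> cf cg; apply: cont_add => //; apply: cont_mul.
(* The minorant is assembled one term at a time so that [itgDZ] can take its integral apart
   again. *)
pose F1 x := g0 x + (- 1) * (g1 x * cos (N * x)).
pose F2 x := F1 x + (p * eps * h) * (g2 x * sin (N * x)).
pose F3 x := F2 x + (- (p * eps * h)) * (g3 x * (cos (N * x) * sin (N * x))).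
pose F4 x := F3 x + (c / 2 * kap * (1 - p)) * g4 x.
pose F5 x := F4 x + (c / 2 * kap * (2 * p)) * (g4 x * sin (N * x) ^+ 2).
pose F6 x := F5 x + (- (c / 2 * r)) * g0 x.
have cF1 : continuous F1 by exact: addc.
have cF2 : continuous F2 by exact: addc.
have cF3 : continuous F3 by exact: addc.
have cF4 : continuous F4 by exact: addc.
have cF5 : continuous F5 by exact: addc.
have cF6 : continuous F6 by exact: addc.
have lower : itg F6 a b <= energy p (stepW p eps N (cst 1) X W) (stepY eps h N X Y) a b.
  have bc : buc (fun x : R => cos (N * x)).
    have -> : (fun x => cos (N * x)) = (fun x => cos (N * x + 0)).
      by apply/funext => x; rewrite addr0.
    exact: buc_cos.
  have cW : continuous (stepW p eps N (cst 1) X W).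
    apply: cont_mul; first exact: buc_cont.
    apply: cont_sub => //; apply: cont_mul; first exact: (buc_cont bk).
    by apply: cont_mul; [exact: cst_continuous|exact: cont_cos].
  have cY : continuous (stepY eps h N X Y).
    apply: cont_add; first exact: buc_cont.
    by apply: cont_mul => //; apply: cont_mul => //; exact: buc_cont.
  apply: le_itg => //.
    apply: cont_mul => //.
    move=> x; apply: (@continuous_comp _ _ _ (stepY eps h N X Y) (fun t => `|t| `^ p)) => //.
      exact: cY.
    exact: (continuous_normpow p1).
  move=> x _.
  have X0 := posb_gt0 x pX; have W0 := posb_gt0 x pW.
  have Z0 : 0 < Z x by exact: apZ_gt0.
  set co := cos (N * x); set si := sin (N * x).
  have co1 : `|co| <= 1 by rewrite ler_norml cos_geN1 cos_le1.
  have si1 : `|si| <= 1 by rewrite ler_norml sin_geN1 sin_le1.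
  have k8 : 0 <= k x <= 8^-1.
    have eb : 0 <= eps * beta by rewrite mulr_ge0 ?ltW.
    rewrite /k mulr_ge0 ?(ltW Z0)//=.
    by rewrite (le_trans _ eb8)// ler_piMr// Z1.
  have kc : `|k x * co| <= 8^-1.
    case/andP: k8 => kx0 kx8; rewrite normrM ger0_norm// (le_trans _ kx8)//.
    by rewrite ler_piMr.
  rewrite /stepW /stepY -/beta -/(Z x) -/(k x) /= mul1r -/co -/si.
  pose t := eps * h * (X x * si).
  have h0 : 0 < h by apply: lt_le_trans hh1.
  have tp : (eps * h1) `^ p * X x `^ p * (2 `^ (- p) * (1 - p) + 2 * p * 2 `^ (- p) * si ^+ 2) <= `|t| `^ p.
    apply: (@le_trans _ _ ((eps * h1) `^ p * X x `^ p * `|si| `^ p)).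
      by rewrite ler_wpM2l ?normpow_lower// mulr_ge0 ?powR_ge0.
    rewrite /t normrM (gtr0_norm (mulr_gt0 e0 h0)) normrM (gtr0_norm X0).
    have eh0 : 0 <= eps * h by rewrite mulr_ge0 ?ltW.
    have eh1 : 0 <= eps * h1 by rewrite mulr_ge0 ?ltW.
    have Xs : 0 <= X x * `|si| by rewrite mulr_ge0 ?(ltW X0).
    rewrite (powRM _ eh0 Xs) (powRM _ (ltW X0) (normr_ge0 si)) mulrA.
    rewrite ler_wpM2r ?powR_ge0// ler_wpM2r ?powR_ge0//.
    apply: ge0_ler_powR; rewrite ?nnegrE ?(ltW p0)//.
    by rewrite ler_wpM2l// ltW.
  have XZ : W x * X x `^ p = g4 x.
    by rewrite powR_split ?(ltW X0)// /g4 /Z /apZ; ring.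
  have H := gain (Y x) t.
  have v0 : 2^-1 <= 1 - k x * co.
    by move: kc; rewrite ler_norml => /andP[k1 k2]; clear - k1 k2; lra.
  have vW : 0 <= W x * (1 - k x * co) by rewrite mulr_ge0 ?(ltW W0)//; clear - v0; lra.
  have := ler_wpM2r vW H.
  set mx := Num.max _ _ => H'.
  have mx0 : 0 <= mx by rewrite le_max lexx.
  have mx1 : c * (`|t| `^ p - r * `|Y x| `^ p) <= mx by rewrite le_max lexx orbT.
  (* The new weight is only known to be at least [W x / 2]; since [mx >= 0], this costs a factor 2
     in the gain. *)
  have gn : W x / 2 * (c * (`|t| `^ p - r * `|Y x| `^ p)) <= mx * (W x * (1 - k x * co)).
    apply: (@le_trans _ _ (W x / 2 * mx)).
      by rewrite ler_wpM2l// divr_ge0 ?(ltW W0).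
    have -> : W x / 2 * mx = mx * (W x * 2^-1) by ring.
    by rewrite ler_wpM2l// ler_wpM2l ?(ltW W0).
  have c2W : 0 <= W x / 2 * c by rewrite mulr_ge0 ?divr_ge0 ?(ltW W0).
  have := ler_wpM2l c2W tp.
  have -> : W x / 2 * c * ((eps * h1) `^ p * X x `^ p * (2 `^ (- p) * (1 - p) + 2 * p * 2 `^ (- p) * si ^+ 2))
    = c / 2 * kap * (1 - p) * g4 x + c / 2 * kap * (2 * p) * (g4 x * si ^+ 2).
    rewrite -XZ /kap; ring.
  move=> H2'.
  rewrite -/t.
  apply: le_trans H'.
  rewrite /F6 /F5 /F4 /F3 /F2 /F1 -/co -/si.
  have -> : g0 x = `|Y x| `^ p * W x by [].
  have -> : g1 x = k x * (`|Y x| `^ p * W x) by [].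
  have e3 : g3 x = k x * (W x * spow beta (Y x) * X x) by [].
  have e2' : g2 x = W x * spow beta (Y x) * X x by [].
  have te : p * spow beta (Y x) * t * (W x * (1 - k x * co)) =
     p * eps * h * (g2 x * si) - p * eps * h * (g3 x * (co * si)).
    by rewrite e3 e2' /t; ring.
  rewrite -/beta !mulrDl te; move: gn H2'; set T := `|t| `^ p; set P := `|Y x| `^ p.
  move: (g2 x) (g3 x) (g4 x) => G2 G3 G4 l1 l2; clear - l1 l2; lra.
apply: le_trans lower.
rewrite /F6 itgDZ// /F5 itgDZ// /F4 itgDZ// /F3 itgDZ// /F2 itgDZ// /F1 itgDZ//.
have -> : energy p W Y a b = itg g0 a b by [].
have -> : zmass p X W a b = itg g4 a b by [].
move: q1 q2 q3 q4.
set I0 := itg g0 a b; set I4 := itg g4 a b.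
set J1 := itg _ a b; set J2 := itg _ a b; set J3 := itg _ a b; set J4 := itg _ a b.
move=> q1 q2 q3 q4.
have pe0 : 0 <= p * eps by rewrite mulr_ge0 ?(ltW p0) ?(ltW e0).
have peh0 : 0 <= p * eps * h by rewrite mulr_ge0// (le_trans (ltW h10)).
have peh2 : p * eps * h <= p * eps * h2 by rewrite ler_wpM2l.
have P2 : `|p * eps * h * J2| <= p * eps * h2 * d.
  by rewrite normrM (ger0_norm peh0); exact: ler_pM.
have P3 : `|p * eps * h * J3| <= p * eps * h2 * d.
  by rewrite normrM (ger0_norm peh0); exact: ler_pM.
have P4 : c / 2 * kap * (2 * p) * (J4 - 2^-1 * I4) >= - (p * kap * d).
  move: q4; rewrite ler_norml => /andP[q4 _].
  have cp : 0 <= c / 2 * kap * (2 * p).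
    apply: mulr_ge0; last by rewrite ltW// mulr_gt0.
    by apply: mulr_ge0; [exact: divr_ge0|exact: ltW].
  have := ler_wpM2l cp q4; apply: le_trans.
  rewrite mulrN lerN2.
  have : c * (p * kap * d) <= p * kap * d by rewrite ler_piMl// mulr_ge0 ?(ltW pk) ?(ltW d0).
  by move=> l; clear - l; lra.
have De : e = d + 2 * (p * eps * h2 * d) + p * kap * d by rewrite -Dd /D; ring.
move: P2 P3 q1 P4; rewrite !ler_norml => /andP[l1 l2] /andP[l3 l4] /andP[l5 l6] l7.
rewrite De; clear - l1 l2 l3 l4 l5 l6 l7; lra.
Qed.

End energy.

(** * The Hilbert transform of an oscillation *)
Section sine_integral.
Context {R : realType}.
Implicit Types (f phi : R -> R) (a b c x y N eta L e t : R).

(** [Num.max c t] is [t] on the range of integration; it makes [1/t] continuous on the whole line,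
    as the lemmas on [itg] require. *)
Lemma cont_invmax c : 0 < c -> continuous (fun t : R => (Num.max c t)^-1).
Proof.
move=> c0 t; apply: cvgV; first by rewrite gt_eqF// lt_max c0.
by apply: continuous_max; [exact: cvg_cst|exact: cvg_id].
Qed.

Lemma sin_le_norm (x : R) : `|sin x| <= `|x|.
Proof.
have /= := @cos_lip R (x - pi / 2) (0 - pi / 2).
have c t : cos (t - pi / 2) = sin t :> R.
  by rewrite cosB cos_pihalf sin_pihalf mulr0 add0r mulr1.
rewrite !c sin0 subr0.
by have -> : x - pi / 2 - (0 - pi / 2) = x by ring.
Qed.

Lemma one_sub_cos_le (x : R) : 1 - cos x <= x ^+ 2 / 2.
Proof.
suff H y : 1 - cos (y *+ 2) <= (y *+ 2) ^+ 2 / 2.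
  have e : x / 2 *+ 2 = x by field.
  by have := H (x / 2); rewrite e.
rewrite cos_mulr2n cos2sin2.
have := sin_le_norm y; rewrite -ler_sqr ?nnegrE// !real_normK ?num_real//.
by set s := sin _ => h; lra.
Qed.

Definition sineint N a : R := itg (fun t => sin (N * t) / Num.max a t) a 2.

Lemma cos1_lt1 : cos 1 < 1 :> R.
Proof.
rewrite -[ltRHS]cos0 ltr_cos ?in_itv/= ?lexx ?ler01 ?pi_ge0//.
by apply: le_trans (pi_ge2 R); rewrite ler1n.
Qed.

(** Taking [1 - cos] rather than [- cos] as primitive of the sine makes the remaining integrand
    nonnegative, so that it can be bounded below on any subinterval. *)
Lemma sineint_parts N a : 0 < N -> 0 < a <= 2 ->
  sineint N a = (1 - cos (N * 2)) / (N * 2) - (1 - cos (N * a)) / (N * a) +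
    itg (fun t => (1 - cos (N * t)) * (N^-1 * ((Num.max a t)^-1 ^+ 2))) a 2.
Proof.
move=> N0 /andP[a0 a2].
have cm := cont_invmax a0; have cs := @cont_sin R N; have cc := @cont_cos R N.
have cst_c (k : R) : continuous (fun _ : R => k) by exact: cst_continuous.
have c1 : continuous (fun t : R => (1 - cos (N * t)) * (N^-1 * ((Num.max a t)^-1 ^+ 2))).
  apply: cont_mul; first exact: cont_sub.
  apply: cont_mul => //; under eq_fun do rewrite expr2; exact: cont_mul.
have c2 : continuous (fun t : R => sin (N * t) / Num.max a t) by exact: cont_mul.
rewrite /sineint -[LHS](subrK (itg (fun t => (1 - cos (N * t)) * (N^-1 * ((Num.max a t)^-1 ^+ 2))) a 2)).
congr (_ + _); rewrite -itgB//.
pose F t := (1 - cos (N * t)) / (N * t) : R.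
suff dF t : a <= t <= 2 -> is_derive t 1 F (sin (N * t) / Num.max a t -
    (1 - cos (N * t)) * (N^-1 * ((Num.max a t)^-1 ^+ 2))).
  by rewrite (itg_FTC _ a2 dF)//; exact: cont_sub.
move=> /andP[t1 t2]; have t0 : 0 < t by apply: lt_le_trans t1.
have -> : F = (fun t => 1 - cos (N * t)) * (fun t => (N * t)^-1) by [].
have d1 : is_derive t 1 (fun t => N * t) N.
  have -> : (fun t => N * t) = N \*: id by [].
  by apply: is_derive_eq; rewrite -[LHS]/(N * 1) mulr1.
have d2 : is_derive t 1 (fun t => cos (N * t)) (- sin (N * t) * N).
  exact: (@is_derive1_comp _ cos (fun t => N * t)).
have d3 : is_derive t 1 (fun t => 1 - cos (N * t)) (sin (N * t) * N).
  have -> : (fun t => 1 - cos (N * t)) = cst 1 - (fun t => cos (N * t)) by [].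
  by apply: is_derive_eq; rewrite add0r mulNr opprK.
have nt : N * t != 0 by rewrite mulf_neq0 ?gt_eqF.
have d4 := @is_deriveV _ (fun t => N * t) t N 1 nt d1.
apply: is_derive_eq.
rewrite max_r// /=; set s := sin _; set c := cos _.
rewrite -![_ *: _]/(_ * _); field.
by rewrite !gt_eqF.
Qed.

Lemma sineint_bounds N a : 1 <= N -> 0 < a -> N * a <= (1 - cos 1) / 4 ->
  (1 - cos 1) / 8 <= sineint N a <= 4.
Proof.
move=> N1 a0 Na; have N0 : 0 < N by apply: lt_le_trans N1.
have c01 : 0 < 1 - cos 1 :> R by rewrite subr_gt0 cos1_lt1.
have c02 : 1 - cos 1 <= 2 :> R by have := cos_geN1 (1 : R); lra.
have NaE : 0 < N * a by rewrite mulr_gt0.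
have iN0 : 0 < N^-1 by rewrite invr_gt0.
have iN1 : N^-1 <= 1 by rewrite invf_le1.
have aN : a <= N^-1.
  by rewrite -[N^-1]mul1r ler_pdivlMr// mulrC; lra.
have a2 : a <= 2 by lra.
rewrite sineint_parts ?a0//.
set I := itg _ _ _.
have cm := cont_invmax a0; have cs := @cont_sin R N; have cc := @cont_cos R N.
have cst_c (k : R) : continuous (fun _ : R => k) by exact: cst_continuous.
pose G t : R := (1 - cos (N * t)) * (N^-1 * ((Num.max a t)^-1 ^+ 2)).
have cG : continuous G.
  apply: cont_mul; first exact: cont_sub.
  apply: cont_mul => //; under eq_fun do rewrite expr2; exact: cont_mul.
have IE : I = itg G a 2 by [].
have c1 t : 0 <= 1 - cos t :> R by rewrite subr_ge0 cos_le1.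
have G0 t : 0 <= G t.
  rewrite /G; apply: mulr_ge0 => //.
  by rewrite mulr_ge0 ?sqr_ge0// ltW.
have Fa : 0 <= (1 - cos (N * a)) / (N * a) <= (1 - cos 1) / 8.
  rewrite divr_ge0 ?c1 ?(ltW NaE)//=.
  rewrite ler_pdivrMr//; apply: le_trans (one_sub_cos_le _) _.
  rewrite expr2; nra.
have F2 : 0 <= (1 - cos (N * 2)) / (N * 2) <= 1.
  rewrite divr_ge0 ?c1 ?mulr_ge0 ?(ltW N0)//=.
  rewrite ler_pdivrMr ?mulr_gt0//; have := cos_geN1 (N * 2); lra.
have I1 : (1 - cos 1) / 4 <= I.
  have N2 : N^-1 <= 2 * N^-1 by lra.
  have N22 : 2 * N^-1 <= 2 by lra.
  rewrite IE (@itg_split _ _ a N^-1 2)//; last by lra.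
  rewrite (@itg_split _ _ N^-1 (2 * N^-1) 2)//.
  have q1 : 0 <= itg G a N^-1 by exact: itg_ge0.
  have q2 : 0 <= itg G (2 * N^-1) 2 by exact: itg_ge0.
  (* On [[1/N, 2/N]] the angle [N t] lies in [[1, 2]], where [1 - cos] is at least [1 - cos 1]; the
     contribution is independent of [N]. *)
  have : itg (fun=> (1 - cos 1) * N / 4) N^-1 (2 * N^-1) <= itg G N^-1 (2 * N^-1).
    apply: le_itg => // t /andP[t1 t2].
    have t0 : 0 < t by apply: lt_le_trans t1.
    rewrite /G max_r ?(le_trans aN)//.
    have Nt1 : 1 <= N * t by rewrite -ler_pdivrMl// mulr1.
    have Nt2 : N * t <= 2 by rewrite -ler_pdivlMl// mulrC.
    have cosb : cos (N * t) <= cos 1.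
      have p2 := pi_ge2 R.
      by rewrite leNgt ltr_cos -?leNgt// in_itv/=; apply/andP; split; lra.
    have -> : (1 - cos 1) * N / 4 = (1 - cos 1) * (N / 4) by ring.
    apply: ler_pM; [exact: ltW|by rewrite divr_ge0 ?(ltW N0)|by lra|].
    rewrite ler_pdivlMl//.
    rewrite exprVn -[(t ^+ 2)^-1]mul1r ler_pdivlMr ?exprn_gt0//.
    have -> : N * (N / 4) * t ^+ 2 = (N * t) ^+ 2 / 4 by field.
    rewrite ler_pdivrMr// mul1r expr2; nra.
  rewrite itg_cst//.
  have -> : (1 - cos 1) * N / 4 * (2 * N^-1 - N^-1) = (1 - cos 1) / 4 by field; rewrite gt_eqF.
  by move=> ?; lra.
have I2 : I <= 5 / 2.
  have N2 : N^-1 <= 2 by lra.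
  rewrite IE (@itg_split _ _ a N^-1 2)//.
  (* For the upper bound, [1 - cos s <= s^2 / 2] is used below [1/N] and [1 - cos s <= 2] above
     it. *)
  have : itg G a N^-1 <= itg (fun=> N / 2) a N^-1.
    apply: le_itg => // t /andP[t1 t2].
    have t0 : 0 < t by apply: lt_le_trans t1.
    rewrite /G max_r//.
    have H := one_sub_cos_le (N * t).
    have h : 0 <= N^-1 * (t^-1 ^+ 2) by rewrite mulr_ge0 ?sqr_ge0// ltW.
    apply: le_trans (ler_wpM2r h H) _.
    rewrite le_eqVlt; apply/orP; left; apply/eqP; field.
    by rewrite !gt_eqF.
  rewrite itg_cst// => q1.
  have : itg G N^-1 2 <= itg (fun t => 2 * N^-1 * ((Num.max a t)^-1 ^+ 2)) N^-1 2.
    apply: le_itg => //.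
      by apply: cont_mul => //; under eq_fun do rewrite expr2; exact: cont_mul.
    move=> t _; rewrite /G -mulrA ler_wpM2r//.
      by rewrite mulr_ge0 ?sqr_ge0// ltW.
    by have := cos_geN1 (N * t); lra.
  have dF t : N^-1 <= t <= 2 -> is_derive t 1 (fun t => - (2 * N^-1) * t^-1)
      (2 * N^-1 * ((Num.max a t)^-1 ^+ 2)).
    move=> /andP[t1 t2].
    have t0 : 0 < t by apply: lt_le_trans t1.
    have tn : id t != 0 by rewrite gt_eqF.
    have d := @is_deriveV _ id t _ 1 tn (is_derive_id t 1).
    have -> : (fun t => - (2 * N^-1) * t^-1) = (- (2 * N^-1)) \*: (fun t => (id t)^-1) by [].
    apply: is_derive_eq; rewrite max_r ?(le_trans aN)//.
    by rewrite -![_ *: _]/(_ * _); field; rewrite !gt_eqF.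
  rewrite (itg_FTC _ N2 dF); last first.
    by apply: cont_mul => //; under eq_fun do rewrite expr2; exact: cont_mul.
  rewrite invrK.
  have -> : - (2 * N^-1) * 2^-1 - - (2 * N^-1) * N = 2 - N^-1 by field; rewrite gt_eqF.
  move=> q2.
  have : N / 2 * (N^-1 - a) <= 2^-1.
    have -> : N / 2 * (N^-1 - a) = 2^-1 - N * a / 2 by field; rewrite gt_eqF.
    by lra.
  by move=> q3; lra.
by move: Fa F2 => /andP[? ?] /andP[? ?]; apply/andP; split; lra.
Qed.

End sine_integral.

Section hilbert_osc.
Context {R : realType}.
Implicit Types (f phi D : R -> R) (a b c x y N eta L e t ph tau : R).

(** The principal value truncated to [eta <= |x - y| <= 2], folded onto positive [t]. The radius 2
    is such that, for [x] in [[4n+1, 4n+2]], the window meets the support of the [n]-th bump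
    only. *)
Definition symint f x eta : R :=
  itg (fun t => (f (x - t) - f (x + t)) / Num.max eta t) eta 2.

(** Below [tau] the quotient is merely bounded by [L]; above [tau] it has Lipschitz constant
    [2 L / tau] and [itg_osc] applies. The bound does not depend on [eta]. *)
Lemma osc_quotient D L N ph eta tau : 0 < L -> 1 <= N -> 0 < eta -> eta <= tau ->
  tau <= 2 -> continuous D -> (forall t, `|D t| <= L * `|t|) ->
  (forall t s, `|D t - D s| <= L * `|t - s|) ->
  `|itg (fun t => D t / Num.max eta t * cos (N * t + ph)) eta 2| <=
  L * tau + (4 * L / tau + L) * (2 * pi / N).
Proof.
move=> L0 N1 eta0 etau tau2 cD Db Dl.
have N0 : 0 < N by apply: lt_le_trans N1.
have tau0 : 0 < tau by apply: lt_le_trans etau.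
have pN : 0 <= 2 * pi / N by rewrite divr_ge0 ?mulr_ge0 ?pi_ge0 ?ltW.
have cc := @cont_cos_affine R N ph.
have cm := cont_invmax eta0; have cm' := cont_invmax tau0.
have cq : continuous (fun t => D t / Num.max eta t) by exact: cont_mul.
have cq' : continuous (fun t => D t / Num.max tau t) by exact: cont_mul.
rewrite (@itg_split _ _ eta tau 2)//; last exact: cont_mul.
apply: le_trans (ler_normD _ _) _; apply: lerD.
  apply: le_trans (@itg_abs _ _ eta tau L _ _ _) _ => //; first exact: cont_mul.
    move=> t /andP[t1 t2]; have t0 : 0 < t by apply: lt_le_trans t1.
    rewrite normrM -[leRHS]mulr1; apply: ler_pM => //; last first.
      by rewrite ler_norml cos_geN1 cos_le1.
    rewrite max_r// normrM normfV (gtr0_norm t0) ler_pdivrMr//.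
    by have := Db t; rewrite (gtr0_norm t0).
  by rewrite ler_wpM2l ?(ltW L0)// lerBlDr lerDl ltW.
have -> : itg (fun t => D t / Num.max eta t * cos (N * t + ph)) tau 2 =
          itg (fun t => D t / Num.max tau t * cos (N * t + ph)) tau 2.
  by apply: eq_itg => t /andP[t1 _]; rewrite !max_r// (le_trans etau).
apply: le_trans (@itg_osc _ _ tau 2 N ph (2 * L / tau * (2 * pi / N)) L N0 cq' tau2 _ _) _.
- move=> t /andP[t1 t2]; have t0 : 0 < t by apply: lt_le_trans t1.
  rewrite max_r// normrM normfV (gtr0_norm t0) ler_pdivrMr//.
  by have := Db t; rewrite (gtr0_norm t0).
- move=> t s /andP[t1 t2] /andP[s1 s2] ts.
  have t0 : 0 < t by apply: lt_le_trans t1.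
  have s0 : 0 < s by apply: lt_le_trans s1.
  rewrite !max_r//.
  have -> : D t / t - D s / s = ((D t - D s) + (D s / s) * (s - t)) / t.
    by field; rewrite !gt_eqF.
  rewrite normrM normfV (gtr0_norm t0).
  have Ds : `|D s / s| <= L.
    rewrite normrM normfV (gtr0_norm s0) ler_pdivrMr//.
    by have := Db s; rewrite (gtr0_norm s0).
  have h : `|D t - D s + D s / s * (s - t)| <= 2 * L * `|t - s|.
    apply: le_trans (ler_normD _ _) _.
    have := Dl t s; rewrite normrM [`|s - t|]distrC => h1.
    have : `|D s / s| * `|t - s| <= L * `|t - s| by rewrite ler_wpM2r.
    by move=> *; lra.
  have -> : 2 * L / tau * (2 * pi / N) = 2 * L * (2 * pi / N) / tau by ring.
  apply: ler_pM => //; first by rewrite invr_ge0 ltW.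
    apply: le_trans h _.
    by rewrite ler_wpM2l// mulr_ge0// ltW.
  by rewrite lef_pV2.
have q : 0 <= 2 * L / tau * (2 * pi / N).
  by rewrite mulr_ge0// divr_ge0 ?mulr_ge0 ?ltW.
have -> : (4 * L / tau + L) * (2 * pi / N) = 2 * L / tau * (2 * pi / N) * 2 + L * (2 * pi / N) by ring.
by rewrite lerD2r ler_wpM2l// lerBlDr lerDl ltW.
Qed.

(* The addition formulas leave [2 phi(x) sin (N x)] times a sine integral, which
   is bounded below uniformly in [N], and oscillating difference quotients. *)
Lemma hilbert_osc L e : 0 < L -> 0 < e ->
  exists N0, forall N, N0 <= N -> exists h, (1 - cos 1) / 4 <= h <= 8 /\
  exists2 eta0 : R, 0 < eta0 & forall phi, lipb L phi -> forall x eta, 0 < eta < eta0 ->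
  `|symint (fun y => phi y * cos (N * y)) x eta - h * (phi x * sin (N * x))| <= e.
Proof.
move=> L0 e0.
pose tau := Num.min 1 (e / (16 * L)).
have tau0 : 0 < tau by rewrite lt_min ltr01 divr_gt0// mulr_gt0.
have tau1 : tau <= 1 by rewrite ge_min lexx.
have taue : 2 * L * tau <= e / 8.
  have : tau <= e / (16 * L) by rewrite ge_min lexx orbT.
  rewrite ler_pdivlMr ?mulr_gt0//; lra.
pose K := (4 * (2 * L) / tau + 2 * L) * (2 * pi).
have K0 : 0 < K.
  by rewrite mulr_gt0 ?mulr_gt0 ?pi_gt0// addr_gt0 ?divr_gt0 ?mulr_gt0.
exists (Num.max 1 (8 * K / e)) => N; rewrite ge_max => /andP[N1 N2].
have N0 : 0 < N by apply: lt_le_trans N1.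
have KN : (4 * (2 * L) / tau + 2 * L) * (2 * pi / N) <= e / 8.
  have -> : (4 * (2 * L) / tau + 2 * L) * (2 * pi / N) = K / N by rewrite /K; ring.
  by rewrite ler_pdivrMr//; move: N2; rewrite ler_pdivrMr//; lra.
have c01 : 0 < 1 - cos 1 :> R by rewrite subr_gt0 cos1_lt1.
(* The three constraints are [eta0 <= tau], the hypothesis of [sineint_bounds], and
   [L * N * eta0 <= e / 8], which pays for replacing the truncation [eta] by [eta0] in the sine
   integral. *)
pose eta0 := Num.min tau (Num.min ((1 - cos 1) / 4 / N) (e / (8 * L) / N)).
have bc0 : 0 < (1 - cos 1) / 4 / N by rewrite !divr_gt0.
have be0 : 0 < e / (8 * L) / N by rewrite !divr_gt0// mulr_gt0.
have eta00 : 0 < eta0 by rewrite lt_min tau0 lt_min bc0 be0.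
have eta0tau : eta0 <= tau by rewrite ge_min lexx.
have eta0r : eta0 <= Num.min ((1 - cos 1) / 4 / N) (e / (8 * L) / N).
  by rewrite ge_min lexx orbT.
have eta0c : N * eta0 <= (1 - cos 1) / 4.
  by rewrite mulrC -ler_pdivlMr//; apply: le_trans eta0r _; rewrite ge_min lexx.
have eta0e : L * (N * eta0) <= e / 8.
  have : eta0 <= e / (8 * L) / N by apply: le_trans eta0r _; rewrite ge_min lexx orbT.
  by rewrite !ler_pdivlMr ?mulr_gt0//; lra.
have /andP[S1 S2] := sineint_bounds N1 eta00 eta0c.
exists (2 * sineint N eta0); split; first by apply/andP; split; lra.
exists eta0 => // phi [phib phil] x eta /andP[etapos eta_lt].
have etatau : eta <= tau by apply: le_trans eta0tau; exact: ltW.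
have tau2 : tau <= 2 by lra.
have cphi : continuous phi by apply: buc_cont; apply: (@lipb_buc _ L).
have cxm : continuous (fun t => x - t).
  by move=> t; apply: cvgB; [exact: cvg_cst|exact: cvg_id].
have cxp : continuous (fun t => x + t).
  by move=> t; apply: cvgD; [exact: cvg_cst|exact: cvg_id].
have cst_c (k : R) : continuous (fun _ : R => k) by exact: cst_continuous.
have cpm : continuous (fun t => phi (x - t)).
  by move=> t; apply: (@continuous_comp _ _ _ (fun t => x - t) phi); [exact: cxm|exact: cphi].
have cpp : continuous (fun t => phi (x + t)).
  by move=> t; apply: (@continuous_comp _ _ _ (fun t => x + t) phi); [exact: cxp|exact: cphi].
(* [DA] is the factor of [cos (N x) cos (N t)]. The factor of [sin (N x) sin (N t)] is the sum of
   the two values; removing [2 phi x], which yields the main term, leaves [DB], which is also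
   O(t). *)
pose DA t := phi (x - t) - phi (x + t).
pose DB t := phi (x - t) + phi (x + t) - 2 * phi x.
have cDA : continuous DA by exact: cont_sub.
have cDB : continuous DB by apply: cont_sub => //; exact: cont_add.
have L2 : 0 < 2 * L by rewrite mulr_gt0.
have xm t : x - t - x = - t by ring.
have xp t : x + t - x = t by ring.
have DAb t : `|DA t| <= 2 * L * `|t|.
  have -> : DA t = (phi (x - t) - phi x) - (phi (x + t) - phi x) by rewrite /DA; ring.
  apply: le_trans (ler_normB _ _) _.
  have := phil (x - t) x; have := phil (x + t) x; rewrite xm xp normrN => l1 l2; clear - l1 l2; lra.
have DBb t : `|DB t| <= 2 * L * `|t|.
  have -> : DB t = (phi (x - t) - phi x) + (phi (x + t) - phi x) by rewrite /DB; ring.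
  apply: le_trans (ler_normD _ _) _.
  have := phil (x - t) x; have := phil (x + t) x; rewrite xm xp normrN => l1 l2; clear - l1 l2; lra.
have ym t s : x - t - (x - s) = - (t - s) by ring.
have yp t s : x + t - (x + s) = t - s by ring.
have DAl t s : `|DA t - DA s| <= 2 * L * `|t - s|.
  have -> : DA t - DA s = (phi (x - t) - phi (x - s)) - (phi (x + t) - phi (x + s)) by rewrite /DA; ring.
  apply: le_trans (ler_normB _ _) _.
  have := phil (x - t) (x - s); have := phil (x + t) (x + s); rewrite ym yp normrN => l1 l2; clear - l1 l2; lra.
have DBl t s : `|DB t - DB s| <= 2 * L * `|t - s|.
  have -> : DB t - DB s = (phi (x - t) - phi (x - s)) + (phi (x + t) - phi (x + s)) by rewrite /DB; ring.
  apply: le_trans (ler_normD _ _) _.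
  have := phil (x - t) (x - s); have := phil (x + t) (x + s); rewrite ym yp normrN => l1 l2; clear - l1 l2; lra.
have HA := osc_quotient 0 L2 N1 etapos etatau tau2 cDA DAb DAl.
have HB := osc_quotient (pi / 2) L2 N1 etapos etatau tau2 cDB DBb DBl.
have cm := cont_invmax etapos.
set IA := itg _ _ _ in HA; set IB := itg _ _ _ in HB.
have cqA : continuous (fun t => DA t / Num.max eta t) by exact: cont_mul.
have cqB : continuous (fun t => DB t / Num.max eta t) by exact: cont_mul.
have cfA : continuous (fun t => DA t / Num.max eta t * cos (N * t + 0)).
  by apply: cont_mul => //; exact: cont_cos_affine.
have cfB : continuous (fun t => DB t / Num.max eta t * cos (N * t + pi / 2)).
  by apply: cont_mul => //; exact: cont_cos_affine.
have cfS : continuous (fun t => sin (N * t) / Num.max eta t).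
  by apply: cont_mul => //; exact: cont_sin.
have SE : symint (fun y => phi y * cos (N * y)) x eta =
   cos (N * x) * IA + (- sin (N * x)) * IB + 2 * (phi x * sin (N * x)) *
     itg (fun t => sin (N * t) / Num.max eta t) eta 2.
  rewrite /IA /IB -(itgZ (cos _))// -!itgDZ//; first last.
  - by apply: cont_mul.
  - by apply: cont_add; apply: cont_mul.
  rewrite /symint; apply: eq_itg => t _.
  have em : N * (x - t) = N * x - N * t by ring.
  have ep : N * (x + t) = N * x + N * t by ring.
  by rewrite addr0 cosDpihalf em ep cosB cosD /DA /DB; ring.
have S3 : `|itg (fun t => sin (N * t) / Num.max eta t) eta 2 - sineint N eta0| <= N * eta0.
  have e02 : eta0 <= 2 := le_trans eta0tau tau2.
  rewrite (@itg_split _ _ eta eta0 2)//; last exact: ltW.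
  have -> : itg (fun t => sin (N * t) / Num.max eta t) eta0 2 = sineint N eta0.
    by apply: eq_itg => t /andP[t1 _]; rewrite !max_r// (le_trans (ltW eta_lt)).
  rewrite addrK.
  apply: le_trans (@itg_abs _ _ eta eta0 N _ _ _) _ => //; first exact: ltW.
    move=> t /andP[t1 _]; have t0 : 0 < t by apply: lt_le_trans t1.
    rewrite max_r// normrM normfV (gtr0_norm t0) ler_pdivrMr//.
    by have := sin_le_norm (N * t); rewrite [`|N * t|]normrM (gtr0_norm N0) (gtr0_norm t0).
  by rewrite ler_wpM2l ?(ltW N0)// lerBlDr lerDl ltW.
have c1 : `|cos (N * x)| <= 1 by rewrite ler_norml cos_geN1 cos_le1.
have s1 : `|sin (N * x)| <= 1 by rewrite ler_norml sin_geN1 sin_le1.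
set S := itg _ _ _ in SE S3.
have -> : symint (fun y => phi y * cos (N * y)) x eta - 2 * sineint N eta0 * (phi x * sin (N * x))
  = cos (N * x) * IA - sin (N * x) * IB + 2 * ((phi x * sin (N * x)) * (S - sineint N eta0)).
  by rewrite SE; ring.
have T1 : `|cos (N * x) * IA| <= e / 4.
  by rewrite normrM (@le_trans _ _ `|IA|) ?ler_piMl//; lra.
have T2 : `|sin (N * x) * IB| <= e / 4.
  by rewrite normrM (@le_trans _ _ `|IB|) ?ler_piMl//; lra.
have T3 : `|(phi x * sin (N * x)) * (S - sineint N eta0)| <= e / 8.
  apply: le_trans eta0e; rewrite !normrM; apply: ler_pM => //.
  by rewrite -[leRHS]mulr1; apply: ler_pM.
move: T1 T2 T3; rewrite !ler_norml => /andP[u1 u2] /andP[u3 u4] /andP[u5 u6].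
by clear - u1 u2 u3 u4 u5 u6; apply/andP; split; lra.
Qed.

End hilbert_osc.

(** * The stages *)
Section stages.
Context {R : realType}.
Implicit Types (U X W Y chi : R -> R) (a b x y N h e lam m L : R) (k : nat).

Definition clamp (u : R) : R := Num.max 0 (Num.min 1 u).

Lemma clamp_ge0 u : 0 <= clamp u. Proof. by rewrite le_max lexx. Qed.

Lemma clamp_le1 u : clamp u <= 1. Proof. by rewrite ge_max ler01 ge_min lexx. Qed.

Lemma clamp1 u : 1 <= u -> clamp u = 1.
Proof. by move=> u1; rewrite /clamp min_l ?max_r. Qed.

Lemma clamp0 u : u <= 0 -> clamp u = 0.
Proof. by move=> u0; rewrite /clamp max_l// ge_min u0 orbT. Qed.

Lemma clamp_lip u v : `|clamp u - clamp v| <= `|u - v|.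
Proof.
have := ler_norm (u - v); have := ler_norm (v - u); rewrite (distrC v) => d1 d2.
have clampE (w : R) : clamp w = (if (w <= 0)%R then 0 else if (1 <= w)%R then 1 else w) :> R.
  rewrite /clamp maxEle minEle; case: (leP 1 w) => w1; case: (leP w 0) => w0; rewrite ?ler01//.
  - by exfalso; lra.
  - by case: leP => //; lra.
  - by rewrite (ltW w0).
rewrite !clampE ler_norml.
by case: (leP u 0) => ?; case: (leP 1 u) => ?; case: (leP v 0) => ?; case: (leP 1 v) => ?;
  apply/andP; split; lra.
Qed.

(** The rise takes place on [[4k+3, 4k+4]], the gap between [J_k] and [J_(k+1)]: stage [k] is absent
    on [J_k] and complete on [J_(k+1)]. *)
Definition ramp k (x : R) : R := clamp (x - (4 * k + 3)%:R).

Lemma ramp_ge0 k x : 0 <= ramp k x. Proof. exact: clamp_ge0. Qed.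

Lemma ramp_le1 k x : ramp k x <= 1. Proof. exact: clamp_le1. Qed.

Lemma ramp1 k x : (4 * k + 4)%:R <= x -> ramp k x = 1.
Proof. by rewrite !natrD => kx; apply: clamp1; rewrite natrD; lra. Qed.

Lemma ramp0 k x : x <= (4 * k + 3)%:R -> ramp k x = 0.
Proof. by move=> kx; apply: clamp0; rewrite subr_le0. Qed.

Lemma ramp_lip k : lipb 1 (ramp k).
Proof.
split=> [x|x y]; first by rewrite ger0_norm ?ramp_ge0 ?ramp_le1.
rewrite mul1r; apply: le_trans (clamp_lip _ _) _.
by set c := _%:R; have -> : x - c - (y - c) = x - y by ring.
Qed.

Lemma posb_step U (v : R -> R) : posb U -> (forall x, `|v x| <= 8^-1) ->
  posb (fun x => U x * (1 + v x)).
Proof.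
move=> [m m0 mU] v8; exists (m * 2^-1); first by rewrite divr_gt0.
move=> x; apply: ler_pM => //; [exact: ltW|].
by have := v8 x; rewrite ler_norml => /andP[? ?]; lra.
Qed.

(** At distances up to [lam] the weight is constant up to factors [1 +- gam]. *)
Definition slow (gam lam : R) U : Prop :=
  forall x y, `|x - y| <= lam -> `|U x - U y| <= gam * U y.

Lemma slow_exists gam U : 0 < gam -> buc U -> posb U ->
  exists2 lam : R, 0 < lam & forall d, d <= lam -> slow gam d U.
Proof.
move=> g0 bU [m m0 mU].
have [d d0 H] := bU.2 (gam * m) (mulr_gt0 g0 m0).
exists d => // d' dd x y xy; apply: le_trans (H x y (le_trans xy dd)) _.
by rewrite ler_pM2l.
Qed.

(** [slam] separates the scales: below it the weights of the stage are slow, above it the next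
    oscillation hardly changes averages. *)
Record stage := Stage { sX : R -> R; sW : R -> R; sY : R -> R; slam : R }.

Variables (p eps gam : R).
Hypotheses (p1 : 1 < p) (eps0 : 0 < eps) (eps8 : eps <= 8^-1)
  (epsb8 : eps * (p - 1) <= 8^-1) (gam0 : 0 < gam).

Record admissible (s : stage) : Prop := Admissible {
  inv_bX : buc (sX s);
  inv_lX : exists2 L : R, 0 < L & lipb L (sX s);
  inv_pX : posb (sX s);
  inv_bW : buc (sW s);
  inv_pW : posb (sW s);
  inv_bY : buc (sY s);
  inv_Z : forall x, apZ p (sX s) (sW s) x <= 1;
  inv_lam : 0 < slam s;
  inv_slowX : slow gam (slam s) (sX s);
  inv_slowW : slow gam (slam s) (sW s) }.

(** Twice the lower bound in [sineint_bounds], the amplitude being [2 * sineint]. *)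
Definition hmin : R := (1 - cos 1) / 4.

(* [s'] refines [s] by one oscillation of frequency [N], chosen so large that
   all error terms are summable in [k]. *)
Record refines_with k (N h : R) (s s' : stage) : Prop := RefinesWith {
  ref_amp : hmin <= h <= 8;
  ref_X : sX s' = stepX eps N (ramp k) (sX s);
  ref_W : sW s' = stepW p eps N (ramp k) (sX s) (sW s);
  ref_Y : sY s' = stepY eps h N (sX s) (sY s);
  ref_lam : slam s' <= slam s;
  ref_lam2 : slam s' <= 2^-1 ^+ k;
  ref_avgX : forall a b, slam s <= b - a ->
    `|itg (sX s') a b - itg (sX s) a b| <= gam / 4 * 2^-1 ^+ k * itg (sX s) a b;
  ref_avgW : forall a b, slam s <= b - a ->
    `|itg (sW s') a b - itg (sW s) a b| <= gam / 4 * 2^-1 ^+ k * itg (sW s) a b;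
  ref_mass : forall a b, b - a = 1 -> (4 * k + 4)%:R <= a ->
    itg (sX s) a b - 4^-1 * 2^-1 ^+ k <= itg (sX s') a b;
  ref_entropy : forall a b, b - a = 1 -> (4 * k + 4)%:R <= a ->
    entropy p (sX s) (sW s) a b + (p - 1) * eps ^+ 2 / 128 * itg (sX s) a b
      - ((p - 1) + 2 * (p - 1) ^+ 2) * eps ^+ 2 * zmass p (sX s) (sW s) a b
      - 4^-1 * 2^-1 ^+ k
    <= entropy p (sX s') (sW s') a b;
  ref_energy : forall a b, b - a = 1 -> (4 * k + 4)%:R <= a ->
    forall r c, 0 <= c <= 1 ->
    (forall y t, `|y| `^ p + p * spow (p - 1) y * t +
       Num.max 0 (c * (`|t| `^ p - r * `|y| `^ p)) <= `|y + t| `^ p) ->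
    energy p (sW s) (sY s) a b + c / 2 * ((eps * hmin) `^ p * 2 `^ (- p) *
      zmass p (sX s) (sW s) a b - r * energy p (sW s) (sY s) a b)
      - 4^-1 * 2^-1 ^+ k
    <= energy p (sW s') (sY s') a b;
  ref_hilbert : exists2 eta0 : R, 0 < eta0 & forall chi, lipb 1 chi ->
    forall x eta, 0 < eta < eta0 ->
    `|symint (fun y => chi y * sX s y * cos (N * y)) x eta
      - h * (chi x * sX s x * sin (N * x))| <= 4^-1 * 2^-1 ^+ k }.

Definition refines k (s s' : stage) : Prop :=
  exists N h, refines_with k N h s s'.

Lemma hmin_gt0 : 0 < hmin.
Proof. by rewrite divr_gt0// subr_gt0 cos1_lt1. Qed.

Lemma osc_small k N x : `|eps * (ramp k x * cos (N * x))| <= 8^-1.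
Proof.
rewrite normrM (gtr0_norm eps0) (le_trans _ eps8)// ler_piMr ?(ltW eps0)//.
rewrite normrM ger0_norm ?ramp_ge0//.
by rewrite mulr_ile1 ?ramp_ge0 ?ramp_le1// ler_norml cos_geN1 cos_le1.
Qed.

Lemma osc_small_W k N X W x : posb X -> posb W -> (forall x, apZ p X W x <= 1) ->
  `|- (eps * (p - 1) * apZ p X W x * (ramp k x * cos (N * x)))| <= 8^-1.
Proof.
move=> pX pW Z1; have b0 : 0 < p - 1 by rewrite subr_gt0.
rewrite normrN normrM -[leRHS]mulr1; apply: ler_pM => //; last first.
  rewrite normrM ger0_norm ?ramp_ge0//.
  by rewrite mulr_ile1 ?ramp_ge0 ?ramp_le1// ler_norml cos_geN1 cos_le1.
have eb : 0 <= eps * (p - 1) by rewrite mulr_ge0 ?ltW.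
have Z0 := apZ_gt0 p x pX pW.
by rewrite (ger0_norm (mulr_ge0 eb (ltW Z0))) (le_trans _ epsb8)// ler_piMr.
Qed.

Lemma stepWE N (a : R -> R) X W : stepW p eps N a X W =
  (fun x => W x * (1 + - (eps * (p - 1) * apZ p X W x * (a x * cos (N * x))))).
Proof. by []. Qed.

Lemma buc_cosN N : 0 <= N -> buc (fun x => cos (N * x)).
Proof.
move=> N0; have -> : (fun x => cos (N * x)) = (fun x => cos (N * x + 0)).
  by apply/funext => x; rewrite addr0.
exact: buc_cos.
Qed.

Lemma buc_sinN N : 0 <= N -> buc (fun x => sin (N * x)).
Proof.
move=> N0; have -> : (fun x => sin (N * x)) = (fun x => (-1) * cos (N * x + pi / 2)).
  by apply/funext => x; rewrite sin_cosE mulN1r.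
by apply: buc_scale; exact: buc_cos.
Qed.

Lemma buc_ramp k : buc (ramp k).
Proof. exact: lipb_buc (ramp_lip k). Qed.

Lemma refine_admissible k s N h : admissible s -> 0 <= N -> exists lam,
  [/\ lam <= slam s, lam <= 2^-1 ^+ k &
   admissible (Stage (stepX eps N (ramp k) (sX s)) (stepW p eps N (ramp k) (sX s) (sW s))
     (stepY eps h N (sX s) (sY s)) lam)].
Proof.
move=> [bX [L L0 lX] pX bW pW bY Z1 lam0 slX slW] N0.
have bc := buc_cosN N0; have bs := buc_sinN N0; have br := buc_ramp k.
have brc : buc (fun x => ramp k x * cos (N * x)) by exact: buc_mul.
have bX' : buc (stepX eps N (ramp k) (sX s)).
  by apply: buc_mul => //; apply: buc_add; [exact: buc_cst|exact: buc_scale].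
have bZ : buc (apZ p (sX s) (sW s)) by exact: buc_apZ.
have bW' : buc (stepW p eps N (ramp k) (sX s) (sW s)).
  apply: buc_mul => //; apply: buc_sub; first exact: buc_cst.
  by apply: buc_mul => //; exact: buc_scale.
have pX' : posb (stepX eps N (ramp k) (sX s)).
  by apply: posb_step => // x; exact: osc_small.
have pW' : posb (stepW p eps N (ramp k) (sX s) (sW s)).
  by rewrite stepWE; apply: posb_step => // x; exact: osc_small_W.
have [l1 l10 H1] := slow_exists gam0 bX' pX'.
have [l2 l20 H2] := slow_exists gam0 bW' pW'.
have k0 : 0 < 2^-1 ^+ k :> R by rewrite exprn_gt0// invr_gt0.
(* The scale is chosen after the new weights, small enough for both to be slow; the bound [2^-k]
   makes the scales tend to 0. *)
exists (Num.min (Num.min (slam s) (2^-1 ^+ k)) (Num.min l1 l2)).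
split; [by rewrite !ge_min lexx|by rewrite !ge_min lexx !orbT|].
split => //=.
- have lc := lipb_cos 0 N0.
  have lc' : lipb (N + 1) (fun x => cos (N * x)).
    have -> : (fun x => cos (N * x)) = (fun x => cos (N * x + 0)) => //.
    by apply/funext => x; rewrite addr0.
  have := lipb_mul lX (lipb_add (lipb_cst 1) (lipb_mul (lipb_cst eps) (lipb_mul (ramp_lip k) lc'))).
  set K := _ + L * _ => HK; exists (K + 1); last first.
    split=> [x|x y]; first by rewrite (le_trans (HK.1 x))// lerDl.
    by rewrite (le_trans (HK.2 x y))// ler_wpM2r// lerDl.
  by rewrite ltr_wpDl// (le_trans _ (HK.1 0)).
- by apply: buc_add => //; apply: buc_scale; exact: buc_mul.
- move=> x; set u := eps * (ramp k x * cos (N * x)).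
  have b0 : 0 < p - 1 by rewrite subr_gt0.
  have u8 : `|u| <= 8^-1 by exact: osc_small.
  have bu8 : (p - 1) * `|u| <= 8^-1.
    apply: le_trans epsb8; rewrite mulrC ler_wpM2r ?(ltW b0)//.
    rewrite /u normrM (gtr0_norm eps0) ler_piMr ?(ltW eps0)// normrM ger0_norm ?ramp_ge0//.
    by rewrite mulr_ile1 ?ramp_ge0 ?ramp_le1// ler_norml cos_geN1 cos_le1.
  have Zx : 0 <= apZ p (sX s) (sW s) x <= 1 by rewrite Z1 ltW// apZ_gt0.
  apply: le_trans (product_step b0 Zx u8 bu8).
  rewrite {1}/apZ /stepX /stepW -/u powRM; first last.
  + by move: u8; rewrite ler_norml => /andP[? ?]; lra.
  + by rewrite ltW// posb_gt0.
  rewrite le_eqVlt; apply/orP; left; apply/eqP.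
  set z := apZ p _ _ x.
  transitivity (sW s x * sX s x `^ (p - 1) * (1 - (p - 1) * z * u) * (1 + u) `^ (p - 1)) => //.
  by rewrite /u; ring.
- by rewrite !lt_min lam0 k0 l10 l20.
- by apply: H1; rewrite !ge_min lexx !orbT.
- by apply: H2; rewrite !ge_min lexx !orbT.
Qed.

Lemma itg_posb_ge U a b m : continuous U -> a <= b -> (forall x, m <= U x) ->
  m * (b - a) <= itg U a b.
Proof.
by move=> cU ab mU; rewrite -itg_cst//; apply: le_itg => //; exact: cst_continuous.
Qed.

(** Riemann--Lebesgue gives an error relative to the length; the positive lower bound [m] of [U]
    makes it relative to the integral of [U]. *)
Lemma avg_step U (v : R -> R) e lam : buc U -> posb U -> buc v -> 0 < e -> 0 < lam ->
  exists N0, forall N, N0 <= N -> forall a b, lam <= b - a ->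
  `|itg (fun x => U x + U x * v x * cos (N * x)) a b - itg U a b| <= e * itg U a b.
Proof.
move=> bU [m m0 mU] bv e0 lam0.
have bg : buc (fun x => U x * v x) by exact: buc_mul.
have [N0 H] := trig_averages bg (mulr_gt0 e0 m0) lam0.
exists N0 => N NN a b ab; have [h _ _ _ _] := H N NN a b ab.
rewrite itgD; first last.
- by apply: cont_mul; [exact: buc_cont|exact: cont_cos].
- exact: buc_cont.
rewrite [itg U a b + _]addrC addrK (le_trans h)// -mulrA ler_pM2l//.
by apply: itg_posb_ge => //; [exact: buc_cont|rewrite -subr_ge0 (le_trans (ltW lam0))].
Qed.

Lemma refine_exists k s : admissible s -> exists s', admissible s' /\ refines k s s'.
Proof.
move=> Is; have [bX [L L0 lX] pX bW pW bY Z1 lam0 slX slW] := Is.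
have k0 : 0 < 2^-1 ^+ k :> R by rewrite exprn_gt0// invr_gt0.
have e0 : 0 < 4^-1 * 2^-1 ^+ k :> R by rewrite mulr_gt0.
have g0 : 0 < gam / 4 * 2^-1 ^+ k by rewrite mulr_gt0// divr_gt0.
have bZ : buc (apZ p (sX s) (sW s)) by exact: buc_apZ.
have br := buc_ramp k.
have bv1 : buc (fun x => eps * ramp k x) by exact: buc_scale.
have bv2 : buc (fun x => - (eps * (p - 1)) * (apZ p (sX s) (sW s) x * ramp k x)).
  by apply: buc_scale; exact: buc_mul.
have eps01 : 0 < eps <= 1   by rewrite eps0; apply: (le_trans eps8); rewrite invf_le1// ler1n.
have [N1 H1] := avg_step bX pX bv1 g0 lam0.
have [N2 H2] := avg_step bW pW bv2 g0 lam0.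
have [N3 H3] := mass_growth eps01 bX e0.
have [N4 H4] := entropy_growth p1 eps0 eps8 epsb8 bX pX bW pW Z1 e0.
have h8 : hmin <= 8.
  by rewrite /hmin; have := cos_geN1 (1 : R); lra.
have [N5 H5] := energy_growth p1 eps0 epsb8 hmin_gt0 h8 bX pX bW pW bY Z1 e0.
(* The constant that [lipb_mul] gives for [chi * sX s], so that the Hilbert estimate covers every
   cutoff [chi] at once. *)
have L0' : 0 < 2 * (1 * L) + 1 * L by rewrite addr_gt0 ?mulr_gt0.
have [N6 H6] := hilbert_osc L0' e0.
pose N := Num.max (Num.max (Num.max 0 N1) (Num.max N2 N3)) (Num.max (Num.max N4 N5) N6).
have : N <= N by [].
rewrite {1}/N !ge_max => /andP[/andP[/andP[NN0 NN1] /andP[NN2 NN3]] /andP[/andP[NN4 NN5] NN6]].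
have [h [hb [eta0 eta00 H6']]] := H6 N NN6.
have [lam [lam1 lam2 Is']] := refine_admissible k h Is NN0.
exists (Stage (stepX eps N (ramp k) (sX s)) (stepW p eps N (ramp k) (sX s) (sW s))
     (stepY eps h N (sX s) (sY s)) lam); split => //.
have onX a b x : (4 * k + 4)%:R <= a -> a <= x <= b ->
    stepX eps N (ramp k) (sX s) x = stepX eps N (cst 1) (sX s) x.
  by move=> ka /andP[ax _]; rewrite /stepX ramp1// (le_trans ka).
have onW a b x : (4 * k + 4)%:R <= a -> a <= x <= b ->
    stepW p eps N (ramp k) (sX s) (sW s) x = stepW p eps N (cst 1) (sX s) (sW s) x.
  by move=> ka /andP[ax _]; rewrite /stepW ramp1// (le_trans ka).
exists N, h; split => //=.
- move=> a b ab.
  rewrite (_ : itg _ a b = itg (fun x => sX s x + sX s x * (eps * ramp k x) * cos (N * x)) a b).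
    exact: (H1 N NN1 a b ab).
  by apply: eq_itg => x _; rewrite /stepX; ring.
- move=> a b ab.
  rewrite (_ : itg _ a b = itg (fun x => sW s x + sW s x *
      (- (eps * (p - 1)) * (apZ p (sX s) (sW s) x * ramp k x)) * cos (N * x)) a b).
    exact: (H2 N NN2 a b ab).
  by apply: eq_itg => x _; rewrite /stepW; ring.
- move=> a b ab ka; apply: le_trans (H3 N NN3 a b ab) _.
  by rewrite le_eqVlt; apply/orP; left; apply/eqP; apply: eq_itg => x /(onX _ _ _ ka) ->.
- move=> a b ab ka; apply: le_trans (H4 N NN4 a b ab) _.
  rewrite le_eqVlt; apply/orP; left; apply/eqP; apply: eq_itg => x xab.
  by rewrite /lnZ (onX _ _ _ ka xab) (onW _ _ _ ka xab).
- move=> a b ab ka r c c01 gn; apply: le_trans (H5 N NN5 h hb a b ab r c c01 gn) _.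
  rewrite le_eqVlt; apply/orP; left; apply/eqP; apply: eq_itg => x xab.
  by rewrite (onW _ _ _ ka xab).
- by exists eta0 => // chi lchi x eta etab; apply: H6' => //; exact: lipb_mul.
Qed.

(** With initial scale 1, averages over all intervals of length at least 1 can be compared with the
    constant weight. *)
Definition stage0 : stage := Stage (cst 1) (cst 1) (cst 0) 1.

Lemma admissible_stage0 : admissible stage0.
Proof.
have b (c : R) : buc (fun _ : R => c) by exact: buc_cst.
have pos1 : posb (fun _ : R => 1 : R) by exists 1.
have sl : slow gam 1 (cst 1) by move=> x y _; rewrite subrr normr0 mulr1 ltW.
split => //=.
- exact: (b 1).
- by exists 1 => //; have := @lipb_cst R 1; rewrite normr1.
- exact: (b 1).
- exact: (b 0).
- by move=> x; rewrite /apZ /= powR1 mulr1.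
Qed.

Lemma stages_exist : exists st : nat -> stage,
  [/\ st 0%N = stage0, forall k, admissible (st k) & forall k, refines k (st k) (st k.+1)].
Proof.
(* The index is carried along because [refines] depends on it. *)
pose T := {ks : nat * stage | admissible ks.2}.
pose Rel (u v : T) := (sval v).1 = (sval u).1.+1 /\ refines (sval u).1 (sval u).2 (sval v).2.
have ex (u : T) : {v : T | Rel u v}.
  apply: cid; case: u => -[k s] /= Is.
  by have [s' [Is' r]] := refine_exists k Is; exists (exist _ (k.+1, s') Is').
have [f [f0 fS]] := dependent_choice ex (exist _ (0%N, stage0) admissible_stage0).
have fk k : (sval (f k)).1 = k.
  by elim: k => [|k IH]; [rewrite f0|have [-> _] := fS k; rewrite IH].
exists (fun k => (sval (f k)).2); split.
- by rewrite f0.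
- by move=> k; exact: (svalP (f k)).
- by move=> k; have [_] := fS k; rewrite fk.
Qed.

End stages.

(** * Divergence of the energies *)

Section energy_unbounded.
Context {R : realType}.
Implicit Types (a b x y M q c : R) (k n : nat).

Let half k : R := 2^-1 ^+ k.

Lemma half_gt0 k : 0 < half k. Proof. by rewrite exprn_gt0// invr_gt0. Qed.

Lemma halfS k : half k.+1 = half k / 2. Proof. by rewrite /half exprS mulrC. Qed.

(** The errors [2^-k / 4] sum to less than 1/2. *)
Lemma perturbed_sum_lower (u g : nat -> R) n :
  (forall k, (k < n)%N -> u k + g k - 4^-1 * half k <= u k.+1) ->
  forall k, (k <= n)%N -> u 0%N + \sum_(i < k) g i - 2^-1 * (1 - half k) <= u k.
Proof.
move=> H; elim=> [|k IH] kn.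
  by rewrite big_ord0 /half expr0; lra.
rewrite big_ord_recr /= halfS; have := H k kn; have := IH (ltnW kn).
by have := half_gt0 k; lra.
Qed.

(** [x], [l], [z] are mass, entropy and [zmass]. The mass never drops below 1/2, so the entropy
    would gain [A / 2] per stage; ending at or below 0, it must have lost as much through [z]. *)
Lemma mass_entropy_lower (x l z : nat -> R) (A C : R) n : 0 < A -> 0 < C ->
  x 0%N = 1 -> l 0%N = 0 -> l n <= 0 ->
  (forall k, (k < n)%N -> x k - 4^-1 * half k <= x k.+1) ->
  (forall k, (k < n)%N -> l k + A * x k - C * z k - 4^-1 * half k <= l k.+1) ->
  n%:R * (A / 2) - 2^-1 <= C * \sum_(i < n) z i.
Proof.
move=> A0 C0 x0 l0 ln Hx Hl.
have xk k : (k <= n)%N -> 2^-1 <= x k.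
  move=> kn.
  have Hx' i : (i < n)%N -> x i + 0 - 4^-1 * half i <= x i.+1 by rewrite addr0; exact: Hx.
  have := @perturbed_sum_lower x (fun=> 0) n Hx' k kn.
  by rewrite big1// x0; have := half_gt0 k; lra.
have Hl' k : (k < n)%N -> l k + (A * x k - C * z k) - 4^-1 * half k <= l k.+1.
  by rewrite addrA; exact: Hl.
have H := @perturbed_sum_lower l (fun k => A * x k - C * z k) n Hl' n (leqnn n).
have h0 := half_gt0 n.
have S1 : n%:R * (A / 2) <= \sum_(i < n) A * x i.
  rewrite mulr_natl -[X in _ *+ X](card_ord n) -sumr_const.
  apply: ler_sum => i _; rewrite ler_pM2l//; exact: xk (ltnW (ltn_ord i)).
rewrite -mulr_sumr in S1; move: H; rewrite sumrB -!mulr_sumr => H.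
by lra.
Qed.

Variables (p eps gam : R).
Hypotheses (p1 : 1 < p) (eps0 : 0 < eps).
Variable st : nat -> @stage R.
Hypotheses (st0 : st 0%N = stage0) (st_inv : forall k, admissible p gam (st k))
  (st_ref : forall k, refines p eps gam k (st k) (st k.+1)).

(** By contradiction: a final energy at most [M] keeps all earlier energies below [M + 1/2], so the
    loss [q * B k] stays below half the average gain and the energy grows linearly in the number of
    stages. *)
Lemma energy_unbounded M : exists n0, forall n, (n0 <= n)%N ->
  M < energy p (sW (st n)) (sY (st n)) (4 * n + 1)%:R (4 * n + 2)%:R.
Proof.
wlog M0 : M / 0 <= M => [H|].
  have [n0 Hn] := H `|M| (normr_ge0 M); exists n0 => n nn.
  by apply: le_lt_trans (Hn n nn); exact: ler_norm.
pose A := (p - 1) * eps ^+ 2 / 128.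
pose C := ((p - 1) + 2 * (p - 1) ^+ 2) * eps ^+ 2.
pose K := (eps * hmin) `^ p * 2 `^ (- p).
have b0 : 0 < p - 1 by rewrite subr_gt0.
have e2 : 0 < eps ^+ 2 by rewrite exprn_gt0.
have A0 : 0 < A by apply: divr_gt0 => //; exact: mulr_gt0.
have C0 : 0 < C.
  by apply: mulr_gt0 => //; apply: addr_gt0 => //; apply: mulr_gt0 => //; exact: exprn_gt0.
have K0 : 0 < K.
  apply: mulr_gt0; apply: powR_gt0 => //; apply: mulr_gt0 => //; exact: hmin_gt0.
(* The average of [K * z k] per stage guaranteed by [mass_entropy_lower], up to a bounded error. *)
pose D := K * A / (2 * C).
have D0 : 0 < D by apply: divr_gt0; exact: mulr_gt0.
have M1 : 0 < M + 2^-1 by lra.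
(* Chosen so that energies up to [M + 1/2] cost at most [D / 2] per stage; in [normpow_gain] it is
   [r^(-p)]. *)
pose q := D / 2 / (M + 2^-1).
have q0 : 0 < q by apply: divr_gt0 => //; exact: divr_gt0.
have p0 : 0 < p by lra.
have r0 : 0 < q `^ (- p^-1) by exact: powR_gt0.
have [c [/andP[c0 c1] gain]] := normpow_gain p1 r0.
have rq : (q `^ (- p^-1)) `^ (- p) = q.
  by rewrite -powRrM mulrNN mulVf ?gt_eqF// powRr1// ltW.
rewrite rq in gain.
(* With gain constant 0, plain convexity says that the energy is almost nondecreasing. *)
have gain0 y t : `|y| `^ p + p * spow (p - 1) y * t +
    Num.max 0 (0 * (`|t| `^ p - q * `|y| `^ p)) <= `|y + t| `^ p.
  apply: le_trans (gain y t); rewrite mul0r maxxx lerD2l.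
  by rewrite le_max lexx.
have [m mP] : exists m : nat, (M + 1 + K / C) * 4 / (c * D) < m%:R.
  by exists (Num.truncn `|(M + 1 + K / C) * 4 / (c * D)|).+1;
    apply: le_lt_trans (truncnS_gt _); exact: ler_norm.
exists m => n mn; rewrite ltNge; apply/negP => BM.
set a : R := (4 * n + 1)%:R in BM; set b : R := (4 * n + 2)%:R in BM.
have ab : b - a = 1 by rewrite /a /b !natrD; lra.
have ka k : (k < n)%N -> (4 * k + 4)%:R <= a.
  move=> kn; rewrite ler_nat.
  by apply: (@leq_trans (4 * n)); rewrite ?leq_addr// -[X in (_ + X)%N]muln1 -mulnDr leq_mul2l addn1 kn orbT.
pose x k := itg (sX (st k)) a b.
pose l k := entropy p (sX (st k)) (sW (st k)) a b.
pose z k := zmass p (sX (st k)) (sW (st k)) a b.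
pose B k := energy p (sW (st k)) (sY (st k)) a b.
have leab : a <= b by lra.
have x0 : x 0%N = 1 by rewrite /x st0 /= itg_cst// mul1r ab.
have l0 : l 0%N = 0.
  rewrite /l st0 /entropy /= -[RHS](mul0r (b - a)) -itg_cst//.
  by apply: eq_itg => t _; rewrite /lnZ /= ln1 !mulr0 addr0 mulr0.
have ln_le : l n <= 0.
  have [bX _ pX bW pW _ Z1 _ _ _] := st_inv n.
  rewrite -[leRHS](mul0r (b - a)) -itg_cst//; apply: le_itg.
  - by apply: buc_cont; apply: buc_mul => //; exact: buc_lnZ.
  - exact: cst_continuous.
  - move=> t _; rewrite pmulr_rle0 ?posb_gt0// lnZ_ln ?posb_gt0//.
    by rewrite ln_le0.
have Hx k : (k < n)%N -> x k - 4^-1 * half k <= x k.+1.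
  by move=> kn; have [N [h [_ _ _ _ _ _ _ _ ms _ _ _]]] := st_ref k; apply: ms => //; exact: ka.
have Hl k : (k < n)%N -> l k + A * x k - C * z k - 4^-1 * half k <= l k.+1.
  by move=> kn; have [N [h [_ _ _ _ _ _ _ _ _ en _ _]]] := st_ref k; apply: en => //; exact: ka.
have HB k c' : (k < n)%N -> 0 <= c' <= 1 ->
    (forall y t, `|y| `^ p + p * spow (p - 1) y * t +
       Num.max 0 (c' * (`|t| `^ p - q * `|y| `^ p)) <= `|y + t| `^ p) ->
    B k + c' / 2 * (K * z k - q * B k) - 4^-1 * half k <= B k.+1.
  by move=> kn c01 gn; have [N [h [_ _ _ _ _ _ _ _ _ _ eg _]]] := st_ref k; apply: eg => //; exact: ka.
have Bmono k : (k <= n)%N -> B k <= M + 2^-1.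
  move=> kn; suff : forall i, (k + i <= n)%N -> B k - 2^-1 * (half k - half (k + i)) <= B (k + i)%N.
    move=> /(_ (n - k)%N); rewrite subnKC// => /(_ (leqnn n)).
    have := half_gt0 n.
    have hk1 : half k <= 1 by rewrite exprn_ile1// ?invr_ge0// invf_le1// ler1n.
    by move: BM; rewrite -/(B n) => *; lra.
  elim=> [|i IH] kin; first by rewrite addn0; lra.
  rewrite addnS in kin *.
  have := HB (k + i)%N 0 kin; rewrite lexx ler01 => /(_ isT gain0).
  have := IH (ltnW kin); rewrite halfS.
  by have := half_gt0 (k + i); lra.
have B0 : B 0%N = 0.
  rewrite /B st0 /energy /= -[RHS](mul0r (b - a)) -itg_cst//.
  by apply: eq_itg => t _; rewrite normr0 powR0 ?gt_eqF// mul0r.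
have HBc k : (k < n)%N -> B k + c / 2 * (K * z k - D / 2) - 4^-1 * half k <= B k.+1.
  move=> kn; have := HB k c kn; rewrite (ltW c0) c1 => /(_ isT gain).
  apply: le_trans; rewrite lerD2r lerD2l ler_wpM2l//; first by rewrite divr_ge0 ?ltW.
  rewrite lerD2l lerN2.
  have -> : D / 2 = q * (M + 2^-1) by rewrite /q divfK// gt_eqF.
  by rewrite ler_pM2l// Bmono// ltnW.
have := @perturbed_sum_lower B (fun k => c / 2 * (K * z k - D / 2)) n HBc n (leqnn n).
rewrite B0 -mulr_sumr sumrB -mulr_sumr sumr_const card_ord.
have := mass_entropy_lower A0 C0 x0 l0 ln_le Hx Hl.
set S := \sum_(i < n) z i => HS.
have hn := half_gt0 n.
have KS : n%:R * D - K / C / 2 <= K * S.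
  have -> : n%:R * D - K / C / 2 = K / C * (n%:R * (A / 2) - 2^-1).
    by rewrite /D; field; rewrite gt_eqF.
  have -> : K * S = K / C * (C * S) by field; rewrite gt_eqF.
  by rewrite ler_pM2l// divr_gt0.
rewrite -mulr_natl.
have big : (M + 1 + K / C) * 4 < c * (n%:R * D).
  have : (M + 1 + K / C) * 4 / (c * D) < n%:R by apply: lt_le_trans mP _; rewrite ler_nat.
  rewrite ltr_pdivrMr; last exact: mulr_gt0.
  by have -> : n%:R * (c * D) = c * (n%:R * D) by ring.
have KC : c * (K / C) <= K / C by rewrite ler_piMl// ltW// divr_gt0.
have : c / 2 * (n%:R * D - K / C / 2 - n%:R * (D / 2)) <= c / 2 * (K * S - n%:R * (D / 2)).
  by rewrite ler_wpM2l ?lerD2r// divr_ge0 ?(ltW c0).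
have : 0 < K / C by rewrite divr_gt0.
move: BM; rewrite -/(B n); move: (B n) => Bn; lra.
Qed.

End energy_unbounded.

(** * The limit weights *)
Section scale.
Context {R : realType}.
Implicit Types (a b c x y L : R) (k n j : nat).

Variables (gam : R) (lam : nat -> R).
Hypotheses (gam0 : 0 < gam) (gam8 : gam <= 8^-1).
Hypotheses (lamS : forall k, lam k.+1 <= lam k) (lam2 : forall k, lam k.+1 <= 2^-1 ^+ k).

(** At length [L], [U k] is nearly constant and the stages after [k.+1] barely affect averages; only
    the step from [k] to [k.+1] is visible, and it costs a factor [1 +- gam]. The second case covers
    lengths beyond all oscillations. *)
Definition at_scale L k : Prop :=
  lam k.+1 <= L < lam k \/ k = 0%N /\ lam 0%N <= L.

Lemma at_scale_exists L : 0 < L -> exists k, at_scale L k.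
Proof.
move=> L0; have [m Lm] : exists m : nat, 2^-1 ^+ m <= L.
  have [m mL] : exists m : nat, L^-1 < m%:R.
    by exists (Num.truncn `|L^-1|).+1; apply: le_lt_trans (truncnS_gt _); exact: ler_norm.
  exists m; rewrite exprVn -[L]invrK lef_pV2 ?posrE ?exprn_gt0 ?invr_gt0//.
  by apply: le_trans (ltW mL) _; rewrite -natrX ler_nat ltnW// ltn_expl.
have : exists n, lam n <= L by exists m.+1; exact: le_trans (lam2 m) Lm.
move=> H; case: (ex_minnP H) => -[|n] ln nmin; first by exists 0%N; right.
exists n; left; rewrite ln/= ltNge; apply/negP => /nmin.
by rewrite ltnn.
Qed.

(** A crude index: left of [4 n + 3] the ramps of all stages from [n] on vanish, so any larger index
    gives the same limit. *)
Definition level x : nat := (Num.truncn `|x|).+1.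

Lemma level_gt x : x < (4 * level x + 3)%:R.
Proof.
apply: (@lt_le_trans _ _ (level x)%:R).
  by apply: le_lt_trans (truncnS_gt _); exact: ler_norm.
by rewrite ler_nat; apply: leq_trans (leq_addr _ _); rewrite leq_pmull.
Qed.

(** What the two sequences of weights have in common, so that scales are analysed once for both. *)
Record tower (U : nat -> R -> R) : Prop := Tower {
  tow0 : U 0%N = cst 1;
  tow_buc : forall k, buc (U k);
  tow_pos : forall k, posb (U k);
  tow_slow : forall k, slow gam (lam k) (U k);
  tow_step : forall k x, `|U k.+1 x - U k x| <= gam * ramp k x * U k x;
  tow_avg : forall k a b, lam k <= b - a ->
    `|itg (U k.+1) a b - itg (U k) a b| <= gam / 4 * 2^-1 ^+ k * itg (U k) a b }.

Definition limit (U : nat -> R -> R) x : R := U (level x) x.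

Variable U : nat -> R -> R.
Hypothesis tU : tower U.

Lemma tower_stable n m x : x <= (4 * n + 3)%:R -> (n <= m)%N -> U m x = U n x.
Proof.
move=> xn; elim: m => [|m IH]; first by rewrite leqn0 => /eqP ->.
rewrite leq_eqVlt => /predU1P[->//|]; rewrite ltnS => nm.
rewrite -(IH nm); apply/eqP; rewrite -subr_eq0 -normr_le0.
apply: le_trans (tow_step tU m x) _.
rewrite ramp0 ?mulr0 ?mul0r//; apply: le_trans xn _; rewrite ler_nat.
by rewrite leq_add2r leq_mul2l.
Qed.

Lemma limitE n x : x <= (4 * n + 3)%:R -> limit U x = U n x.
Proof.
move=> xn; rewrite /limit.
rewrite -(tower_stable xn (leq_maxl n (level x))).
by rewrite -(tower_stable (ltW (level_gt x)) (leq_maxr n (level x))).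
Qed.

Lemma limit_gt0 x : 0 < limit U x.
Proof. exact: posb_gt0 (tow_pos tU _). Qed.

Lemma limit_cont : continuous (limit U).
Proof.
move=> x; apply: cvg_trans; last first.
  rewrite (limitE (ltW (level_gt x))).
  exact: (buc_cont (tow_buc tU (level x))).
apply: near_eq_cvg; near=> y; rewrite (@limitE (level x))//.
by near: y; have := lt_nbhsl (level_gt x); apply: filterS => y /ltW.
Unshelve. all: by end_near. Qed.

Lemma itg_limit n a b : b <= (4 * n + 3)%:R -> itg (limit U) a b = itg (U n) a b.
Proof.
by move=> bn; apply: eq_itg => x /andP[_ xb]; apply: limitE; exact: le_trans bn.
Qed.

Lemma tower_avg j n a b : (j <= n)%N -> lam j <= b - a ->
  (1 - gam) * itg (U j) a b <= itg (U n) a b <= (1 + gam) * itg (U j) a b.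
Proof.
move=> jn ab; have g8 := gam8.
have I0 k : 0 <= itg (U k) a b.
  by apply: itg_ge0 => x _; rewrite ltW// posb_gt0//; exact: tow_pos.
have h0 k : 0 < 2^-1 ^+ k :> R by rewrite exprn_gt0// invr_gt0.
have h1 k : 2^-1 ^+ k <= 1 :> R by rewrite exprn_ile1// ?invr_ge0// invf_le1// ler1n.
(* The sharper factor leaves room in the induction: as [itg (U n) <= 2 * itg (U j)], step [n] costs
   [gam * 2^-n / 2], exactly the increase of [gam * (1 - 2^-n)]. *)
suff : (1 - gam * (1 - 2^-1 ^+ n)) * itg (U j) a b <= itg (U n) a b <=
       (1 + gam * (1 - 2^-1 ^+ n)) * itg (U j) a b.
  have := h0 n; have := I0 j => i0 hn.
  have : 0 <= gam * 2^-1 ^+ n * itg (U j) a b by rewrite mulr_ge0// mulr_ge0// ltW.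
  by move=> q /andP[? ?]; apply/andP; split; lra.
elim: n jn => [|n IH] jn.
  move: jn; rewrite leqn0 => /eqP ->; rewrite expr0 subrr mulr0 subr0 addr0 mul1r.
  by rewrite lexx.
move: jn; rewrite leq_eqVlt => /predU1P[jn|].
  rewrite -jn; have := h1 j; have := I0 j => i0 hj.
  have : 0 <= gam * (1 - 2^-1 ^+ j) * itg (U j) a b.
    by rewrite mulr_ge0//; apply: mulr_ge0; [exact: ltW|rewrite subr_ge0].
  by move=> q; apply/andP; split; lra.
rewrite ltnS => jn; have /andP[L1 L2] := IH jn.
have lamm : lam n <= b - a.
  apply: le_trans ab; elim: (n) jn => [|m IHm]; first by rewrite leqn0 => /eqP ->.
  by rewrite leq_eqVlt => /predU1P[->//|/IHm]; apply: le_trans.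
have := tow_avg tU lamm; rewrite ler_norml exprS => /andP[].
move: (h0 n) (h1 n) (I0 j) L1 L2 => {IH}.
move: (2^-1 ^+ n) (itg (U j) a b) (itg (U n) a b) => h J K hp hl J0 L1 L2 d1 d2.
have K2 : K <= 2 * J.
  apply: le_trans L2 _; rewrite ler_wpM2r//.
  have : 0 <= gam * h by rewrite mulr_ge0// ltW.
  by move=> ?; lra.
have gh : gam * h * K <= gam * h * (2 * J) by rewrite ler_wpM2l// mulr_ge0// ltW.
by apply/andP; split; lra.
Qed.

(** The three factors [1 +- gam] come from slowness of [U k], from the visible step, and from all
    later averages. The reference value is [U k c] for every interval of length at least [L] within
    distance [L] of [c]. *)
Lemma scale_bounds L k c a b : 0 < L -> at_scale L k -> L <= b - a ->
  (forall x, a <= x <= b -> `|x - c| <= L) ->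
  (1 - gam) ^+ 3 * U k c * (b - a) <= itg (limit U) a b <=
  (1 + gam) ^+ 3 * U k c * (b - a).
Proof.
move=> L0 sc Lab xc; have g0 := gam0; have g8 := gam8.
have ab : a <= b by rewrite -subr_ge0 (le_trans (ltW L0)).
have g1 : 0 <= 1 - gam by lra.
have g2 : 0 <= 1 + gam by lra.
have gl : 1 - gam <= 1 by lra.
have gu : 1 <= 1 + gam by lra.
have bn : b <= (4 * level b + 3)%:R by rewrite ltW// level_gt.
rewrite (@itg_limit (level b + k.+1))//; last first.
  by apply: le_trans bn _; rewrite ler_nat leq_add2r leq_mul2l leq_addr.
case: sc => [/andP[L1 L2]|[-> L1]]; last first.
  have := @tower_avg 0 (level b + 1) a b (leq0n _) (le_trans L1 Lab).
  rewrite (tow0 tU) itg_cst// mul1r => /andP[t1 t2].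
  have -> : cst 1 c = 1 :> R by [].
  rewrite !mulr1; have ba : 0 <= b - a by rewrite subr_ge0.
  apply/andP; split.
    by apply: le_trans t1; rewrite ler_wpM2r// exprS ler_piMr// exprn_ile1.
  by apply: le_trans t2 _; rewrite ler_wpM2r// exprS ler_peMr// exprn_ege1.
have := @tower_avg k.+1 (level b + k.+1) a b (leq_addl _ _) (le_trans L1 Lab).
have Uc : 0 < U k c by apply: posb_gt0; exact: tow_pos.
have H x : a <= x <= b -> (1 - gam) ^+ 2 * U k c <= U k.+1 x <= (1 + gam) ^+ 2 * U k c.
  move=> /xc xL; have := tow_slow tU (le_trans xL (ltW L2)).
  have Ux : 0 < U k x by apply: posb_gt0; exact: tow_pos.
  have : `|U k.+1 x - U k x| <= gam * U k x.
    apply: le_trans (tow_step tU k x) _; apply: ler_wpM2r; first exact: ltW.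
    by rewrite ler_piMr ?ramp_le1// ltW.
  rewrite !ler_norml => /andP[s1 s2] /andP[s3 s4].
  have : (1 - gam) * ((1 - gam) * U k c) <= (1 - gam) * U k x by rewrite ler_wpM2l//; lra.
  have : (1 + gam) * U k x <= (1 + gam) * ((1 + gam) * U k c) by rewrite ler_wpM2l//; lra.
  by rewrite !expr2 => ? ?; apply/andP; split; lra.
have cU : continuous (U k.+1) by apply: buc_cont; exact: tow_buc.
have i1 : (1 - gam) ^+ 2 * U k c * (b - a) <= itg (U k.+1) a b.
  by rewrite -itg_cst//; apply: le_itg => // [|x /H/andP[]//]; exact: cst_continuous.
have i2 : itg (U k.+1) a b <= (1 + gam) ^+ 2 * U k c * (b - a).
  by rewrite -itg_cst//; apply: le_itg => // [|x /H/andP[]//]; exact: cst_continuous.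
move=> /andP[t1 t2]; apply/andP; split.
  by apply: le_trans t1; rewrite exprS -!mulrA ler_wpM2l// !mulrA.
by apply: le_trans t2 _; rewrite [in leRHS]exprS -!mulrA ler_wpM2l// !mulrA.
Qed.

End scale.

(** * From two-sided bounds to doubling and joint A_p *)

Section weights.
Context {R : realType}.
Implicit Types (w v f : R -> R) (a b c x y L gam p delta : R) (k n j : nat).
Let mu := @lebesgue_measure R.

Lemma continuous_is_weight w : continuous w -> (forall x, 0 < w x) -> is_weight w.
Proof.
move=> cw w0; split; last by apply: aeW.
split.
- exact: continuous_measurable_fun.
- exact: openT.
- move=> K _ cK.
  have : mu.-integrable K (EFin \o w).
    by apply: continuous_compact_integrable => //; exact: continuous_subspaceT.
  by move=> /integrableP[_].
Qed.

Lemma doubling_le gam delta w : 0 < gam <= 8^-1 ->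
  2 * ((1 + gam) / (1 - gam)) ^+ 3 <= 2 + delta ->
  continuous w ->
  (forall a b, a < b -> exists2 C, 0 < C &
    (1 - gam) ^+ 3 * C * (b - a) <= itg w a b /\
    itg w ((a + b) / 2 - (b - a)) ((a + b) / 2 + (b - a)) <= (1 + gam) ^+ 3 * C * (2 * (b - a))) ->
  (doubling_constant w <= (2 + delta)%:E)%E.
Proof.
move=> /andP[g0 g8] gd cw H; apply: ge_ereal_sup => _ [a [b [ab ->]]].
have [C C0 [h1 h2]] := H a b ab.
rewrite /wmeas /dbl_itv !itgE//.
have g1 : 0 < 1 - gam by lra.
have ba : 0 < b - a by rewrite subr_gt0.
have P : 0 < itg w a b.
  by apply: lt_le_trans h1; rewrite !mulr_gt0 ?exprn_gt0.
rewrite inver gt_eqF// -EFinM lee_fin ler_pdivrMr//.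
apply: le_trans h2 _.
have d0 : 0 <= 2 + delta.
  by apply: le_trans gd; rewrite mulr_ge0// exprn_ge0// divr_ge0; lra.
apply: le_trans (ler_wpM2l d0 h1).
have e : (1 + gam) ^+ 3 * C * (2 * (b - a)) =
   2 * ((1 + gam) / (1 - gam)) ^+ 3 * ((1 - gam) ^+ 3 * C * (b - a)).
  rewrite expr_div_n; field; by rewrite gt_eqF.
by rewrite e ler_wpM2r// ltW// !mulr_gt0 ?exprn_gt0.
Qed.

Lemma average_itg w a b : continuous w -> average w a b = ((b - a)^-1 * itg w a b)%:E.
Proof. by move=> cw; rewrite /average /wmeas itgE. Qed.

Lemma joint_Ap_lt_pinfty p gam w (s : R -> R) v : 1 < p -> 0 < gam <= 8^-1 ->
  continuous w -> continuous s -> (forall x, 0 < w x) -> (forall x, 0 < s x) ->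
  dual_weight p v = s ->
  (forall a b, a < b -> exists C S, [/\ 0 < C, 0 < S, C * S `^ (p - 1) <= 1,
    itg w a b <= (1 + gam) ^+ 3 * C * (b - a) &
    itg s a b <= (1 + gam) ^+ 3 * S * (b - a)]) ->
  (joint_Ap p w v < +oo)%E.
Proof.
move=> p1 /andP[g0 g8] cw cs w0 s0 vs H.
pose G := (1 + gam) ^+ 3.
have G0 : 0 < G by rewrite exprn_gt0//; lra.
apply: (@le_lt_trans _ _ (G * G `^ (p - 1))%:E); last exact: ltry.
apply: ge_ereal_sup => _ [a [b [ab ->]]].
have [C [S [C0 S0 CS h1 h2]]] := H a b ab.
rewrite vs !average_itg// poweR_EFin -EFinM lee_fin.
have ba : 0 < b - a by rewrite subr_gt0.
have avg u K : itg u a b <= G * K * (b - a) -> (b - a)^-1 * itg u a b <= G * K.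
  by move=> h; rewrite mulrC ler_pdivrMr.
have i0 u : (forall x, 0 < u x) -> 0 <= (b - a)^-1 * itg u a b.
  by move=> u0; rewrite mulr_ge0 ?invr_ge0 ?(ltW ba)// itg_ge0// => x _; exact: ltW.
apply: (@le_trans _ _ ((G * C) * (G * S) `^ (p - 1))).
  apply: ler_pM; [exact: i0|exact: powR_ge0|exact: avg|].
  apply: ge0_ler_powR; rewrite ?nnegrE ?i0 ?avg//; first by rewrite subr_ge0 ltW.
  by rewrite mulr_ge0// ltW.
rewrite powRM ?(ltW G0) ?(ltW S0)//.
have -> : G * C * (G `^ (p - 1) * S `^ (p - 1)) = (G * G `^ (p - 1)) * (C * S `^ (p - 1)) by ring.
by rewrite ler_piMr// mulr_ge0 ?powR_ge0// ltW.
Qed.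

Lemma exists_gam delta : 0 < delta ->
  exists2 gam, 0 < gam <= 8^-1 & 2 * ((1 + gam) / (1 - gam)) ^+ 3 <= 2 + delta.
Proof.
move=> d0; pose g := Num.min 8^-1 (delta / 32) : R.
have g0 : 0 < g by rewrite lt_min invr_gt0 ltr0n divr_gt0.
have g8 : g <= 8^-1 by rewrite ge_min lexx.
have gd : g <= delta / 32 by rewrite ge_min lexx orbT.
exists g; first by rewrite g0.
move: g g0 g8 gd => g g0 g8 gd.
have g1 : 0 < 1 - g by lra.
have u1 : (1 + g) / (1 - g) <= 1 + 3 * g.
  by rewrite ler_pdivrMr//; nra.
have u0 : 0 <= (1 + g) / (1 - g) by rewrite divr_ge0; lra.
have : ((1 + g) / (1 - g)) ^+ 3 <= (1 + 3 * g) ^+ 3.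
  by rewrite lerXn2r ?nnegrE//; lra.
have : (1 + 3 * g) ^+ 3 <= 1 + 16 * g.
  have gg : g * g <= g * 8^-1 by rewrite ler_pM2l.
  have ggg : g * (g * g) <= g * 64^-1.
    by rewrite ler_pM2l//; apply: le_trans gg _; lra.
  have -> : (1 + 3 * g) ^+ 3 = 1 + 9 * g + 27 * (g * g) + 27 * (g * (g * g)) by ring.
  lra.
lra.
Qed.

End weights.

(** * Truncated Hilbert transforms *)
Section truncated.
Context {R : realType}.
Implicit Types (f : R -> R) (a b c x y t eta T L : R).
Let mu := @lebesgue_measure R.

Definition far x eta : set R := [set y | eta < `|x - y|].

(** A continuous bounded extension of [1 / (x - y)] from [|x - y| >= eta] to the whole line. *)
Definition kernel eta x y : R := (x - y) / Num.max (eta ^+ 2) ((x - y) ^+ 2).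

Lemma kernelE eta x y : 0 < eta -> eta <= `|x - y| -> kernel eta x y = (x - y)^-1.
Proof.
move=> e0 exy; have xy : x - y != 0 by rewrite -normr_gt0 (lt_le_trans e0).
rewrite /kernel max_r.
  by rewrite expr2 invfM mulrA divff// mul1r.
by rewrite -[leRHS]real_normK ?num_real// lerXn2r ?nnegrE// ltW.
Qed.

Lemma kernel_cont eta x : 0 < eta -> continuous (kernel eta x).
Proof.
move=> e0; have cs : continuous (fun y => x - y).
  by move=> y; apply: cvgB; [exact: cvg_cst|exact: cvg_id].
have cc (k : R) : continuous (fun _ : R => k) by exact: cst_continuous.
apply: cont_mul => // y; apply: cvgV; first by rewrite gt_eqF// lt_max exprn_gt0.
apply: (@continuous_max _ _ (fun=> eta ^+ 2) (fun y => (x - y) ^+ 2)); first exact: cc.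
have c2 : continuous (fun y => (x - y) ^+ 2).
  by under eq_fun do rewrite expr2; exact: (cont_mul cs cs).
exact: c2.
Qed.

Lemma kernel_le eta x y : 0 < eta -> `|kernel eta x y| <= eta^-1.
Proof.
move=> e0; set d := x - y.
have m0 : 0 < Num.max (eta ^+ 2) (d ^+ 2) by rewrite lt_max exprn_gt0.
rewrite /kernel -/d normrM normfV (gtr0_norm m0) ler_pdivrMr// ler_pdivlMl//.
have [ed|ed] := leP eta `|d|.
  apply: (@le_trans _ _ (d ^+ 2)); last by rewrite le_max lexx orbT.
  by rewrite -[leRHS]real_normK ?num_real// expr2 ler_wpM2r.
apply: (@le_trans _ _ (eta ^+ 2)); last by rewrite le_max lexx.
by rewrite expr2 ler_wpM2l// ltW.
Qed.

Lemma measurable_far x eta : measurable (far x eta : set (measurableTypeR R)).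
Proof.
apply: open_measurable; rewrite /far.
have c : continuous (fun y => `|x - y|).
  move=> y; apply: (@continuous_comp _ _ _ (fun y => x - y) (@Num.norm _ R)).
    by apply: cvgB; [exact: cvg_cst|exact: cvg_id].
  exact: norm_continuous.
exact: (open_comp (fun y _ => c y) (@open_gt R eta)).
Qed.

Lemma kernel_integrable f x eta : 0 < eta -> continuous f ->
  mu.-integrable setT (EFin \o f) ->
  mu.-integrable setT (EFin \o (fun y => f y * kernel eta x y)).
Proof.
move=> e0 cf If.
have ck := @kernel_cont eta x e0.
apply: (@le_integrable _ _ _ mu setT measurableT _ (fun y => (eta^-1)%:E * (EFin \o f) y)%E).
- apply/measurable_EFinP; apply: continuous_measurable_fun; exact: cont_mul.
- move=> y _; change (`|f y * kernel eta x y|%:E <= `|eta^-1 * f y|%:E)%E.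
  have := @kernel_le eta x y e0; move: (kernel eta x y) => k kle.
  have i0 : 0 < eta^-1 by rewrite invr_gt0.
  by rewrite lee_fin !normrM (gtr0_norm i0) [X in X <= _]mulrC ler_wpM2r.
- exact: integrableZl.
Qed.

Lemma far_integrable f x eta : 0 < eta -> continuous f ->
  mu.-integrable setT (EFin \o f) ->
  mu.-integrable (far x eta) (fun y => (f y / (x - y))%:E).
Proof.
move=> e0 cf If.
have H : mu.-integrable (far x eta) (EFin \o (fun y => f y * kernel eta x y)).
  by apply: integrableS (kernel_integrable x e0 cf If) => //; exact: measurable_far.
apply: eq_integrable H => //; first exact: measurable_far.
by move=> y /[!inE] /= ey; rewrite kernelE// ltW.
Qed.

Lemma far_split x eta T : 0 < eta -> eta <= T ->
  far x eta = (`[x - T, x - eta[ `|` `]x + eta, x + T]) `|` far x T.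
Proof.
move=> e0 eT; apply/seteqP; split=> y /=; rewrite ?in_itv/=.
  rewrite /far /= => e1; have [h|h] := leP `|x - y| T; last by right.
  left; move: e1 h; rewrite ler_norml ltNge ler_norml negb_and -!ltNge => e1 /andP[h1 h2].
  by case/orP: e1 => e1; [right|left]; apply/andP; split; lra.
move=> [[/andP[h1 h2]|/andP[h1 h2]]|].
- by rewrite /far /= ger0_norm; lra.
- by rewrite /far /= ler0_norm; lra.
- exact: le_lt_trans.
Qed.

Lemma hilbert_trunc_split f x eta T : 0 < eta -> eta <= T -> continuous f ->
  mu.-integrable setT (EFin \o f) ->
  hilbert_trunc f x eta =
  itg (fun t => (f (x - t) - f (x + t)) / Num.max eta t) eta T +
  Rintegral mu (far x T) (fun y => f y * kernel eta x y).
Proof.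
move=> e0 eT cf If.
pose F y := f y * kernel eta x y.
have cF : continuous F by apply: cont_mul => //; exact: kernel_cont.
have IF : mu.-integrable setT (EFin \o F) by exact: kernel_integrable.
have IFs A : measurable A -> mu.-integrable A (EFin \o F).
  by move=> mA; apply: integrableS IF.
have -> : hilbert_trunc f x eta = Rintegral mu (far x eta) F.
  apply: eq_Rintegral => y; rewrite inE /= => ey.
  by rewrite /F kernelE// ltW.
have mfar := measurable_far.
rewrite (far_split x e0 eT) Rintegral_setU//; first last.
- apply/disj_setPS => y /= [[]]; rewrite /far /= !in_itv/= => /andP[h1 h2].
    by rewrite ger0_norm; lra.
  by rewrite ler0_norm; lra.
- apply: IFs; apply: measurableU; last exact: mfar.
  by apply: measurableU; exact: measurable_itv.
- by apply: measurableU; exact: measurable_itv.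
congr (_ + _); rewrite Rintegral_setU//; first last.
- apply/disj_setPS => y /= []; rewrite !in_itv/= => /andP[h1 h2] /andP[h3 h4]; lra.
- by apply: IFs; apply: measurableU; exact: measurable_itv.
rewrite Rintegral_itv_bndo_bndc ?IFs// Rintegral_itv_obnd_cbnd ?IFs//.
rewrite -/(itg F (x - T) (x - eta)) -/(itg F (x + eta) (x + T)).
rewrite -itg_reflect// -itg_shift// -itgD; first last.
- by move=> t; apply: (@continuous_comp _ _ _ (fun t => x + t) F);
    [apply: cvgD; [exact: cvg_cst|exact: cvg_id]|exact: cF].
- by move=> t; apply: (@continuous_comp _ _ _ (fun t => x - t) F);
    [apply: cvgB; [exact: cvg_cst|exact: cvg_id]|exact: cF].
apply: eq_itg => t /andP[t1 t2]; have t0 : 0 < t by apply: lt_le_trans t1.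
rewrite /F max_r//.
have xm : x - (x - t) = t by ring.
have xp : x - (x + t) = - t by ring.
rewrite !kernelE ?xm ?xp ?normrN ?gtr0_norm//.
by rewrite invrN; ring.
Qed.

(** Two truncations at [e1 <= e2] differ by the integral over [[e1, e2]] of a difference quotient
    bounded by [L], so the truncations are Cauchy. *)
Lemma hilbert_defined_lip f x L d : continuous f -> mu.-integrable setT (EFin \o f) ->
  0 < d -> (forall t, 0 <= t <= d -> `|f (x - t) - f (x + t)| <= L * t) ->
  hilbert_defined f x.
Proof.
move=> cf If d0 fL; split; first by move=> e e0; exact: far_integrable.
have L0 : 0 <= L.
  have := fL d; rewrite ltW// lexx => /(_ isT) h.
  by rewrite -(pmulr_lge0 _ d0); exact: le_trans h.
have key e1 e2 : 0 < e1 -> e1 <= e2 -> e2 <= d ->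
    `|hilbert_trunc f x e1 - hilbert_trunc f x e2| <= L * e2.
  move=> e10 e12 e2d.
  have e20 : 0 < e2 by apply: lt_le_trans e12.
  rewrite (hilbert_trunc_split x e10 e12)//.
  have -> : Rintegral mu (far x e2) (fun y => f y * kernel e1 x y) = hilbert_trunc f x e2.
    apply: eq_Rintegral => y; rewrite inE /far /= => ey.
    by rewrite kernelE// ltW// (le_lt_trans e12).
  rewrite addrK.
  have cm : continuous (fun t => f (x - t)).
    move=> t; apply: (@continuous_comp _ _ _ (fun t => x - t) f); last exact: cf.
    by apply: cvgB; [exact: cvg_cst|exact: cvg_id].
  have cp : continuous (fun t => f (x + t)).
    move=> t; apply: (@continuous_comp _ _ _ (fun t => x + t) f); last exact: cf.
    by apply: cvgD; [exact: cvg_cst|exact: cvg_id].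
  apply: le_trans (@itg_abs _ _ e1 e2 L _ e12 _) _.
  - by apply: cont_mul; [exact: cont_sub|exact: cont_invmax].
  - move=> t /andP[t1 t2]; have t0 : 0 < t by apply: lt_le_trans t1.
    rewrite max_r// normrM normfV (gtr0_norm t0) ler_pdivrMr//.
    by apply: fL; rewrite (ltW t0) (le_trans t2).
  - by rewrite ler_wpM2l// lerBlDr lerDl ltW.
apply/cauchy_cvgP; apply/cauchy_ballP => e e0.
pose r := Num.min d (e / (L + 1)).
have L1 : 0 < L + 1 by lra.
have r0 : 0 < r by rewrite lt_min d0 divr_gt0.
have rd : r <= d by rewrite ge_min lexx.
have Lr : L * r < e.
  apply: (@lt_le_trans _ _ ((L + 1) * r)); first by rewrite ltr_pM2r// ltrDl.
  by rewrite mulrC -ler_pdivlMr// ge_min lexx orbT.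
have near_r : \forall e1 \near 0^'+, 0 < e1 <= r.
  near=> e1; apply/andP; split; near: e1; first exact: nbhs_right_gt.
  exact: nbhs_right_le.
have cmp e1 e2 : 0 < e1 <= r -> 0 < e2 <= r ->
    ball (hilbert_trunc f x e1) e (hilbert_trunc f x e2).
  move=> /andP[a1 a2] /andP[b1 b2]; rewrite /ball /=.
  have [h|/ltW h] := leP e1 e2.
    apply: le_lt_trans (key _ _ a1 h (le_trans b2 rd)) _.
    by apply: le_lt_trans Lr; rewrite ler_wpM2l.
  rewrite distrC; apply: le_lt_trans (key _ _ b1 h (le_trans a2 rd)) _.
  by apply: le_lt_trans Lr; rewrite ler_wpM2l.
exists ([set hilbert_trunc f x e1 | e1 in [set e1 | 0 < e1 <= r]],
        [set hilbert_trunc f x e1 | e1 in [set e1 | 0 < e1 <= r]]).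
  by split; rewrite /= ; apply: filterS near_r => e1 h; exists e1.
by move=> [u v] /= [[e1 h1 <-] [e2 h2 <-]]; exact: cmp.
Unshelve. all: by end_near. Qed.

Lemma far_kernel_le f x eta T : 0 < eta -> eta <= T -> continuous f ->
  mu.-integrable setT (EFin \o f) ->
  `|Rintegral mu (far x T) (fun y => f y * kernel eta x y)| <=
  T^-1 * Rintegral mu setT (fun y => `|f y|).
Proof.
move=> e0 eT cf If.
have T0 : 0 < T by apply: lt_le_trans eT.
have mfar := measurable_far x T.
have IF : mu.-integrable (far x T) (EFin \o (fun y => f y * kernel eta x y)).
  by apply: integrableS (kernel_integrable x e0 cf If).
have Ia : mu.-integrable setT (EFin \o (fun y => `|f y|)).
  exact: (integrable_norm If).
have Iaf : mu.-integrable (far x T) (EFin \o (fun y => `|f y|)) by apply: integrableS Ia.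
apply: le_trans (le_normr_Rintegral mfar IF) _.
apply: (@le_trans _ _ (Rintegral mu (far x T) (fun y => T^-1 * `|f y|))).
  apply: le_Rintegral => //.
  - exact: (integrable_norm IF).
  - exact: (integrableZl mfar (T^-1) Iaf).
  - move=> y /= yT; rewrite normrM mulrC ler_wpM2r//.
    have xy0 : 0 < `|x - y| by apply: lt_trans yT.
    by rewrite kernelE// ?normfV ?lef_pV2 ?posrE// ltW// (le_lt_trans eT).
rewrite RintegralZl// ler_wpM2l ?invr_ge0 ?(ltW T0)//.
rewrite /Rintegral fine_le//.
- exact: integrable_fin_num.
- exact: integrable_fin_num.
- apply: ge0_subset_integral => //.
  by apply/measurable_EFinP; case/integrableP: Ia => /measurable_EFinP.
Qed.

End truncated.

(** * The stage weights form towers *)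

Section towers.
Context {R : realType}.
Variables (p eps gam : R).
Hypotheses (p1 : 1 < p) (eps0 : 0 < eps) (epsg : eps <= gam)
  (epsbg : eps * (p - 1) <= gam).
Variable st : nat -> @stage R.
Hypotheses (st0 : st 0%N = stage0) (st_inv : forall k, admissible p gam (st k))
  (st_ref : forall k, refines p eps gam k (st k) (st k.+1)).

Let lam k := slam (st k).

Lemma stage_lamS k : lam k.+1 <= lam k.
Proof. by have [N [h []]] := st_ref k. Qed.

Lemma stage_lam2 k : lam k.+1 <= 2^-1 ^+ k.
Proof. by have [N [h []]] := st_ref k. Qed.

Lemma towerX : tower gam lam (fun k => sX (st k)).
Proof.
split.
- by rewrite st0.
- by move=> k; case: (st_inv k).
- by move=> k; case: (st_inv k).
- by move=> k; case: (st_inv k).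
- move=> k x; have [N [h [_ -> _ _ _ _ _ _ _ _ _ _]]] := st_ref k.
  have X0 : 0 < sX (st k) x by apply: posb_gt0; case: (st_inv k).
  have -> : stepX eps N (ramp k) (sX (st k)) x - sX (st k) x =
     eps * ramp k x * cos (N * x) * sX (st k) x by rewrite /stepX; ring.
  rewrite normrM (gtr0_norm X0) ler_wpM2r ?(ltW X0)//.
  rewrite normrM (@le_trans _ _ `|eps * ramp k x|) ?ler_piMr//.
    by rewrite ler_norml cos_geN1 cos_le1.
  by rewrite ger0_norm ?mulr_ge0 ?ramp_ge0 ?(ltW eps0)// ler_wpM2r ?ramp_ge0.
- by move=> k; have [N [h []]] := st_ref k.
Qed.

Lemma towerW : tower gam lam (fun k => sW (st k)).
Proof.
split.
- by rewrite st0.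
- by move=> k; case: (st_inv k).
- by move=> k; case: (st_inv k).
- by move=> k; case: (st_inv k).
- move=> k x; have [N [h [_ _ -> _ _ _ _ _ _ _ _ _]]] := st_ref k.
  have [_ _ pX _ pW _ Z1 _ _ _] := st_inv k.
  have W0 : 0 < sW (st k) x by exact: posb_gt0.
  have Z0 := apZ_gt0 p x pX pW; have Z1x := Z1 x.
  set z := apZ p _ _ x in Z0 Z1x.
  have -> : stepW p eps N (ramp k) (sX (st k)) (sW (st k)) x - sW (st k) x =
     - (eps * (p - 1) * z * ramp k x * cos (N * x) * sW (st k) x) by rewrite /stepW -/z; ring.
  have b0 : 0 <= p - 1 by rewrite subr_ge0 ltW.
  have eb : 0 <= eps * (p - 1) by rewrite mulr_ge0// ltW.
  have r0 := ramp_ge0 k x.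
  rewrite normrN normrM (gtr0_norm W0) ler_wpM2r ?(ltW W0)//.
  rewrite normrM (@le_trans _ _ `|eps * (p - 1) * z * ramp k x|) ?ler_piMr//.
    by rewrite ler_norml cos_geN1 cos_le1.
  have ebz : 0 <= eps * (p - 1) * z by rewrite mulr_ge0// ltW.
  rewrite (ger0_norm (mulr_ge0 ebz r0)) ler_wpM2r//.
  by apply: le_trans epsbg; rewrite ler_piMr.
- by move=> k; have [N [h []]] := st_ref k.
Qed.

End towers.

(** * The test function *)
Section cutoff.
Context {R : realType}.
Implicit Types (x y M : R) (n m : nat) (alpha : nat -> R).

(** It equals 1 on [[4n+1, 4n+2]] and lives on [J_n], leaving the gap [[4n+3, 4n+4]] to [ramp n]. *)
Definition plateau n x : R := clamp (3 / 2 - `|x - ((4 * n)%:R + 3 / 2)|).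

Lemma plateau_ge0 n x : 0 <= plateau n x. Proof. exact: clamp_ge0. Qed.

Lemma plateau_le1 n x : plateau n x <= 1. Proof. exact: clamp_le1. Qed.

Lemma plateau_lip n : lipb 1 (plateau n).
Proof.
split=> [x|x y]; first by rewrite ger0_norm ?plateau_ge0 ?plateau_le1.
rewrite mul1r; apply: le_trans (clamp_lip _ _) _.
set c := (4 * n)%:R + 3 / 2.
have -> : 3 / 2 - `|x - c| - (3 / 2 - `|y - c|) = `|y - c| - `|x - c| by ring.
apply: le_trans (ler_dist_dist _ _) _.
have -> : y - c - (x - c) = - (x - y) by ring.
by rewrite normrN.
Qed.

Lemma plateau1 n x : (4 * n + 1)%:R <= x <= (4 * n + 2)%:R -> plateau n x = 1.
Proof.
rewrite !natrD => /andP[h1 h2]; apply: clamp1.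
have : `|x - ((4 * n)%:R + 3 / 2)| <= 1 / 2 by rewrite ler_norml; apply/andP; split; lra.
by move=> ?; lra.
Qed.

Lemma plateau_neq0 n x : plateau n x != 0 -> (4 * n)%:R < x < (4 * n)%:R + 3.
Proof.
move=> b0; have : ~~ (3 / 2 - `|x - ((4 * n)%:R + 3 / 2)| <= 0).
  by apply: contra b0 => h; rewrite /plateau clamp0.
rewrite -ltNge subr_gt0 ltr_norml => /andP[? ?].
by apply/andP; split; lra.
Qed.

Definition cell x : nat := Num.truncn (x / 4).

(** The sum over [n] of [alpha n * plateau n], written through its only possibly nonzero term. *)
Definition cutoff alpha x : R := alpha (cell x) * plateau (cell x) x.

Lemma cell_plateau n x : plateau n x != 0 -> cell x = n.
Proof.
move=> /plateau_neq0 /andP[]; rewrite natrM => h1 h2.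
by apply: truncn_def; rewrite -[n.+1%:R]natr1; apply/andP; split; lra.
Qed.

(** For [n > 0] the range is [[4n-1, 4n+4]], which begins where the previous bump ends; the
    [Num.max 1] lets [n = 0] cover the whole negative axis. *)
Lemma cutoffE alpha n x : (4 * n)%:R <= Num.max 1 (x + 1) -> x <= (4 * n)%:R + 4 ->
  cutoff alpha x = alpha n * plateau n x.
Proof.
move=> h1 h2; have [e|ne] := eqVneq (cell x) n; first by rewrite /cutoff e.
have -> : plateau n x = 0.
  by apply/eqP; apply: contraNT ne => /cell_plateau ->.
rewrite mulr0 /cutoff; have [->|b] := eqVneq (plateau (cell x) x) 0; first by rewrite mulr0.
case/negP: ne; have /andP[b1 b2] := plateau_neq0 b.
rewrite eqn_leq; apply/andP; split.
  by rewrite -ltnS -(ltr_nat R) -[n.+1%:R]natr1; move: b1 h2; rewrite !natrM => ? ?; lra.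
rewrite -ltnS -(ltr_nat R) -[(cell x).+1%:R]natr1; move: h1 b1 b2.
have c0 : 0 <= (cell x)%:R :> R by [].
rewrite le_max !natrM => /orP[h|h] ? ?; lra.
Qed.

Lemma cutoff_local alpha x : exists n, exists2 d : R, 0 < d &
  forall y, `|x - y| <= d -> cutoff alpha y = alpha n * plateau n y.
Proof.
have xc : x < (4 * cell x)%:R + 4.
  by have := truncnS_gt (x / 4); rewrite -/(cell x) -[(cell x).+1%:R]natr1 natrM => ?; lra.
exists (cell x), (Num.min 1 ((4 * cell x)%:R + 4 - x)).
  by rewrite lt_min ltr01 subr_gt0.
move=> y; rewrite le_min => /andP[y1 y2]; apply: cutoffE; last first.
  by move: y2; rewrite ler_norml => /andP[? ?]; lra.
rewrite le_max; have [->|c0] := posnP (cell x); first by rewrite muln0 ler01.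
apply/orP; right.
have : (cell x)%:R <= x / 4.
  by rewrite truncn_le; move: c0; rewrite truncn_gt0; exact: le_trans.
by move: y1; rewrite ler_norml natrM => /andP[? ?] ?; lra.
Qed.

(** The weight [2^-i] is placed at an index [nn i] where [E] is so large that its multiple by
    [2^(-i q)] exceeds [i]. *)
Lemma summable_weights (q : R) (E : nat -> R) : 0 < q ->
  (forall M, exists n0, forall n, (n0 <= n)%N -> M < E n) ->
  exists alpha : nat -> R, [/\ forall n, 0 <= alpha n,
    forall m, \sum_(n < m) alpha n <= 2 &
    forall M, exists n, M < alpha n `^ q * E n].
Proof.
move=> q0 HE.
pose h i : R := 2^-1 ^+ i.
have h0 i : 0 < h i by rewrite exprn_gt0// invr_gt0.
have /choice[nn nnP] : forall i : nat, exists n, (i <= n)%N /\ i%:R < h i `^ q * E n.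
  move=> i; have hq : 0 < h i `^ q by exact: powR_gt0.
  have [n0 Hn] := HE (i%:R / h i `^ q); exists (maxn i n0); split; first exact: leq_maxl.
  by have := Hn _ (leq_maxr i n0); rewrite ltr_pdivrMr// mulrC.
(* Weights landing on the same index are added; [i <= nn i] bounds the sum by [i <= n]. *)
pose alpha n : R := \sum_(i < n.+1) h i * (nn i == n)%:R.
have a0 n : 0 <= alpha n by apply: sumr_ge0 => i _; rewrite mulr_ge0 ?(ltW (h0 i)).
have hsum m : \sum_(i < m) h i <= 2.
  suff : \sum_(i < m) h i = 2 - 2 * h m by move=> ->; have := h0 m; lra.
  elim: m => [|m IH]; first by rewrite big_ord0 /h expr0; lra.
  by rewrite big_ord_recr/= IH /h exprS; field.
exists alpha; split => // [m|M].
  apply: le_trans (hsum m).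
  apply: (@le_trans _ _ (\sum_(n < m) \sum_(i < m) h i * (nn i == n)%:R)).
    apply: ler_sum => n _; rewrite /alpha.
    rewrite (big_ord_widen m (fun i => h i * (nn i == n)%:R))//.
    rewrite big_mkcond /=; apply: ler_sum => i _; case: ifP => // _.
    by rewrite mulr_ge0 ?(ltW (h0 i)).
  rewrite exchange_big /=; apply: ler_sum => i _.
  rewrite -mulr_sumr ler_piMr ?(ltW (h0 i))//.
  have [lt|ge] := ltnP (nn i) m.
    rewrite (bigD1 (Ordinal lt))//= eqxx big1 ?addr0// => j jne.
    by case: eqP => // e; case/negP: jne; apply/eqP/val_inj.
  rewrite big1// => j _; case: eqP => // e.
  by have := ltn_ord j; rewrite -e ltnNge ge.
have [i Mi] : exists i : nat, M < i%:R.
  by exists (Num.truncn `|M|).+1; apply: le_lt_trans (truncnS_gt _); exact: ler_norm.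
have [ni iE] := nnP i; exists (nn i); apply: lt_trans Mi _; apply: lt_le_trans iE _.
have hq : 0 < h i `^ q by exact: powR_gt0.
have E0 : 0 <= E (nn i).
  have [_ iE] := nnP i; rewrite -(pmulr_rge0 _ hq) ltW//; exact: le_lt_trans iE.
rewrite ler_wpM2r//; apply: ge0_ler_powR; rewrite ?nnegrE ?(ltW q0) ?(ltW (h0 i))//.
have ilt : (i < (nn i).+1)%N by [].
rewrite /alpha (bigD1 (Ordinal ilt))//= eqxx mulr1 lerDl.
by apply: sumr_ge0 => j _; rewrite mulr_ge0 ?(ltW (h0 j)).
Qed.

End cutoff.

(** * Integrals over the whole line *)

Section integral_bounds.
Context {R : realType}.
Implicit Types (f h s G H : R -> R) (a b c x y M : R).
Let mu := @lebesgue_measure R.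

(* For a nonmeasurable [H] the integral is still the supremum over simple
   functions below [H]. *)
Lemma le_integral_itg G H a b : continuous G -> (forall x, 0 <= H x) ->
  (forall x, a <= x <= b -> G x <= H x) ->
  ((itg G a b)%:E <= \int[mu]_x (H x)%:E)%E.
Proof.
move=> cG H0 GH; pose P x := Num.max 0 (G x).
have cP : continuous P.
  by move=> x; apply: (@continuous_max _ _ (fun=> 0) G); [exact: cst_continuous|exact: cG].
apply: (@le_trans _ _ (itg P a b)%:E).
  by rewrite lee_fin; apply: le_itg => // x _; rewrite /P le_max lexx orbT.
rewrite -itgE// integral_mkcond.
have P0 x : (0 <= ((fun x => (P x)%:E) \_ `[a, b]) x)%E.
  by rewrite patchE; case: ifP => // _; rewrite lee_fin /P le_max lexx.
have H0' x : (0 <= (H x)%:E)%E by rewrite lee_fin.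
rewrite [leLHS](ge0_integralTE mu P0) [leRHS](ge0_integralTE mu H0').
apply: ereal_sup_le => _ [h hP <-]; exists h => // x.
apply: le_trans (hP x) _; rewrite patchE; case: ifPn => // xab.
rewrite lee_fin /P ge_max H0/=; apply: GH.
by move: xab; rewrite inE /= in_itv.
Qed.

Lemma integral_exhaust h M : continuous h -> (forall x, 0 <= h x) ->
  (forall m : nat, itg h (- m%:R) (4 * m)%:R <= M) ->
  (\int[mu]_x (h x)%:E <= M%:E)%E.
Proof.
move=> ch h0 hM.
have mh : measurable_fun (setT : set (measurableTypeR R)) (EFin \o h).
  by apply/measurable_EFinP; exact: continuous_measurable_fun.
pose F (m : nat) : set (measurableTypeR R) := [set` `[- m%:R, (4 * m)%:R : R]].
have FT : \bigcup_m F m = setT.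
  apply/seteqP; split=> // x _; exists (Num.truncn `|x|).+1 => //=.
  set m := _.+1; have xm : `|x| < m%:R by exact: truncnS_gt.
  rewrite /F /= in_itv/=; move: xm; rewrite ltr_norml => /andP[h1 h2].
  rewrite (ltW h1)/= (le_trans (ltW h2))// ler_nat.
  by rewrite leq_pmull.
have nF : nondecreasing_seq F.
  move=> m n mn; apply/subsetPset => x; rewrite /F /= !in_itv/= => /andP[h1 h2].
  apply/andP; split; first by apply: le_trans h1; rewrite lerN2 ler_nat.
  by apply: le_trans h2 _; rewrite ler_nat leq_mul2l.
have mF m : measurable (F m) by exact: measurable_itv.
have := @ge0_nondecreasing_set_cvg_integral _ _ R F (EFin \o h) mu nF mF.
rewrite FT => H.
have {}H : (\int[mu]_(x in F m) (h x)%:E)%E @[m --> \oo] --> (\int[mu]_x (h x)%:E)%E.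
  apply: H.
  - by move=> m; apply: measurable_funTS.
  - by move=> m x _; rewrite lee_fin.
rewrite -(cvg_lim _ H)//; apply: lime_le.
  by apply/cvg_ex; eexists; exact: H.
by apply: nearW => m; rewrite /F itgE// lee_fin.
Qed.

(** Each cell contributes at most [8 * kap * alpha n], and the [alpha n] sum to at most 2. *)
Lemma integral_cells h s (kap : R) (alpha : nat -> R) : continuous h -> continuous s ->
  (forall x, 0 <= h x) -> (forall x, 0 <= s x) -> 0 <= kap ->
  (forall n, 0 <= alpha n) -> (forall m, \sum_(n < m) alpha n <= 2) ->
  (forall x, x <= 0 -> h x = 0) ->
  (forall n, itg s (4 * n)%:R ((4 * n)%:R + 4) <= 8) ->
  (forall n x, (4 * n)%:R <= x <= (4 * n)%:R + 4 -> h x <= kap * alpha n * s x) ->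
  (\int[mu]_x (h x)%:E <= (16 * kap)%:E)%E.
Proof.
move=> ch cs h0 s0 k0 a0 asum hneg s8 hb.
apply: integral_exhaust => // m.
rewrite (@itg_split _ _ _ 0)//.
have -> : itg h (- m%:R) 0 = 0.
  rewrite -[RHS](mul0r (0 - - m%:R)) -itg_cst ?oppr_le0//.
  by apply: eq_itg => x /andP[_ /hneg].
rewrite add0r.
suff : itg h 0 (4 * m)%:R <= 8 * kap * \sum_(n < m) alpha n.
  have : 8 * kap * \sum_(n < m) alpha n <= 8 * kap * 2 by rewrite ler_wpM2l// mulr_ge0.
  by move=> *; lra.
elim: m => [|m IH].
  by rewrite muln0 big_ord0 mulr0 -[leRHS](mul0r (0 - 0)) -itg_cst//;
    apply: le_itg => //; [exact: cst_continuous|move=> x /andP[_ /hneg ->]].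
have e4 : (4 * m.+1)%:R = (4 * m)%:R + 4 :> R by rewrite mulnS addnC natrD.
rewrite (@itg_split _ _ _ (4 * m)%:R)//; last by rewrite e4 lerDl.
rewrite big_ord_recr /= mulrDr; apply: lerD => //.
rewrite e4; apply: (@le_trans _ _ (itg (fun x => kap * alpha m * s x) (4 * m)%:R ((4 * m)%:R + 4))).
  apply: le_itg => //; last by move=> x /hb.
  by apply: cont_mul => //; exact: cst_continuous.
rewrite itgZ//; have : kap * alpha m * itg s (4 * m)%:R ((4 * m)%:R + 4) <= kap * alpha m * 8.
  by rewrite ler_wpM2l// mulr_ge0.
by move=> *; lra.
Qed.

Lemma integrable_of_bound h M : continuous h -> (forall x, 0 <= h x) ->
  (\int[mu]_x (h x)%:E <= M%:E)%E -> mu.-integrable setT (EFin \o h).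
Proof.
move=> ch h0 hM; apply/integrableP; split.
  by apply/measurable_EFinP; exact: continuous_measurable_fun.
apply: le_lt_trans (ltry M); apply: le_trans hM.
rewrite le_eqVlt; apply/orP; left; apply/eqP; apply: eq_integral => x _ /=.
by rewrite ger0_norm.
Qed.

End integral_bounds.

(** * The test function and its Hilbert transform *)

Section witness.
Context {R : realType}.
Implicit Types (x y t eta M : R) (n k m : nat).
Let mu := @lebesgue_measure R.

Variables (p eps gam : R).
Hypotheses (p1 : 1 < p) (eps0 : 0 < eps) (epsg : eps <= gam)
  (epsbg : eps * (p - 1) <= gam) (gam0 : 0 < gam) (gam8 : gam <= 8^-1).
Variable st : nat -> @stage R.
Hypotheses (st0 : st 0%N = stage0) (st_inv : forall k, admissible p gam (st k))
  (st_ref : forall k, refines p eps gam k (st k) (st k.+1)).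

Let lam k := slam (st k).
Let X k := sX (st k).
Let W k := sW (st k).
Let tX : tower gam lam X := towerX eps0 epsg st0 st_inv st_ref.
Let tW : tower gam lam W := towerW p1 eps0 epsbg st0 st_inv st_ref.
Let sig := limit X.
Let wgt := limit W.

Let X_cont n : continuous (X n). Proof. by apply: buc_cont; case: (st_inv n). Qed.

Let plateau_cont n : continuous (plateau n : R -> R).
Proof. exact: buc_cont (lipb_buc (plateau_lip n)). Qed.

Lemma itg_limit_le U a b : tower gam lam U -> 1 <= b - a ->
  itg (limit U) a b <= 2 * (b - a).
Proof.
move=> tU ab; have g8 := gam8; have a_b : a <= b by lra.
rewrite (itg_limit tU a (ltW (level_gt b))).
have ab' : lam 0%N <= b - a by rewrite /lam st0.
have /andP[_ h] := tower_avg gam0 gam8 (stage_lamS st_ref) tU (leq0n (level b)) ab'.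
apply: le_trans h _; rewrite (tow0 tU) itg_cst// mul1r ler_wpM2r ?subr_ge0//.
by lra.
Qed.

Lemma symint_lin (f g : R -> R) (c x eta : R) : 0 < eta -> continuous f -> continuous g ->
  symint (fun y => f y + c * g y) x eta = symint f x eta + c * symint g x eta :> R.
Proof.
move=> e0 cf cg.
have cm (h : R -> R) : continuous h -> continuous (fun t : R => (h (x - t) - h (x + t)) / Num.max eta t).
  move=> ch; apply: cont_mul; last exact: cont_invmax.
  apply: cont_sub.
    by move=> t; apply: (@continuous_comp _ _ _ (fun t => x - t) h);
      [apply: cvgB; [exact: cvg_cst|exact: cvg_id]|exact: ch].
  by move=> t; apply: (@continuous_comp _ _ _ (fun t => x + t) h);
    [apply: cvgD; [exact: cvg_cst|exact: cvg_id]|exact: ch].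
rewrite /symint -itgDZ; [|exact: cm|exact: cm].
by apply: eq_itg => t _; ring.
Qed.

(** Stage by stage, the error starts at 4, a difference quotient bounded by 2 over a length below 2,
    and grows by at most [2^-k / 4]. *)
Lemma symint_stage n k : (k <= n)%N -> exists2 eta0 : R, 0 < eta0 &
  forall eta, 0 < eta < eta0 -> forall x, (4 * n + 1)%:R <= x <= (4 * n + 2)%:R ->
  `|symint (fun y => plateau n y * X k y) x eta - sY (st k) x| <= 4 + (1 - 2^-1 ^+ k) / 2.
Proof.
have eps1 : eps <= 1 by have := epsg; have := gam8; lra.
elim: k => [|k IH] kn.
  exists 2 => // eta /andP[e0 e2] x _.
  rewrite /X st0 /= subr0 expr0 subrr mul0r addr0.
  have -> : (fun y => plateau n y * cst 1 y) = plateau n :> (R -> R).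
    by apply/funext => y; rewrite mulr1.
  have cf : continuous (fun t : R => (plateau n (x - t) - plateau n (x + t)) / Num.max eta t).
    apply: cont_mul; last exact: cont_invmax.
    apply: cont_sub.
      by move=> t; apply: (@continuous_comp _ _ _ (fun t => x - t) (plateau n));
        [apply: cvgB; [exact: cvg_cst|exact: cvg_id]|exact: plateau_cont].
    by move=> t; apply: (@continuous_comp _ _ _ (fun t => x + t) (plateau n));
      [apply: cvgD; [exact: cvg_cst|exact: cvg_id]|exact: plateau_cont].
  apply: le_trans (@itg_abs _ _ eta 2 2 cf (ltW e2) _) _; last by lra.
  move=> t /andP[t1 _]; have t0 : 0 < t by apply: lt_le_trans t1.
  rewrite max_r// normrM normfV (gtr0_norm t0) ler_pdivrMr//.
  apply: le_trans ((plateau_lip n).2 _ _) _; rewrite mul1r.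
  have -> : x - t - (x + t) = - (2 * t) by ring.
  by rewrite normrN ger0_norm// mulr_ge0// ltW.
have [e1 e10 H1] := IH (ltnW kn).
have [N [h [_ eX _ eY _ _ _ _ _ _ _ [e2 e20 H2]]]] := st_ref k.
exists (Num.min e1 e2); first by rewrite lt_min e10.
move=> eta /andP[et0]; rewrite lt_min => /andP[et1 et2] x xI.
have := H1 eta _ x xI; rewrite et0 et1 => /(_ isT) K1.
have := H2 (plateau n) (plateau_lip n) x eta; rewrite et0 et2 => /(_ isT) K2.
have -> : (fun y => plateau n y * X k.+1 y) =
          (fun y => plateau n y * X k y + eps * (plateau n y * X k y * cos (N * y))).
  apply/funext => y; rewrite /X eX /stepX.
  have [->|/plateau_neq0 /andP[y1 _]] := eqVneq (plateau n y) 0; first by rewrite !mul0r mulr0 addr0.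
  (* For [k < n] the support of [plateau n] lies beyond [4k + 4], so the ramp disappears. *)
  rewrite ramp1 ?mul1r; first by ring.
  apply: le_trans (ltW y1); rewrite ler_nat -[X in (_ + X)%N]muln1 -mulnDr leq_mul2l addn1.
  by rewrite kn orbT.
rewrite symint_lin//; first last.
- by apply: cont_mul; [apply: cont_mul; [exact: plateau_cont|exact: X_cont]|exact: cont_cos].
- by apply: cont_mul; [exact: plateau_cont|exact: X_cont].
rewrite eY /stepY.
rewrite (plateau1 xI) mul1r in K2.
have -> : symint (fun y => plateau n y * X k y) x eta +
   eps * symint (fun y => plateau n y * X k y * cos (N * y)) x eta -
   (sY (st k) x + eps * h * (sX (st k) x * sin (N * x))) =
   (symint (fun y => plateau n y * X k y) x eta - sY (st k) x) +
   eps * (symint (fun y => plateau n y * X k y * cos (N * y)) x eta -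
     h * (sX (st k) x * sin (N * x))) by ring.
apply: le_trans (ler_normD _ _) _.
have : `|eps * (symint (fun y => plateau n y * X k y * cos (N * y)) x eta -
     h * (sX (st k) x * sin (N * x)))| <= 4^-1 * 2^-1 ^+ k.
  rewrite normrM (gtr0_norm eps0); apply: le_trans K2.
  by rewrite ler_piMl.
move: K1; rewrite exprS; move: (2^-1 ^+ k) (symint _ _ _ - sY _ _) (eps * _) => u v w.
by move=> *; lra.
Qed.

Variable alpha : nat -> R.
Hypotheses (alpha0 : forall n, 0 <= alpha n)
  (alpha_sum : forall m, \sum_(n < m) alpha n <= 2).

Definition witness x : R := cutoff alpha x * sig x.
Let f := witness.

Let alpha2 n : alpha n <= 2.
Proof.
apply: le_trans (alpha_sum n.+1); rewrite big_ord_recr /= lerDr.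
by apply: sumr_ge0 => i _.
Qed.

Let plateau_sig n y : plateau n y * sig y = plateau n y * X n y.
Proof.
have [->|/plateau_neq0 /andP[_ y2]] := eqVneq (plateau n y) 0; first by rewrite !mul0r.
by congr (_ * _); apply: (limitE tX); rewrite natrD ltW.
Qed.

Lemma witnessE n y : (4 * n)%:R <= Num.max 1 (y + 1) -> y <= (4 * n)%:R + 4 ->
  f y = alpha n * (plateau n y * X n y).
Proof. by move=> h1 h2; rewrite /f /witness (cutoffE _ h1 h2) -mulrA plateau_sig. Qed.

Lemma witness_local x : exists n, exists2 d : R, 0 < d &
  forall y, `|x - y| <= d -> f y = alpha n * (plateau n y * X n y).
Proof.
have [n [d d0 H]] := cutoff_local alpha x; exists n, d => // y /H e.
by rewrite /f /witness e -mulrA plateau_sig.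
Qed.

Lemma witness_cont : continuous f.
Proof.
move=> x; have [n [d d0 H]] := witness_local x.
apply: cvg_trans; last first.
  have -> : f x = alpha n * (plateau n x * X n x) by apply: H; rewrite subrr normr0 ltW.
  have c : continuous (fun y => alpha n * (plateau n y * X n y)).
    by apply: cont_mul; [exact: cst_continuous|apply: cont_mul; [exact: plateau_cont|exact: X_cont]].
  exact: c.
apply: near_eq_cvg; near=> y; apply: esym; apply: H.
by near: y; exists d => //= y /ltW.
Unshelve. all: by end_near. Qed.

Let sig_gt0 x : 0 < sig x := limit_gt0 tX x.
Let wgt_gt0 x : 0 < wgt x := limit_gt0 tW x.
Let sig_cont : continuous sig := limit_cont tX.
Let wgt_cont : continuous wgt := limit_cont tW.

Lemma cutoff_ge0 x : 0 <= cutoff alpha x.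
Proof. by rewrite mulr_ge0// plateau_ge0. Qed.

Lemma cutoff_le n x : (4 * n)%:R <= x <= (4 * n)%:R + 4 -> cutoff alpha x <= alpha n.
Proof.
move=> /andP[h1 h2]; rewrite (@cutoffE _ alpha n)//; first by rewrite ler_piMr ?plateau_le1.
by rewrite le_max; apply/orP; right; lra.
Qed.

Lemma cutoff_neg x : x <= 0 -> cutoff alpha x = 0.
Proof.
move=> x0; rewrite (@cutoffE _ alpha 0) ?muln0 ?le_max ?ler01//; last by lra.
have [->|/plateau_neq0 /andP[]] := eqVneq (plateau 0 x) 0; first by rewrite mulr0.
by rewrite muln0 => *; lra.
Qed.

Lemma cutoff_cont : continuous (cutoff alpha).
Proof.
move=> x; have [n [d d0 H]] := cutoff_local alpha x.
apply: cvg_trans; last first.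
  have -> : cutoff alpha x = alpha n * plateau n x by apply: H; rewrite subrr normr0 ltW.
  have c : continuous (fun y => alpha n * plateau n y).
    by apply: cont_mul; [exact: cst_continuous|exact: plateau_cont].
  exact: c.
apply: near_eq_cvg; near=> y; apply: esym; apply: H.
by near: y; exists d => //= y /ltW.
Unshelve. all: by end_near. Qed.

Let sig8 n : itg sig (4 * n)%:R ((4 * n)%:R + 4) <= 8.
Proof.
have := @itg_limit_le X (4 * n)%:R ((4 * n)%:R + 4) tX.
by rewrite addrAC subrr add0r => H; apply: le_trans (H _) _; lra.
Qed.

Lemma witness_integrable : mu.-integrable setT (EFin \o f).
Proof.
apply: (@integrable_of_bound _ _ (16 * 1)).
- exact: witness_cont.
- by move=> x; rewrite mulr_ge0 ?cutoff_ge0// ltW.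
apply: (@integral_cells _ _ sig 1 alpha) => //.
- exact: witness_cont.
- by move=> x; rewrite mulr_ge0 ?cutoff_ge0// ltW.
- by move=> x; rewrite ltW.
- by move=> x x0; rewrite /f /witness cutoff_neg// mul0r.
- by move=> n x xn; rewrite mul1r ler_wpM2r ?cutoff_le// ltW.
Qed.

Let v x : R := sig x `^ (- (p - 1)).

(** Since [sig^p * sig^(-(p-1)) = sig], the integrand is [cutoff^p * sig], and [cutoff <= 2] gives
    [cutoff^p <= 2^(p-1) * alpha n] on each cell. *)
Lemma witness_weighted : weighted_Lp p v f.
Proof.
have p0 : 0 < p by have := p1; lra.
split; first by apply: continuous_measurable_fun; exact: witness_cont.
rewrite /weighted_norm.
have E x : `|f x| `^ p * v x = cutoff alpha x `^ p * sig x.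
  rewrite ger0_norm; last by rewrite mulr_ge0 ?cutoff_ge0// ltW.
  rewrite /f /witness powRM ?cutoff_ge0 ?(ltW (sig_gt0 x))// -mulrA; congr (_ * _).
  rewrite /v -powRD; last by rewrite (gt_eqF (sig_gt0 x)) implybT.
  by rewrite opprB addrC subrK powRr1// ltW.
under eq_integral do rewrite E.
have pc : continuous (fun x => cutoff alpha x `^ p).
  have -> : (fun x => cutoff alpha x `^ p) = (fun x => `|cutoff alpha x| `^ p).
    by apply/funext => x; rewrite ger0_norm// cutoff_ge0.
  move=> x; apply: (@continuous_comp _ _ _ (cutoff alpha) (fun t => `|t| `^ p)).
    exact: cutoff_cont.
  exact: (continuous_normpow p1).
have B : (\int[mu]_x (cutoff alpha x `^ p * sig x)%:E <= (16 * 2 `^ (p - 1))%:E)%E.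
  apply: (@integral_cells _ _ sig _ alpha) => //.
  - exact: cont_mul.
  - by move=> x; rewrite mulr_ge0 ?powR_ge0// ltW.
  - by move=> x; rewrite ltW.
  - by move=> x x0; rewrite cutoff_neg// powR0 ?mul0r// gt_eqF.
  - move=> n x xn; rewrite ler_wpM2r//; first exact: ltW.
    rewrite powR_split ?cutoff_ge0// mulrC; apply: ler_pM.
    + exact: powR_ge0.
    + exact: cutoff_ge0.
    + apply: ge0_ler_powR; rewrite ?nnegrE ?cutoff_ge0//; first by rewrite subr_ge0 ltW.
      exact: le_trans (cutoff_le xn) (alpha2 n).
    + exact: cutoff_le.
have B0 : (0 <= \int[mu]_x (cutoff alpha x `^ p * sig x)%:E)%E.
  by apply: integral_ge0 => x _; rewrite lee_fin mulr_ge0 ?powR_ge0// ltW.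
move: B B0; case: (\int[mu]_x _)%E => [r| |]//= _ _.
by rewrite ?poweR_EFin ltry.
Qed.

Lemma witness_hilbert_defined x : hilbert_defined f x.
Proof.
have [n [d d0 H]] := witness_local x.
have [L L0 lX] : exists2 L : R, 0 < L & lipb L (X n) by case: (st_inv n).
have [_ lip] := lipb_mul (plateau_lip n) lX.
set K := _ + _ in lip.
apply: (@hilbert_defined_lip _ f x (alpha n * (K * 2)) d) => //.
- exact: witness_cont.
- exact: witness_integrable.
move=> t /andP[t0 td].
have xm : x - (x - t) = t by ring.
have xp : x - (x + t) = - t by ring.
have hm : `|x - (x - t)| <= d by rewrite xm ger0_norm.
have hp : `|x - (x + t)| <= d by rewrite xp normrN ger0_norm.
rewrite (H _ hm) (H _ hp) -mulrBr normrM (ger0_norm (alpha0 n)) -!mulrA ler_wpM2l//.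
apply: le_trans (lip _ _) _.
have -> : x - t - (x + t) = - (2 * t) by ring.
by rewrite normrN (ger0_norm (mulr_ge0 _ t0)).
Qed.

Let F : R := Rintegral mu setT (fun y => `|f y|).

(** The near part errs by at most [5 * alpha n <= 10], the part beyond distance 2 by at most
    [F / 2]; the bound passes to the limit of the truncations. *)
Lemma hilbert_witness_ge n x : (4 * n + 1)%:R <= x <= (4 * n + 2)%:R ->
  alpha n * `|sY (st n) x| <= `|hilbert f x| + (10 + F / 2).
Proof.
move=> xI; have [eta0 eta00 H] := symint_stage (leqnn n).
have [_ cv] := witness_hilbert_defined x.
apply/ler_addgt0Pr => e e0.
have nr : \forall eta \near 0^'+, 0 < eta < Num.min eta0 2.
  have m0 : 0 < Num.min eta0 2 by rewrite lt_min eta00 /= ltr0n.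
  near=> eta; apply/andP; split; near: eta; first exact: nbhs_right_gt.
  exact: (nbhs_right_lt m0).
have := cvgr_dist_le _ _ cv e e0 => nd.
have [eta [/andP[et0]]] := filter_ex (filterI nr (nd _)).
rewrite lt_min => /andP[et1 et2] dist.
have := H eta _ x xI; rewrite et0 et1 => /(_ isT) K.
have h2 : 2^-1 ^+ n >= 0 :> R by rewrite exprn_ge0// invr_ge0.
have {}K : `|symint (fun y => plateau n y * X n y) x eta - sY (st n) x| <= 5.
  by apply: le_trans K _; lra.
have E := hilbert_trunc_split x et0 (ltW et2) witness_cont witness_integrable.
have T := far_kernel_le x et0 (ltW et2) witness_cont witness_integrable.
rewrite -/F in T; set tail := Rintegral _ _ _ in E T.
have S : itg (fun t => (f (x - t) - f (x + t)) / Num.max eta t) eta 2 =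
    alpha n * symint (fun y => plateau n y * X n y) x eta.
  rewrite /symint -itgZ; last first.
    apply: cont_mul; last exact: cont_invmax.
    have c : continuous (fun y => plateau n y * X n y) by apply: cont_mul; [exact: plateau_cont|exact: X_cont].
    apply: cont_sub.
      by move=> t; apply: (@continuous_comp _ _ _ (fun t => x - t) (fun y => plateau n y * X n y));
        [apply: cvgB; [exact: cvg_cst|exact: cvg_id]|exact: c].
    by move=> t; apply: (@continuous_comp _ _ _ (fun t => x + t) (fun y => plateau n y * X n y));
      [apply: cvgD; [exact: cvg_cst|exact: cvg_id]|exact: c].
  apply: eq_itg => t /andP[t1 t2]; have t0 : 0 < t by apply: lt_le_trans t1.
  move: xI; rewrite !natrD => /andP[x1 x2].
  (* For [t <= 2] both [x - t] and [x + t] stay in [[4n-1, 4n+4]], where only the [n]-th bump is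
     present. *)
  by rewrite !(@witnessE n) ?le_max; [ring|apply/orP; right; lra|lra|apply/orP; right; lra|lra].
have aK : `|alpha n * (symint (fun y => plateau n y * X n y) x eta - sY (st n) x)| <= 10.
  by rewrite normrM (ger0_norm (alpha0 n)) (@le_trans _ _ (2 * 5))//; [apply: ler_pM|lra].
have -> : alpha n * `|sY (st n) x| = `|alpha n * sY (st n) x| by rewrite normrM (ger0_norm (alpha0 n)).
have -> : alpha n * sY (st n) x = hilbert f x - (hilbert f x - hilbert_trunc f x eta)
   - alpha n * (symint (fun y => plateau n y * X n y) x eta - sY (st n) x) - tail.
  by rewrite E S; ring.
apply: le_trans (ler_normB _ _) _; apply: le_trans (lerD (ler_normB _ _) T) _.
apply: le_trans (lerD (lerD (ler_normB _ _) aK) (lexx _)) _.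
by lra.
Unshelve. all: by end_near. Qed.

Hypothesis alpha_energy : forall M, exists n,
  M < alpha n `^ p * energy p (W n) (sY (st n)) (4 * n + 1)%:R (4 * n + 2)%:R.

Lemma hilbert_witness_infinite : weighted_norm p wgt (hilbert f) = +oo%E.
Proof.
have pp : 1 < p := p1; have p0 : 0 < p by lra.
pose C := 10 + F / 2.
have F0 : 0 <= F by apply: Rintegral_ge0.
have C0 : 0 <= C by rewrite addr_ge0// divr_ge0.
suff I : (\int[mu]_x (`|hilbert f x| `^ p * wgt x)%:E)%E = +oo%E.
  rewrite /weighted_norm I poweRE gt_eqF ?invr_gt0//.
apply/eqyP => M _.
(* It undoes [(u + C)^p <= 2^p (u^p + C^p)]; the factor 2 on [C^p] bounds the mass of [W n] on the
   unit interval. *)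
pose M' := 2 `^ p * (M + 2 * C `^ p).
have [n Mn] := alpha_energy M'.
set a : R := (4 * n + 1)%:R in Mn; set b : R := (4 * n + 2)%:R in Mn.
have ab : b - a = 1 by rewrite /a /b !natrD; lra.
have leab : a <= b by lra.
pose G x := 2 `^ (- p) * alpha n `^ p * (`|sY (st n) x| `^ p * W n x) + (- C `^ p) * W n x.
have bY : buc (sY (st n)) by case: (st_inv n).
have cW : continuous (W n) by apply: buc_cont; case: (st_inv n).
have cYW : continuous (fun x => `|sY (st n) x| `^ p * W n x).
  apply: cont_mul => // x.
  apply: (@continuous_comp _ _ _ (sY (st n)) (fun t => `|t| `^ p)); first exact: buc_cont.
  exact: (continuous_normpow p1).
have c1 : continuous (fun x => 2 `^ (- p) * alpha n `^ p * (`|sY (st n) x| `^ p * W n x)).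
  by apply: cont_mul => //; exact: cst_continuous.
have cG : continuous G.
  by apply: cont_add => //; apply: cont_mul => //; exact: cst_continuous.
have P2 : 0 < 2 `^ p :> R by exact: powR_gt0.
have W2 : itg (W n) a b <= 2.
  have -> : itg (W n) a b = itg wgt a b.
    apply: esym; apply: (itg_limit tW).
    by rewrite /b ler_nat leq_add2l.
  by apply: le_trans (itg_limit_le tW _) _; rewrite ab; lra.
have GE : M <= itg G a b.
  rewrite itgDZ// itgZ// -/(energy p (W n) (sY (st n)) a b).
  have : 2 `^ (- p) * M' <= 2 `^ (- p) * (alpha n `^ p * energy p (W n) (sY (st n)) a b).
    by rewrite ler_wpM2l ?powR_ge0// ltW.
  rewrite /M' mulrA powRN mulVf ?gt_eqF// mul1r mulrA.
  have : C `^ p * itg (W n) a b <= C `^ p * 2 by rewrite ler_wpM2l// powR_ge0.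
  by move=> *; lra.
apply: (@le_trans _ _ (itg G a b)%:E); first by rewrite lee_fin.
apply: le_integral_itg => //.
  by move=> x; rewrite mulr_ge0 ?powR_ge0// ltW.
move=> x xI.
have -> : wgt x = W n x.
  apply: (limitE tW); move: xI => /andP[_ h]; apply: le_trans h _.
  by rewrite /b ler_nat leq_add2l.
have Wx : 0 < W n x by exact: posb_gt0 (tow_pos tW n).
have -> : G x = (2 `^ (- p) * (alpha n * `|sY (st n) x|) `^ p - C `^ p) * W n x.
  by rewrite /G powRM//; ring.
rewrite ler_wpM2r ?(ltW Wx)// lerBlDr powRN ler_pdivrMl//.
have := hilbert_witness_ge xI; rewrite -/C; set u := `|hilbert f x| => h.
have u0 : 0 <= u by exact: normr_ge0.
have {}h : alpha n * `|sY (st n) x| <= 2 * Num.max u C.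
  by apply: le_trans h _; rewrite mulr_natl mulr2n lerD// le_max lexx ?orbT.
have m0 : 0 <= Num.max u C by rewrite le_max u0.
apply: (@le_trans _ _ ((2 * Num.max u C) `^ p)).
  by apply: ge0_ler_powR; rewrite ?nnegrE ?(ltW p0) ?mulr_ge0.
rewrite powRM// ler_pM2l//.
by case: (leP u C) => _; [rewrite lerDr powR_ge0|rewrite lerDl powR_ge0].
Qed.

End witness.

(** * Doubling and joint A_p for the limit weights *)

Section tower_doubling.
Context {R : realType}.
Variables (gam : R) (lam : nat -> R).
Hypotheses (gam0 : 0 < gam) (gam8 : gam <= 8^-1).
Hypotheses (lamS : forall k, lam k.+1 <= lam k) (lam2 : forall k, lam k.+1 <= 2^-1 ^+ k).

(** The interval and its double are compared with the same value, that of [U k] at the common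
    centre, so only powers of [1 +- gam] and the ratio 2 of the lengths remain. *)
Lemma doubling_limit U delta : tower gam lam U ->
  2 * ((1 + gam) / (1 - gam)) ^+ 3 <= 2 + delta ->
  (doubling_constant (limit U) <= (2 + delta)%:E)%E.
Proof.
move=> tU gd; have g08 : 0 < gam <= 8^-1 by rewrite gam0.
apply: (doubling_le g08 gd); first exact: limit_cont tU.
move=> a b ab; have L0 : 0 < b - a by rewrite subr_gt0.
have [k sk] := at_scale_exists lam2 L0.
exists (U k ((a + b) / 2)); first by apply: posb_gt0; exact: tow_pos tU k.
split.
  have := @scale_bounds _ _ _ gam0 gam8 lamS _ tU _ _ ((a + b) / 2) a b L0 sk (lexx _).
  move=> H; suff /H /andP[] : forall x, a <= x <= b -> `|x - (a + b) / 2| <= b - a by [].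
  by move=> x /andP[h1 h2]; rewrite ler_norml; apply/andP; split; lra.
have := @scale_bounds _ _ _ gam0 gam8 lamS _ tU _ _ ((a + b) / 2)
  ((a + b) / 2 - (b - a)) ((a + b) / 2 + (b - a)) L0 sk.
have -> : (a + b) / 2 + (b - a) - ((a + b) / 2 - (b - a)) = 2 * (b - a) by field.
move=> H; suff h : forall x, (a + b) / 2 - (b - a) <= x <= (a + b) / 2 + (b - a) ->
    `|x - (a + b) / 2| <= b - a.
  by have /andP[] := H (ltac:(lra)) h.
by move=> x /andP[h1 h2]; rewrite ler_norml; apply/andP; split; lra.
Qed.

(** Both towers share the scales [lam], so one [k] serves both and the product of the reference
    values is [apZ] at the midpoint. *)
Lemma joint_bounds X W p a b : tower gam lam X -> tower gam lam W ->
  (forall k x, apZ p (X k) (W k) x <= 1) -> a < b ->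
  exists C S, [/\ 0 < C, 0 < S, C * S `^ (p - 1) <= 1,
    itg (limit W) a b <= (1 + gam) ^+ 3 * C * (b - a) &
    itg (limit X) a b <= (1 + gam) ^+ 3 * S * (b - a)].
Proof.
move=> tX tW Z1 ab; have L0 : 0 < b - a by rewrite subr_gt0.
have [k sk] := at_scale_exists lam2 L0; pose c := (a + b) / 2.
have xc x : a <= x <= b -> `|x - c| <= b - a.
  by move=> /andP[h1 h2]; rewrite /c ler_norml; apply/andP; split; lra.
exists (W k c), (X k c); split.
- by apply: posb_gt0; exact: tow_pos tW k.
- by apply: posb_gt0; exact: tow_pos tX k.
- exact: Z1.
- by have /andP[] := scale_bounds gam0 gam8 lamS tW L0 sk (lexx _) xc.
- by have /andP[] := scale_bounds gam0 gam8 lamS tX L0 sk (lexx _) xc.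
Qed.

Lemma continuous_powR_pos (g : R -> R) q : continuous g -> (forall x, 0 < g x) ->
  continuous (fun x => g x `^ q).
Proof.
move=> cg g0.
have -> : (fun x => g x `^ q) = (fun x => expR (q * ln (g x))).
  by apply/funext => x; rewrite /powR gt_eqF.
move=> x; apply: (@continuous_comp _ _ _ (fun x => q * ln (g x)) (@expR R)).
  apply: cvgM; first exact: cvg_cst.
  apply: (@continuous_comp _ _ _ g (@ln R)); first exact: cg.
  exact: continuous_ln.
exact: continuous_expR.
Qed.

End tower_doubling.

Theorem theorem1p4 (R : realType) (p delta : R)
    (p_gt1 : 1 < p) (delta_gt0 : 0 < delta) :
  exists w v : R -> R,
    is_weight w /\ is_weight v /\ is_weight (dual_weight p v) /\
    (joint_Ap p w v < +oo)%E /\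
    (doubling_constant w <= (2 + delta)%:E)%E /\
    (doubling_constant (dual_weight p v) <= (2 + delta)%:E)%E /\
    ~ bounded_weighted_Lp p v w hilbert /\
    exists f : R -> R, weighted_Lp p v f /\
      {ae (@lebesgue_measure R), forall x, hilbert_defined f x} /\
      weighted_norm p w (hilbert f) = +oo%E.
Proof.
have [gam g08 gd] := exists_gam delta_gt0.
have /andP[gam0 gam8] := g08.
have p0 : 0 < p by lra.
(* Dividing by [p] makes both relative increments, [eps] for [X] and [eps * (p - 1)] for [W], at
   most [gam]. *)
pose eps := gam / p.
have eps0 : 0 < eps by rewrite divr_gt0.
have epsp : eps * p = gam by rewrite /eps divfK// gt_eqF.
have epsg : eps <= gam by rewrite -epsp ler_peMr// ltW.
have epsbg : eps * (p - 1) <= gam by rewrite -epsp ler_pM2l//; lra.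
have [st [st0 sti str]] := stages_exist p_gt1 eps0 (le_trans epsg gam8) (le_trans epsbg gam8) gam0.
have [alpha [a0 asum aE]] := summable_weights p0 (energy_unbounded p_gt1 eps0 st0 sti str).
have tX := towerX eps0 epsg st0 sti str.
have tW := towerW p_gt1 eps0 epsbg st0 sti str.
set lam := fun k => slam (st k) in tX tW.
have lamS : forall k, lam k.+1 <= lam k := stage_lamS str.
have lam2 : forall k, lam k.+1 <= 2^-1 ^+ k := stage_lam2 str.
set sig := limit (fun k => sX (st k)); set w := limit (fun k => sW (st k)).
have sig_gt0 x : 0 < sig x := limit_gt0 tX x.
have w_gt0 x : 0 < w x := limit_gt0 tW x.
have sig_cont : continuous sig := limit_cont tX.
have w_cont : continuous w := limit_cont tW.
pose v x := sig x `^ (- (p - 1)).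
have v_gt0 x : 0 < v x by exact: powR_gt0.
have dual : dual_weight p v = sig.
  apply/funext => x; rewrite /dual_weight /v -powRrM mulrNN mulfV ?powRr1// ?(ltW (sig_gt0 x))//.
  by rewrite subr_eq0 gt_eqF.
pose f := witness st alpha.
have wf : weighted_Lp p v f by exact: (witness_weighted p_gt1 eps0 epsg gam0 gam8 st0 sti str a0 asum).
have infinite : weighted_norm p w (hilbert f) = +oo%E.
  exact: (hilbert_witness_infinite p_gt1 eps0 epsg epsbg gam0 gam8 st0 sti str a0 asum aE).
exists w, v; rewrite dual; split; [|split; [|split; [|split; [|split; [|split; [|split]]]]]].
- exact: continuous_is_weight.
- by apply: continuous_is_weight => //; exact: continuous_powR_pos.
- exact: continuous_is_weight.
- apply: (joint_Ap_lt_pinfty p_gt1 g08 w_cont sig_cont w_gt0 sig_gt0 dual) => a b ab.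
  apply: (joint_bounds gam0 gam8 lamS lam2 tX tW _ ab) => k x.
  by case: (sti k).
- exact: (doubling_limit gam0 gam8 lamS lam2 tW gd).
- exact: (doubling_limit gam0 gam8 lamS lam2 tX gd).
- move=> [C /(_ f wf)]; rewrite infinite leye_eq => /eqP.
  case: wf => _; have : (0 <= weighted_norm p v f)%E by exact: poweR_ge0.
  by case: (weighted_norm p v f) => [r| |].
- exists f; split=> //; split => //.
  apply: aeW => x.
  exact: (witness_hilbert_defined eps0 epsg gam0 gam8 st0 sti str a0 asum).
Qed.
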